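(* There is a universal constant $C\in(0,+\infty)$ such that the following holds. For any graph $\mathsf G=(\mathsf V,\mathsf E)$ (countable, locally finite, oriented, symmetric, connected) equipped with independent square-integrable positive random resistances $r(e)\sim\mu_e$, $e\in\mathsf E_{1/2}$, define in $[0,+\infty]$ $$K(\mu)=C\,\sup_{e}\left(\mathbb E[r^8(e)]+\mathbb E[r^{-8}(e)]\right)^6\ \sup_e\frac{\mathbb E\left[(r(e)-r'(e))^2\left(\frac1{r^6(e)}+r^6(e)\right)\right]}{\mathbb E\left[(r(e)-r'(e))_+^2\min\left\{1,\frac1{r^4(e)}\right\}\right]},$$ where the suprema run over $e\in\mathsf E_{1/2}$ and $r'$ is an independent copy of $r$. Then, for any pair of distinct vertices $(u,v)$, $$\sum_{S}|S|^2\,\|\mathcal R^{u,v}_S\|_2^2\le K(\mu)\sum_{S\ne\varnothing}\|\mathcal R^{u,v}_S\|_2^2 .$$ Consequently, for any $k\ge1$ and any pair of distinct vertices $(u,v)$, $$\sum_{|S|\ge k}\|\mathcal R^{u,v}_S\|_2^2\le\frac{K(\mu)}{k^2}\sum_{S\ne\varnothing}\|\mathcal R^{u,v}_S\|_2^2 .$$ All sums run over finite subsets $S$ of $\mathsf E_{1/2}$.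
   Context: Graphs: $\mathsf G=(\mathsf V,\mathsf E)$ is a countable, locally finite, oriented, symmetric, connected graph without loops; each edge $e=(e_-,e_+)\in\mathsf E\subset\mathsf V^2$ occurs together with $-e=(e_+,e_-)$. $\mathsf E_{1/2}\subset\mathsf E$ contains exactly one of $e,-e$ for every edge. For $r\in(0,\infty)^{\mathsf E_{1/2}}$, $\ell^2_-(\mathsf E,r)$ is the Hilbert space of functions $\theta:\mathsf E\to\mathbb R$ with $\theta(-e)=-\theta(e)$ and $\sum_{e\in\mathsf E_{1/2}}r(e)\theta(e)^2<\infty$. With $d^*\theta(x)=\sum_{e_-=x}\theta(e)$, a unit flow from $u$ to $v$ ($u\neq v$) is $\theta\in\ell^2_-(\mathsf E,r)$ with $d^*\theta=\mathbf 1_u-\mathbf 1_v$. The effective resistance is $$\mathcal R^{u,v}(r)=\inf\Big\{\sum_{e\in\mathsf E_{1/2}}r(e)\theta(e)^2:\ \theta\in \ell^2_-(\mathsf E,r)\text{ a unit flow from }u\text{ to }v\Big\}.$$ Randomness: $r=(r(e))_{e\in\mathsf E_{1/2}}$ has law $\mathbb P=\bigotimes_{e\in\mathsf E_{1/2}}\mu_e$, where each $\mu_e$ is a probability measure on $(0,\infty)$ with finite second moment. Walsh (Efron–Stein) decomposition: for $f\in L^2(\mathbb P)$ and a finite $S\subset\mathsf E_{1/2}$, $$f_S(r)=\sum_{T\subset S}(-1)^{|S\setminus T|}\,\mathbb E[f(r)\mid (r(e))_{e\in T}].$$ $\mathcal R^{u,v}_S$ denotes $f_S$ for $f=\mathcal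 R^{u,v}$; $\|\cdot\|_2$ is the $L^2(\mathbb P)$ norm. Conventions: inequalities are in $[0,\infty]$; $0/0=0$ and $0\cdot\infty=0$. *)

(* Defs.v *)
From HB Require Import structures.
From mathcomp Require Import all_boot all_order all_algebra finmap.
From mathcomp Require Import all_classical all_reals all_analysis.

Set Implicit Arguments.
Unset Strict Implicit.
Unset Printing Implicit Defensive.

Import Order.TTheory GRing.Theory Num.Theory.
Import numFieldNormedType.Exports.

Local Open Scope classical_set_scope.
Local Open Scope ring_scope.

(* The oriented edges are the ordered pairs of adjacent vertices. *)
Record graph := Graph {
  vertex :> countType;
  adj : rel vertex;
  adj_sym : symmetric adj;
  adj_irr : irreflexive adj;
  adj_locfin : forall x, finite_set [set y | adj x y];
  adj_connected : forall x y, exists2 p, path adj x p & last x p = y }.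

Definition edge (G : graph) := {e : G * G | adj e.1 e.2}.

Definition edge_src (G : graph) (e : edge G) : G := (sval e).1.

Lemma opp_edge_subproof (G : graph) (e : edge G) :
  adj ((sval e).2, (sval e).1).1 ((sval e).2, (sval e).1).2.
Proof. by rewrite /= adj_sym (svalP e). Qed.

Definition opp_edge (G : graph) (e : edge G) : edge G :=
  exist _ ((sval e).2, (sval e).1) (opp_edge_subproof e).

(* [H] contains exactly one of [e], [- e] for every edge [e]. *)
Definition is_half (G : graph) (H : pred (edge G)) :=
  forall e, H e (+) H (opp_edge e).

Definition half_edge (G : graph) (H : pred (edge G)) := {e : edge G | H e}.


Section resistance.
Context {R : realType} {G : graph} {H : pred (edge G)}.
Implicit Types (r : half_edge H -> R) (theta : edge G -> R) (u v x : G).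

Definition energy r theta : \bar R :=
  \esum_(e in [set: half_edge H]) (r e * theta (sval e) ^+ 2)%:E.

Definition ell2_minus r : set (edge G -> R) :=
  [set theta | (forall e, theta (opp_edge e) = - theta e) /\
               (energy r theta < +oo)%E].

(* A finite sum, by local finiteness. *)
Definition divergence theta x : R :=
  \sum_(e \in [set e : edge G | edge_src e = x]) theta e.

Definition unit_flow r u v : set (edge G -> R) :=
  [set theta | ell2_minus r theta /\
     forall x, divergence theta x = (x == u)%:R - (x == v)%:R].

Definition eff_res u v r : R :=
  fine (ereal_inf [set energy r theta | theta in unit_flow r u v]).

End resistance.

Section walsh.
Context {R : realType} {d : measure_display} {Omega : measurableType d}.
Variable P : probability Omega R.

(* [g] is a version of the conditional expectation of [f] given the
   sub-sigma-algebra [F]. *)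
Definition is_cond_exp (F : set (set Omega)) (f g : Omega -> R) :=
  [/\ forall B : set R, measurable B -> F (g @^-1` B),
      P.-integrable setT (EFin \o g) &
      forall A, F A ->
        (\int[P]_(w in A) (g w)%:E = \int[P]_(w in A) (f w)%:E)%E].

(* An arbitrary version; two versions agree almost surely. *)
Definition cond_exp (F : set (set Omega)) (f : Omega -> R) : Omega -> R :=
  xget (cst 0) [set g | is_cond_exp F f g].

Context {I : choiceType}.
Variable r : I -> {RV P >-> R}.

Definition mutually_independent :=
  forall (S : {fset I}) (B : I -> set R), (forall i, measurable (B i)) ->
    P (\bigcap_(i in [set` S]) (r i @^-1` B i)) =
    (\prod_(i <- S) P (r i @^-1` B i))%E.

Definition sigma_of (T : {fset I}) : set (set Omega) :=
  <<s \bigcup_(i in [set` T]) preimage_set_system setT (r i) measurable >>.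

Definition walsh (f : Omega -> R) (S : {fset I}) (w : Omega) : R :=
  \sum_(T <- fpowerset S)
    (-1) ^+ #|` (S `\` T)%fset| * cond_exp (sigma_of T) f w.

Definition sqnorm2 (f : Omega -> R) : \bar R :=
  ('N[P]_2%:E[EFin \o f] ^+ 2)%E.

End walsh.

Section constant.
Local Open Scope ereal_scope.
Context {R : realType} {I : Type}.
Variable mu : I -> probability R R.

(* In the double integrals, [z.1] stands for [r(e)] and [z.2] for the
   independent copy [r'(e)].  Since [0^-1 = +oo], [+oo * 0 = 0] and
   [x * +oo = +oo] for [0 < x], the quotient is the one of [0, +oo] with
   [0 / 0 = 0]. *)
Definition ratio (i : I) : \bar R :=
  (\int[mu i \x mu i]_z ((z.1 - z.2) ^+ 2 * (1 / z.1 ^+ 6 + z.1 ^+ 6))%:E) /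
  (\int[mu i \x mu i]_z
     (Num.max (z.1 - z.2) 0 ^+ 2 * Num.min 1 (1 / z.1 ^+ 4))%:E).

Definition Kconst (C : R) : \bar R :=
  C%:E *
  ereal_sup [set ('E_(mu i)[(fun x : R => x ^+ 8)%R] +
                  'E_(mu i)[(fun x : R => x ^- 8)%R]) | i in [set: I]] ^+ 6 *
  ereal_sup [set ratio i | i in [set: I]].

End constant.

(* Main.v *)
(* Write [w S] for the squared norm of the component on [S].  By Cauchy-Schwarz it is
   enough to bound [\sum_S |S| (|S| - 1) w S] by [A \sum_S |S| w S]; here the left-hand
   side is a sum of squared mixed second differences of the effective resistance and the
   right-hand side a sum of squared first differences.

   For finitely many edges the resistance is the minimum of a positive quadratic form on
   an affine space, and changing one resistance is a rank-one perturbation.  With [theta]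
   the minimizing flow, [gam] the projection kernel on cycles and [m s] the distortion
   [max (s / x e) (x e / s)], this gives
   (mixed difference)^2 <= 2 G e e' (Z_e m^2 m'^4 + Z_e' m'^2 m^4), where [Z_e] is the
   squared first difference and [G e e' = x e * x e' * (gam e e')^2] has row sums at
   most [1] because [gam] is a projection.  Summing over [e'] loses nothing in the number
   of edges.  Squared differences may be computed from a reference configuration with
   typical values of [r e], for which the distortions are controlled by the eighth
   moments, and the remaining factor [Z_e m^4] is compared with [Z_e] edge by edge, through
   the ratio of the statement.

   The infinite graph is exhausted by the problems in which flow conservation is only
   required at the first [n] vertices: their minimal energies increase to the effective
   resistance, and they are bounded by the energy of a flow along a path, which is
   linear in the resistances and hence square integrable. *)
Require Import Defs.
From HB Require Import structures.
From mathcomp Require Import all_boot all_order all_algebra finmap.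
From mathcomp Require Import ring lra.
From mathcomp Require Import all_classical all_reals all_analysis.
From mathcomp Require Import measurable_realfun.
Set Implicit Arguments.
Unset Strict Implicit.
Unset Printing Implicit Defensive.
Import Order.TTheory GRing.Theory Num.Theory.
Import numFieldNormedType.Exports.
Local Open Scope classical_set_scope.
Local Open Scope ring_scope.

(** * Möbius inversion on finite subsets *)

(** The constant obtained for [A] is [2048 M^2 lam] with [lam^2 = M rho], where [M] bounds the
    moments and [rho] the ratios. Hence [(1 + A)^2] is of order [M^5 rho]: the ratio enters to the
    first power, and one of the six powers of the moments is to spare. The square root comes from an
    AM-GM weight: a squared distortion is at most [lam / 2 + m^4 / (2 lam)], and only the second
    half is paid for by the ratio.

    The sample space has no product structure and the Walsh components use arbitrary versions of
    conditional expectations. Estimates are therefore made on the pointwise functional [cond], which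
    integrates out the free coordinates of a configuration; [phi] records its squared norms, and
    their Möbius transform gives the norms of the Walsh components. What passes to the limit is thus
    an inequality between real numbers indexed by finite sets.

    The conventions of [[0, +oo]] matter at the end: for deterministic resistances [K] is 0 even if
    the moments are unbounded, so this case is settled separately. *)

Section moebius.
Local Open Scope fset_scope.
Local Open Scope ring_scope.
Context {R : numDomainType} {J : choiceType}.
Implicit Types (phi : {fset J} -> R) (S T F : {fset J}).

Lemma big_fpowersetU1 (i : J) S (X : {fset J} -> R) : i \notin S ->
  \sum_(T <- fpowerset (i |` S)) X T =
  \sum_(T <- fpowerset S) X T + \sum_(T <- fpowerset S) X (i |` T).
Proof.
move=> iS.
have niT T : T \in fpowerset S -> i \notin T.
  by rewrite fpowersetE => /fsubsetP TS; apply: contra iS => /TS.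
rewrite -[X in _ + X](big_map (fun T => i |` T) predT X) -big_cat/=.
apply: perm_big; apply: uniq_perm; first exact: fset_uniq.
  rewrite cat_uniq fset_uniq /=; apply/andP; split.
    apply/hasPn => _ /mapP[T TS ->]; apply/negP => /niT.
    by rewrite fset1U1.
  rewrite map_inj_in_uniq ?fset_uniq// => T T' TS TS' TT'.
  by rewrite -(fsetU1K (niT _ TS)) TT' fsetU1K// niT.
move=> T; rewrite mem_cat !fpowersetE.
have [iT|iT] := boolP (i \in T).
  have -> : (T `<=` S) = false.
    by apply/negbTE; apply: contra iS => /fsubsetP /(_ i iT).
  apply/idP/mapP => [TiS|[T' + ->]].
    exists (T `\ i); last by rewrite fsetD1K.
    by rewrite fpowersetE fsubDset.
  by rewrite fpowersetE => T'S; rewrite fsetUS.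
have -> : (T \in [seq i |` T0 | T0 <- fpowerset S]) = false.
  by apply/negbTE/mapP => -[T' _ TE]; rewrite TE fset1U1 in iT.
rewrite orbF; apply/idP/idP => [/fsubsetP TiS|TS].
  apply/fsubsetP => j jT; have := TiS j jT; rewrite in_fset1U.
  by case/orP => // /eqP ji; rewrite -ji jT in iT.
exact: (fsubset_trans TS (fsubsetU1 _ _)).
Qed.

Definition moebius phi S :=
  \sum_(T <- fpowerset S) (-1) ^+ #|` (S `\` T)| * phi T.

(** Adding a point to [S] takes a discrete derivative of [phi] in that direction. The identities
    below rest on this recursion. *)
Lemma moebiusU1 phi i S : i \notin S ->
  moebius phi (i |` S) = moebius (fun T => phi (i |` T)) S - moebius phi S.
Proof.
move=> iS; rewrite /moebius big_fpowersetU1// addrC; congr (_ + _).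
  rewrite big_seq [RHS]big_seq; apply: eq_bigr => T.
  rewrite fpowersetE => /fsubsetP TS; congr ((-1) ^+ #|` _| * _).
  apply/fsetP => j; rewrite !in_fsetD !in_fset1U.
  by case: eqVneq => //= ->; rewrite (negbTE iS) andbF.
rewrite -sumrN big_seq [RHS]big_seq; apply: eq_bigr => T.
rewrite fpowersetE => /fsubsetP TS.
have iT : i \notin T by apply: contra iS => /TS.
have -> : (i |` S) `\` T = i |` (S `\` T).
  apply/fsetP => j; rewrite !(in_fsetD, in_fset1U).
  by case: eqVneq => //= ->; rewrite iT.
by rewrite cardfsU1 in_fsetD iT (negbTE iS) /= exprS mulN1r mulNr.
Qed.

Lemma fset_indU1 (Q : {fset J} -> Prop) : Q fset0 ->
  (forall i S, i \notin S -> Q S -> Q (i |` S)) -> forall S, Q S.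
Proof.
move=> Q0 QU S; elim: {S}_.+1 {-2}S (ltnSn #|` S|) => // n IH S Sn.
have [->//|/fset0Pn[i iS]] := eqVneq S fset0.
rewrite -(fsetD1K iS); apply: QU; first by rewrite fsetD11.
by apply: IH; move: Sn; rewrite (cardfsD1 i) iS.
Qed.

Lemma sum_moebius F phi : \sum_(S <- fpowerset F) moebius phi S = phi F.
Proof.
elim/fset_indU1: F phi => [|i F iF IH] phi.
  rewrite fpowerset0 big_seq_fset1 /moebius fpowerset0 big_seq_fset1.
  by rewrite fsetDv cardfs0 expr0 mul1r.
rewrite big_fpowersetU1// -big_split/= -[RHS](IH (fun T => phi (i |` T))).
rewrite big_seq [RHS]big_seq; apply: eq_bigr => S.
rewrite fpowersetE => /fsubsetP SF.
by rewrite moebiusU1 1?addrC ?subrK//; apply: contra iF => /SF.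
Qed.

(** Subsets avoiding [e] contribute nothing and those containing it telescope. When [phi] gives the
    squared norms of conditional expectations, this is the influence of [e]. *)
Lemma sum_moebius_mem F phi e : e \in F ->
  \sum_(S <- fpowerset F) (e \in S)%:R * moebius phi S = phi F - phi (F `\ e).
Proof.
move=> eF; rewrite -{1}(fsetD1K eF) big_fpowersetU1 ?fsetD11//.
have nS S : S \in fpowerset (F `\ e) -> e \notin S.
  rewrite fpowersetE => /fsubsetP SF; apply/negP => /SF.
  by rewrite fsetD11.
rewrite big_seq big1 ?add0r => [|S /nS/negbTE->]; last by rewrite mul0r.
rewrite -{2}(fsetD1K eF) -(sum_moebius (F `\ e) (fun T => phi (e |` T))).
rewrite -(sum_moebius (F `\ e) phi) -sumrB.
rewrite big_seq [RHS]big_seq; apply: eq_bigr => S /nS eS.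
by rewrite fset1U1 mul1r moebiusU1.
Qed.

Lemma sum_moebius_mem2 F phi e e' : e \in F -> e' \in F -> e != e' ->
  \sum_(S <- fpowerset F) (e \in S)%:R * (e' \in S)%:R * moebius phi S =
  phi F - phi (F `\ e) - phi (F `\ e') + phi ((F `\ e) `\ e').
Proof.
move=> eF eF' ee'; rewrite -{1}(fsetD1K eF) big_fpowersetU1 ?fsetD11//.
have nS S : S \in fpowerset (F `\ e) -> e \notin S.
  rewrite fpowersetE => /fsubsetP SF; apply/negP => /SF.
  by rewrite fsetD11.
rewrite big_seq big1 ?add0r => [|S /nS/negbTE->]; last by rewrite !mul0r.
have e'F : e' \in F `\ e by rewrite in_fsetD1 eq_sym ee'.
transitivity (\sum_(S <- fpowerset (F `\ e)) (e' \in S)%:R *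
   moebius (fun T => phi (e |` T)) S -
  \sum_(S <- fpowerset (F `\ e)) (e' \in S)%:R * moebius phi S).
  rewrite -sumrB big_seq [RHS]big_seq; apply: eq_bigr => S /nS eS.
  rewrite fset1U1 mul1r moebiusU1// mulrBr.
  by rewrite in_fset1U eq_sym (negbTE ee').
rewrite !sum_moebius_mem// fsetD1K//.
have -> : e |` ((F `\ e) `\ e') = F `\ e'.
  rewrite -[in RHS](fsetD1K eF); apply/fsetP => j.
  rewrite !(in_fsetD1, in_fset1U); case: (eqVneq j e) => [->|]//=.
  by rewrite ee'.
by ring.
Qed.

(** If some [i] in [S] lies outside [T], the function of [T'] ignores [i], so its discrete
    derivative in that direction is zero. *)
Lemma moebius_meet phi S T : T `<=` S ->
  moebius (fun T' => phi (T' `&` T)) S = (T == S)%:R * moebius phi S.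
Proof.
move=> TS; case: eqVneq => [->|TnS].
  rewrite mul1r /moebius big_seq [RHS]big_seq; apply: eq_bigr => T'.
  by rewrite fpowersetE => /fsetIidPl ->.
have [i iS iT] : exists2 i, i \in S & i \notin T.
  by apply/fsubsetPn; move: TnS; rewrite eqEfsubset TS.
rewrite mul0r -(fsetD1K iS) moebiusU1 ?fsetD11//.
apply/eqP; rewrite subr_eq0; apply/eqP; apply: eq_bigr => T' _.
congr (_ * phi _); apply/fsetP => j; rewrite !(in_fsetI, in_fset1U).
by case: eqVneq => //= ->; rewrite (negbTE iT) !andbF.
Qed.

(** The square of a Walsh component expands into products of conditional expectations given [T] and
    [T'], whose means depend only on the intersection; this collapses the double sum. *)
Lemma sum_sign_meet phi S :
  \sum_(T <- fpowerset S) \sum_(T' <- fpowerset S)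
    (-1) ^+ #|` (S `\` T)| * (-1) ^+ #|` (S `\` T')| * phi (T `&` T') =
  moebius phi S.
Proof.
transitivity (\sum_(T <- fpowerset S) (T == S)%:R * moebius phi S).
  rewrite big_seq [RHS]big_seq; apply: eq_bigr => T; rewrite fpowersetE => TS.
  transitivity ((-1) ^+ #|` (S `\` T)| * moebius (fun T' => phi (T' `&` T)) S).
    rewrite /moebius mulr_sumr; apply: eq_bigr => T' _.
    by rewrite mulrA fsetIC.
  rewrite moebius_meet//; case: eqVneq => [->|]; last by rewrite !mul0r mulr0.
  by rewrite fsetDv cardfs0 expr0 !mul1r.
have SS : S \in fpowerset S by rewrite fpowersetE.
rewrite (big_fsetD1 S)//= eqxx mul1r big_seq big1 ?addr0// => T.
by rewrite in_fsetD1 => /andP[/negbTE-> _]; rewrite mul0r.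
Qed.

Lemma sum_mem_card F S : S `<=` F -> \sum_(e <- F) (e \in S)%:R = #|` S|%:R :> R.
Proof.
move=> SF; rewrite (big_fsetID _ (mem S))/= -natr_sum -natr_sum.
rewrite [X in _ + X%:R]big_seq [X in _ + X%:R]big1 ?addr0; last first.
  by move=> e; rewrite !inE/= => /andP[_ /negbTE->].
congr (_%:R); rewrite big_seq (eq_bigr (fun=> 1%N)); last first.
  by move=> e; rewrite !inE/= => /andP[_ ->].
rewrite -big_seq sum1_size; congr (size (enum_fset _)); apply/fsetP => e.
rewrite !inE/=; case: (boolP (e \in S)); rewrite ?andbT ?andbF// => eS.
by rewrite (fsubsetP SF).
Qed.

Lemma sum_card_moebius F phi :
  \sum_(S <- fpowerset F) #|` S|%:R * moebius phi S =
  \sum_(e <- F) (phi F - phi (F `\ e)).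
Proof.
transitivity (\sum_(S <- fpowerset F) \sum_(e <- F) (e \in S)%:R * moebius phi S).
  rewrite big_seq [RHS]big_seq; apply: eq_bigr => S; rewrite fpowersetE => SF.
  by rewrite -mulr_suml sum_mem_card.
rewrite exchange_big/= big_seq [RHS]big_seq; apply: eq_bigr => e eF.
exact: sum_moebius_mem.
Qed.

(** The square of the cardinal counts ordered pairs: the diagonal yields first differences, the rest
    mixed second differences. *)
Lemma sum_card2_moebius F phi :
  \sum_(S <- fpowerset F) #|` S|%:R ^+ 2 * moebius phi S =
  \sum_(e <- F) (phi F - phi (F `\ e)) +
  \sum_(e <- F) \sum_(e' <- F | e' != e)
    (phi F - phi (F `\ e) - phi (F `\ e') + phi ((F `\ e) `\ e')).
Proof.
transitivity (\sum_(S <- fpowerset F) \sum_(e <- F) \sum_(e' <- F)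
    (e \in S)%:R * (e' \in S)%:R * moebius phi S).
  rewrite big_seq [RHS]big_seq; apply: eq_bigr => S; rewrite fpowersetE => SF.
  rewrite -(sum_mem_card SF) expr2.
  rewrite !mulr_suml; apply: eq_bigr => e _.
  by rewrite [X in X * _]mulr_sumr mulr_suml.
rewrite exchange_big/= -big_split/= big_seq [RHS]big_seq.
apply: eq_bigr => e eF; rewrite exchange_big/= (big_fsetD1 e)//=.
congr (_ + _).
  rewrite -(sum_moebius_mem phi eF); apply: eq_bigr => S _.
  by case: (e \in S); rewrite ?mul0r ?mul1r ?mul0r.
rewrite [RHS]big_mkcond [RHS](big_fsetD1 e)//= eqxx add0r big_seq [RHS]big_seq.
apply: eq_bigr => e'; rewrite in_fsetD1 => /andP[e'e e'F].
by rewrite e'e; apply: sum_moebius_mem2 => //; rewrite eq_sym.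
Qed.

End moebius.

(** * Conditioning on finitely many independent coordinates *)

Section decoupling.
Context {R : realType} d d1 d2 (Omega : measurableType d)
  (T1 : measurableType d1) (T2 : measurableType d2) (P : probability Omega R).

(** Factorization on rectangles makes the joint law the product of the marginals; Tonelli then
    replaces the shared sample point by two independent ones. *)
Lemma ge0_integral_indep (X1 : Omega -> T1) (X2 : Omega -> T2)
    (h : T1 * T2 -> \bar R) :
  measurable_fun setT X1 -> measurable_fun setT X2 ->
  (forall A B, measurable A -> measurable B ->
    P (X1 @^-1` A `&` X2 @^-1` B) = P (X1 @^-1` A) * P (X2 @^-1` B))%E ->
  measurable_fun setT h -> (forall z, 0 <= h z)%E ->
  (\int[P]_w h (X1 w, X2 w) = \int[P]_w \int[P]_w' h (X1 w, X2 w'))%E.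
Proof.
move=> mX1 mX2 ind mh h0.
have mX : measurable_fun setT (fun w => (X1 w, X2 w)).
  exact: measurable_fun_pair.
pose m1 : probability T1 R := distribution P (mfun_Sub (mem_set mX1)).
pose m2 : probability T2 R := distribution P (mfun_Sub (mem_set mX2)).
pose m : probability _ R := distribution P (mfun_Sub (mem_set mX)).
transitivity (\int[m]_z h z)%E.
  by rewrite ge0_integral_distribution.
transitivity (\int[m1 \x m2]_z h z)%E.
  apply: eq_measure_integral => A mA _; apply/esym.
  apply: (product_measure_unique (m' := m)).
    by move=> B C mB mC; exact: ind.
  by [].
rewrite fubini_tonelli1// ge0_integral_distribution //; last 2 first.
- exact: measurable_fun_fubini_tonelli_F.
- by move=> y; apply: integral_ge0.
apply: eq_integral => w _; rewrite /= /fubini_F ge0_integral_distribution//.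
exact: measurableT_comp.
Qed.
End decoupling.

Section independence.
Context {R : realType} d (Omega : measurableType d) (P : probability Omega R)
  (J : choiceType) (r : J -> {RV P >-> R}).
Hypothesis ind : mutually_independent r.

(** A family stable under intersection, as uniqueness of measures requires. [U] may be infinite,
    since complements of finite sets occur. *)
Definition cylinders (U : set J) : set (set Omega) :=
  [set A | exists S : {fset J}, exists B : J -> set R,
    [/\ [set` S] `<=` U, forall i, measurable (B i) &
        A = \bigcap_(i in [set` S]) (r i @^-1` B i)]].

Lemma measurable_cylinder U : cylinders U `<=` measurable.
Proof.
move=> _ [S [B [_ mB ->]]]; rewrite bigcap_fset.
apply: bigsetI_measurable => i _; exact: measurable_funPTI.
Qed.

Lemma cylinders_setT U : cylinders U setT.
Proof.
exists fset0, (fun=> setT); split => //.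
by apply/seteqP; split => // w _ i /=; rewrite in_fset0.
Qed.

Lemma cylinders_setI U : setI_closed (cylinders U).
Proof.
move=> _ _ [S [B [SU mB ->]]] [S' [B' [SU' mB' ->]]].
exists (S `|` S')%fset, (fun i => (if i \in S then B i else setT) `&`
   (if i \in S' then B' i else setT)); split.
- by move=> i /=; rewrite in_fsetU => /orP[/SU|/SU'].
- by move=> i; apply: measurableI; case: ifP.
apply/seteqP; split => [w [h h'] i /= _|w h].
  split; case: ifP => // iS; [exact: h|exact: h'].
split => i /= iS.
  by have := h i; rewrite /= in_fsetU iS => /(_ isT) [].
by have := h i; rewrite /= in_fsetU iS orbT => /(_ isT) [_].
Qed.

Lemma cylinder_indep (U V : set J) A B : U `&` V = set0 ->
  cylinders U A -> cylinders V B -> P (A `&` B) = (P A * P B)%E.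
Proof.
move=> UV [S [BA [SU mBA ->]]] [S' [BB [SV mBB ->]]].
have dSS' i : i \in S -> i \in S' -> False.
  by move=> /SU iU /SV iV; have : set0 i by rewrite -UV.
pose BC i := if i \in S then BA i else BB i.
have mBC i : measurable (BC i) by rewrite /BC; case: ifP.
have -> : \bigcap_(i in [set` S]) r i @^-1` BA i `&`
    \bigcap_(i in [set` S']) r i @^-1` BB i =
    \bigcap_(i in [set` (S `|` S')%fset]) r i @^-1` BC i.
  apply/seteqP; split => [w [h h'] i /=|w h].
    rewrite in_fsetU /BC; case: ifPn => [iS _|_ /=]; [exact: h|exact: h'].
  split => i /= iS.
    by have := h i; rewrite /= in_fsetU iS /BC iS => /(_ isT).
  have := h i; rewrite /= in_fsetU iS orbT /BC => /(_ isT).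
  by case: ifPn => // /dSS'; move/(_ iS).
rewrite !ind//.
have pSS' : perm_eq (S `|` S')%fset (enum_fset S ++ enum_fset S').
  apply: uniq_perm; first exact: fset_uniq.
    rewrite cat_uniq !fset_uniq /= andbT; apply/hasPn => i iS'.
    by apply/negP => iS; exact: (dSS' i).
  by move=> i; rewrite mem_cat in_fsetU.
rewrite (perm_big _ pSS') big_cat/=.
congr (_ * _)%E; apply: eq_big_seq => i iS; rewrite /BC; first by rewrite iS.
by case: ifPn => // /dSS'; move/(_ iS).
Qed.

Lemma measurable_sigma_cylinders U A : <<s cylinders U >> A -> measurable A.
Proof.
apply: smallest_sub; first exact: sigma_algebra_measurable.
exact: measurable_cylinder.
Qed.

(* Both sides are finite measures in each of [A] and [B] separately, so the
   pi-lambda theorem applies twice. *)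
Lemma sigma_cylinders_indep (U V : set J) A B : U `&` V = set0 ->
  <<s cylinders U >> A -> <<s cylinders V >> B -> P (A `&` B) = (P A * P B)%E.
Proof.
move=> UV sA sB.
have PBfin C : measurable C -> P C \is a fin_num by move=> ?; exact: fin_num_measure.
have half (U' : set J) C : measurable C ->
    (forall D, cylinders U' D -> P (D `&` C) = (P D * P C)%E) ->
    forall D, <<s cylinders U' >> D -> P (D `&` C) = (P D * P C)%E.
  move=> mC CD D sD.
  have PC0 : 0 <= fine (P C) by apply: fine_ge0.
  pose m2 : {measure set Omega -> \bar R} := mscale (NngNum PC0) P.
  have m2E E : m2 E = (P E * P C)%E.
    by rewrite /m2 /= /mscale /= muleC fineK// PBfin.
  have -> : P (D `&` C) = mrestr P mC D by [].
  rewrite -m2E -[LHS]/((mrestr P mC : {measure set Omega -> \bar R}) D).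
  apply: (g_sigma_algebra_measure_unique (cylinders U') _ (fun=> setT)) => //.
  - exact: measurable_cylinder.
  - by move=> _; exact: cylinders_setT.
  - by rewrite bigcup_const//; exists 0%N.
  - exact: cylinders_setI.
  - by move=> E cE; rewrite m2E -CD.
  - by move=> _; rewrite /= /mrestr setTI ltey_eq PBfin.
have mB := measurable_sigma_cylinders sB.
apply: (half U) => // D cD.
have mD := measurable_cylinder cD.
rewrite setIC muleC; apply: (half V) => // E cE.
rewrite setIC muleC; exact: (cylinder_indep UV).
Qed.

Lemma sub_sigma_of (T : {fset J}) A :
  sigma_of r T A -> <<s cylinders [set` T] >> A.
Proof.
apply: smallest_sub; first exact: smallest_sigma_algebra.
move=> _ [i iT [B mB <-]]; apply: sub_sigma_algebra.
exists [fset i]%fset, (fun=> B); split => //.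
  by move=> j /=; rewrite in_fset1 => /eqP ->.
by rewrite set_fset1 bigcap_set1 setTI.
Qed.

End independence.

Section coord_measurable.
Context {R : realType} {J : choiceType}.
Implicit Types (x y : J -> R) (T : {fset J}).
Local Open Scope ereal_scope.

(* Measurability for the product sigma-algebra on [J -> R], without
   constructing that sigma-algebra. *)
Definition coord_measurable (g : (J -> R) -> \bar R) :=
  forall d (T : measurableType d) (y : T -> J -> R),
    (forall i, measurable_fun setT (fun t => y t i)) ->
    (forall t i, (0 < y t i)%R) -> measurable_fun setT (fun t => g (y t)).

Definition mix T x y : J -> R := fun i => if i \in T then x i else y i.

(** Only positive configurations are compared, because minimal energies are specified only there. *)
Definition depends_on T (g : (J -> R) -> \bar R) := forall x y,
  (forall i, (0 < x i)%R) -> (forall i, (0 < y i)%R) ->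
  (forall i, i \in T -> x i = y i) -> g x = g y.

Lemma mix_gt0 T x y : (forall i, (0 < x i)%R) -> (forall i, (0 < y i)%R) ->
  forall i, (0 < mix T x y i)%R.
Proof. by move=> x0 y0 i; rewrite /mix; case: (i \in T). Qed.

Lemma measurable_mix d (S : measurableType d) T (y z : S -> J -> R) i :
  measurable_fun setT (fun t => y t i) -> measurable_fun setT (fun t => z t i) ->
  measurable_fun setT (fun t => mix T (y t) (z t) i).
Proof. by move=> my mz; rewrite /mix; case: (i \in T). Qed.

End coord_measurable.

Section conditioning.
Context {R : realType} d (Omega : measurableType d) (P : probability Omega R)
  (J : choiceType) (r : J -> {RV P >-> R}).
Hypothesis ind : mutually_independent r.
Hypothesis r_gt0 : forall i w, (0 < r i w)%R.
Local Open Scope ereal_scope.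
Implicit Types (x y : J -> R) (S T : {fset J}) (g : (J -> R) -> \bar R).

Definition config w : J -> R := fun i => r i w.

Lemma config_gt0 w i : (0 < config w i)%R. Proof. exact: r_gt0. Qed.

Lemma measurable_config i : measurable_fun setT (fun w => config w i).
Proof. exact: measurable_funP. Qed.

Definition mean g := \int[P]_w g (config w).

(** The conditional expectation given the coordinates in [T], as a function defined at every
    configuration: the other coordinates are drawn afresh. [integral_cond] ties it to the
    sigma-algebra [sigma_of r T]. *)
Definition cond T g x := \int[P]_w g (mix T x (config w)).

Lemma coord_measurable_cond T g : coord_measurable g -> (forall x, 0 <= g x) ->
  coord_measurable (cond T g).
Proof.
move=> mg g0 d' S y my y0; rewrite /cond.
apply: (measurable_fun_fubini_tonelli_F (m2 := P)
  (fun z : S * Omega => g (mix T (y z.1) (config z.2)))) => //.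
apply: mg; last by move=> t; apply: mix_gt0 => //; exact: config_gt0.
move=> i; apply: measurable_mix.
  by apply: (measurableT_comp (my i)); exact: measurable_fst.
by apply: (measurableT_comp (measurable_config i)); exact: measurable_snd.
Qed.

Lemma cond_ge0 T g x : (forall x, 0 <= g x) -> 0 <= cond T g x.
Proof. by move=> g0; apply: integral_ge0. Qed.

Lemma depends_on_cond T g : depends_on T (cond T g).
Proof.
move=> x y x0 y0 xy; rewrite /cond; apply: eq_integral => w _; congr g.
by apply/funext => i; rewrite /mix; case: ifP => // /xy.
Qed.

Lemma measurable_comp_config g : coord_measurable g ->
  measurable_fun setT (fun w => g (config w)).
Proof.
by move=> mg; apply: mg; [exact: measurable_config | exact: config_gt0].
Qed.

Lemma integral_cond T g A : coord_measurable g -> (forall x, 0 <= g x) ->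
  sigma_of r T A ->
  \int[P]_(w in A) g (config w) = \int[P]_(w in A) cond T g (config w).
Proof.
move=> mg g0 sA.
(* The sample space carries two sigma-algebras here, of the coordinates in [T] and of those outside
   it. The identity maps into them are independent, hence can be decoupled. *)
pose T1 := g_sigma_algebraType (cylinders r [set` T]).
pose T2 := g_sigma_algebraType (cylinders r (~` [set` T])).
have mid (U : set J) : measurable_fun setT
    (fun w : Omega => w : g_sigma_algebraType (cylinders r U)).
  by move=> _ B mB; rewrite setTI; exact: measurable_sigma_cylinders mB.
have mT (U : set J) i : U i -> measurable_fun setT
    (fun w : g_sigma_algebraType (cylinders r U) => config w i).
  move=> Ui _ B mB; rewrite setTI; apply: sub_sigma_algebra.
  exists [fset i]%fset, (fun=> B); split => //.
    by move=> j /=; rewrite in_fset1 => /eqP ->.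
  by rewrite set_fset1 bigcap_set1.
have sA1 := sub_sigma_of sA.
pose k (z : T1 * T2) := g (mix T (config z.1) (config z.2)).
pose fA : set (T1 * T2) := [set z | A z.1].
pose h : T1 * T2 -> \bar R := k \_ fA.
have mk : measurable_fun setT k.
  apply: mg; last by move=> t; apply: mix_gt0; exact: config_gt0.
  move=> i; rewrite /mix; case: (boolP (i \in T)) => [iT|/negP iT].
    exact: (measurableT_comp (mT [set` T] i iT) measurable_fst).
  exact: (measurableT_comp (mT (~` [set` T]) i iT) measurable_snd).
have mfA : measurable fA.
  by rewrite -[X in measurable X]setTI; exact: (measurable_fst _ (A : set T1)).
have mh : measurable_fun setT h.
  apply: (iffLR (measurable_restrictT k mfA)); exact: measurable_funS mk.
have h0 z : 0 <= h z by rewrite /h /patch; case: (z \in fA); [exact: g0|exact: lexx].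
have indT B C : measurable B -> measurable C ->
    P ((fun w : Omega => w : T1) @^-1` B `&` (fun w : Omega => w : T2) @^-1` C) =
    P ((fun w : Omega => w : T1) @^-1` B) *
    P ((fun w : Omega => w : T2) @^-1` C).
  by move=> mB mC; apply: sigma_cylinders_indep mB mC => //; rewrite setICr.
have fAE w w' : ((w, w') \in fA) = (w \in A).
  by apply/idP/idP; rewrite !inE.
have H := ge0_integral_indep (mid _) (mid _) indT mh h0.
rewrite [LHS]integral_mkcond [RHS]integral_mkcond.
(* On the diagonal, mixing a configuration with itself gives it back. *)
transitivity (\int[P]_w h (w, w)).
  apply: eq_integral => w _; rewrite /h /patch /k /=.
  rewrite (_ : ((w, w) \in fA) = (w \in A)) ?fAE//.
  by case: ifP => // _; congr g; apply/funext => i; rewrite /mix if_same.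
rewrite H; apply: eq_integral => w _; rewrite /patch.
case: (boolP (w \in A)) => wA.
  by rewrite /cond; apply: eq_integral => w' _; rewrite /h /patch fAE wA.
by apply: integral0_eq => w' _; rewrite /h /patch fAE (negbTE wA).
Qed.

Lemma mean_cond T g : coord_measurable g -> (forall x, 0 <= g x) ->
  mean (cond T g) = mean g.
Proof.
move=> mg g0; rewrite /mean -(integral_cond (T := T))//.
by apply: (@measurableT _ (g_sigma_algebraType _)).
Qed.

Lemma eq_mean g g' : (forall x, (forall i, (0 < x i)%R) -> g x = g' x) ->
  mean g = mean g'.
Proof. by move=> gg'; apply: eq_integral => w _; apply: gg'; exact: config_gt0. Qed.

(** Outside the intersection the coordinates come from two independent copies, split according to
    [T1]; by [mean_cond] this has the law of a single copy. *)
Lemma cond_cond T1 T2 g x : coord_measurable g -> (forall x, 0 <= g x) ->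
  (forall i, (0 < x i)%R) -> cond T2 (cond T1 g) x = cond (T1 `&` T2)%fset g x.
Proof.
move=> mg g0 x0.
pose G v := g (mix (T1 `&` T2)%fset x v).
have mG : coord_measurable G.
  move=> d' S y my y0; apply: mg; last by move=> t; exact: mix_gt0.
  by move=> i; apply: measurable_mix.
have G0 v : 0 <= G v by exact: g0.
transitivity (mean G); last by [].
rewrite -(mean_cond T1 mG G0).
apply: eq_integral => w _; rewrite /cond; apply: eq_integral => w' _.
rewrite /G; congr g; apply/funext => i; rewrite /mix in_fsetI.
by case: (i \in T1); case: (i \in T2).
Qed.

Lemma cond_mulr T g k x : coord_measurable g -> (forall x, 0 <= g x) ->
  (forall x, 0 <= k x) -> depends_on T k -> (forall i, (0 < x i)%R) ->
  cond T (fun x => g x * k x) x = cond T g x * k x.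
Proof.
move=> mg g0 k0 kT x0; rewrite /cond -ge0_integralZr//; last first.
  apply: mg; last by move=> t; apply: mix_gt0 => //; exact: config_gt0.
  by move=> i; apply: measurable_mix => //; exact: measurable_config.
apply: eq_integral => w _; congr (_ * _); apply: kT => //.
  by apply: mix_gt0 => //; exact: config_gt0.
by move=> i iT; rewrite /mix iT.
Qed.

Lemma coord_measurableM g k : coord_measurable g -> coord_measurable k ->
  coord_measurable (fun x => g x * k x).
Proof. by move=> mg mk d' S y my y0; apply: emeasurable_funM; [exact: mg|exact: mk]. Qed.

Lemma mean_cond_mul T g k : coord_measurable g -> (forall x, 0 <= g x) ->
  coord_measurable k -> (forall x, 0 <= k x) -> depends_on T k ->
  mean (fun x => g x * k x) = mean (fun x => cond T g x * k x).
Proof.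
move=> mg g0 mk k0 kT; rewrite -(mean_cond T); last 2 first.
- exact: coord_measurableM.
- by move=> x; rewrite mule_ge0.
by apply: eq_mean => x x0; exact: cond_mulr.
Qed.

(** The squared norm of the conditional expectation given the coordinates in [T]. *)
Definition phi g T := mean (fun x => cond T g x * cond T g x).

(** [mean_cond_mul] acts as self-adjointness: one projection is moved onto the other factor, where
    [cond_cond] intersects the two sets. *)
Lemma mean_cond_cond T1 T2 g : coord_measurable g -> (forall x, 0 <= g x) ->
  mean (fun x => cond T1 g x * cond T2 g x) = phi g (T1 `&` T2)%fset.
Proof.
move=> mg g0.
have mc T : coord_measurable (cond T g) by exact: coord_measurable_cond.
have c0 T x : 0 <= cond T g x by exact: cond_ge0.
rewrite (mean_cond_mul (mc T1) (c0 T1) (mc T2) (c0 T2) (@depends_on_cond _ _)).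
rewrite (eq_mean (g' := fun x => cond T2 g x * cond (T1 `&` T2)%fset g x)); last first.
  by move=> x x0; rewrite cond_cond// muleC.
rewrite (mean_cond_mul (mc _) (c0 _) (mc _) (c0 _) (@depends_on_cond _ _)).
have TI : (T2 `&` (T1 `&` T2) = T1 `&` T2)%fset; last first.
  by apply: eq_mean => x x0; rewrite (cond_cond _ _ mg g0 x0) TI.
by apply/fsetP => i; rewrite !in_fsetI; case: (i \in T1); case: (i \in T2).
Qed.

Lemma cond_depends T g x : depends_on T g -> (forall i, (0 < x i)%R) ->
  cond T g x = g x.
Proof.
move=> gT x0; rewrite /cond (eq_integral (cst (g x))).
  by rewrite integral_cst//= probability_setT mule1.
move=> w _; apply: gT => //; first by apply: mix_gt0 => //; exact: config_gt0.
by move=> i iT; rewrite /mix iT.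
Qed.

End conditioning.

(** * Norms of the Walsh components *)

Section cond_exp.
Context {R : realType} d (Omega : measurableType d) (P : probability Omega R).
Local Open Scope ereal_scope.

Lemma sqnorm2E (h : Omega -> R) : sqnorm2 P h = \int[P]_w (h w ^+ 2)%:E.
Proof.
have sq (y : \bar R) : 0 <= y -> y ^+ 2 = y `^ 2.
  case: y => [y||]//; rewrite ?lee_fin => y0; last by rewrite poweRyr.
  by rewrite poweR_EFin powR_mulrn// expe2 EFinM.
rewrite /sqnorm2 sq ?Lnorm_ge0// poweR_Lnorm//; apply: eq_integral => w _.
by rewrite -sq ?abse_ge0// expe2 /= -EFinM -expr2 real_normK// num_real.
Qed.

(** Both versions are measurable for the sub-sigma-algebra, so they are compared under the measure
    restricted to it, where equality of all integrals forces equality almost everywhere; the null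
    set remains null for [P]. *)
Lemma is_cond_exp_ae_eq (G : set (set Omega)) (f g h : Omega -> R) :
  <<s G >> `<=` measurable ->
  is_cond_exp P <<s G >> f g -> is_cond_exp P <<s G >> f h ->
  ae_eq P setT (EFin \o g) (EFin \o h).
Proof.
move=> mG [mg ig fg] [mh ih fh].
pose T1 := g_sigma_algebraType G.
have mid : measurable_fun setT (fun w : Omega => w : T1).
  by move=> _ B mB; rewrite setTI; exact: mG.
pose P1 : probability T1 R := distribution P (mfun_Sub (mem_set mid)).
have mT1 (k : Omega -> R) : (forall B, measurable B -> <<s G >> (k @^-1` B)) ->
    measurable_fun setT (EFin \o (k : T1 -> R)).
  by move=> mk; apply/measurable_EFinP => _ B mB; rewrite setTI; exact: mk.
have int1 (k : T1 -> \bar R) A : measurable_fun setT k -> measurable A ->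
    P.-integrable setT (k : Omega -> \bar R) ->
    \int[P1]_(w in A) k w = \int[P]_(w in A) k w.
  move=> mk mA ik.
  rewrite (@integral_pushforward _ _ _ _ _ _ mid P _ k)//.
  apply: integrableS ik => //; exact: mG.
have igP1 : P1.-integrable setT (EFin \o (g : T1 -> R)).
  by apply: integrable_pushforward => //; exact: mT1.
have := integral_ae_eq (mu := P1) (D := setT) measurableT igP1 (mT1 _ mh).
case=> [A _ mA|N [mN PN sN]].
  rewrite !int1//; try exact: mT1.
  by rewrite fg// fh.
exists N; split => //; exact: mG.
Qed.

End cond_exp.

Section walsh_norm.
Context {R : realType} d (Omega : measurableType d) (P : probability Omega R)
  (J : choiceType) (r : J -> {RV P >-> R}).
Hypothesis ind : mutually_independent r.
Hypothesis r_gt0 : forall i w, (0 < r i w)%R.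
Local Open Scope ereal_scope.
Variable F : (J -> R) -> R.
Hypothesis F_ge0 : forall x, (0 <= F x)%R.
Let g x := (F x)%:E.
Hypothesis mg : coord_measurable g.
Hypothesis cond_fin : forall T x, (forall i, 0 < x i)%R -> cond r T g x < +oo.
Hypothesis phi_fin : forall T, phi r g T < +oo.

Let g0 x : 0 <= g x. Proof. by rewrite /g lee_fin. Qed.

Let u T (w : Omega) := fine (cond r T g (config r w)).

Let uE T w : (u T w)%:E = cond r T g (config r w).
Proof.
rewrite /u fineK// ge0_fin_numE ?cond_ge0//; apply: cond_fin.
exact: config_gt0.
Qed.

Let u0 T w : (0 <= u T w)%R.
Proof. by rewrite -lee_fin uE cond_ge0. Qed.

Let mu_ T : measurable_fun setT (u T).
Proof.
apply/measurable_EFinP; rewrite (_ : _ \o _ = fun w => cond r T g (config r w)).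
  apply: measurable_comp_config => //; exact: coord_measurable_cond.
by apply/funext => w; rewrite /= uE.
Qed.

Let uu T T' : \int[P]_w (u T w * u T' w)%:E = phi r g (T `&` T')%fset.
Proof.
rewrite -mean_cond_cond//; apply: eq_integral => w _.
by rewrite EFinM !uE.
Qed.

Let iuu T T' : P.-integrable setT (fun w => (u T w * u T' w)%:E).
Proof.
apply/integrableP; split.
  by apply/measurable_EFinP; apply: measurable_funM; exact: mu_.
rewrite (eq_integral (fun w => (u T w * u T' w)%:E)); last first.
  by move=> w _; rewrite gee0_abs// lee_fin mulr_ge0.
by rewrite uu.
Qed.

Let iu T : P.-integrable setT (EFin \o u T).
Proof.
apply/integrableP; split; first by apply/measurable_EFinP; exact: mu_.
rewrite (eq_integral (EFin \o u T)); last first.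
  by move=> w _; rewrite gee0_abs// lee_fin.
apply: (@le_lt_trans _ _ (\int[P]_w (1 + (u T w * u T w)%:E))).
  apply: ge0_le_integral => //.
  - by move=> w _; rewrite lee_fin.
  - by apply/measurable_EFinP; exact: mu_.
  - apply: emeasurable_funD => //.
    by apply/measurable_EFinP; apply: measurable_funM; exact: mu_.
  - move=> w _; rewrite -EFinD lee_fin.
    by have := u0 T w; nra.
rewrite ge0_integralD//.
- by rewrite integral_cst//= probability_setT mul1e uu fsetIid lte_add_pinfty// ltry.
- by move=> w _; rewrite lee_fin mulr_ge0.
- by apply/measurable_EFinP; apply: measurable_funM; exact: mu_.
Qed.

Let f w := F (config r w).

Lemma is_cond_exp_cond T : is_cond_exp P (sigma_of r T) f (u T).
Proof.
split; [|exact: iu|]; last first.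
  move=> A sA; rewrite [RHS](integral_cond ind r_gt0 mg g0 sA).
  by apply: eq_integral => w _; rewrite uE.
pose G := \bigcup_(i in [set` T]) preimage_set_system setT (r i) measurable.
pose T1 := g_sigma_algebraType G.
(* Freezing the coordinates outside [T] at 1 does not change [cond r T g] and leaves a function of
   the coordinates in [T] only. *)
pose y (w : T1) i : R := if i \in T then config r w i else 1%R.
have my : measurable_fun setT (fun w : T1 => cond r T g (y w)).
  apply: coord_measurable_cond => //; rewrite /y.
    move=> i; case: (boolP (i \in T)) => iT; last exact: measurable_cst.
    move=> _ B mB; apply: sub_sigma_algebra; exists i => //.
    by exists B.
  by move=> w i; case: ifP => // _; exact: config_gt0.
move=> B mB; have /= := measurableT_comp (fine_measurable measurableT) my.
move=> /(_ measurableT B mB); rewrite setTI.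
congr (_ _); apply/funext => w; rewrite /preimage /=; congr (B _).
rewrite /u; congr fine; rewrite /cond; apply: eq_integral => w' _; congr (g _).
by apply/funext => i; rewrite /mix /y; case: (i \in T).
Qed.

(** The chosen versions are replaced by [u T], the square is expanded, and [sum_sign_meet] collapses
    the sum of the means [phi] of the intersections. *)
Lemma sqnorm2_walsh S :
  sqnorm2 P (walsh r f S) = (moebius (fun T => fine (phi r g T)) S)%:E.
Proof.
pose c T : R := ((-1) ^+ #|` (S `\` T)%fset|)%R.
pose v w := (\sum_(T <- fpowerset S) c T * u T w)%R.
have mv : measurable_fun setT v.
  by apply: measurable_sum => T; apply: measurable_funM => //; exact: mu_.
have sub T : sigma_of r T `<=` @measurable _ Omega.
  apply: smallest_sub; first exact: sigma_algebra_measurable.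
  by move=> _ [i iT [B mB <-]]; apply: measurable_funP.
have ce T : is_cond_exp P (sigma_of r T) f (cond_exp P (sigma_of r T) f).
  rewrite /cond_exp; have := @xgetPex _ (cst 0%R) [set h | is_cond_exp P (sigma_of r T) f h].
  by apply; exists (u T); exact: is_cond_exp_cond.
have mce T : measurable_fun setT (cond_exp P (sigma_of r T) f).
  by move=> _ B mB; rewrite setTI; apply: (sub T); have [+ _ _] := ce T; exact.
have ae T : ae_eq P setT (EFin \o cond_exp P (sigma_of r T) f) (EFin \o u T).
  by apply: is_cond_exp_ae_eq (ce T) (is_cond_exp_cond T); exact: sub.
have aew : ae_eq P setT (EFin \o walsh r f S) (EFin \o v).
  (* Only finitely many conditional expectations occur, so their exceptional null sets can be
     united. *)
  have aes (s : seq {fset J}) : \forall w \ae P, forall T, T \in s ->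
      cond_exp P (sigma_of r T) f w = u T w.
    elim: s => [|T s IH]; first by apply: aeW => w T; rewrite in_nil.
    near=> w => T'; rewrite in_cons => /orP[/eqP ->|T's].
      apply: EFin_inj; near: w; have := ae T; apply: filterS => w; exact.
    by move: T' T's; near: w.
  apply: filterS (aes (fpowerset S)) => w H _ /=; congr (_%:E); rewrite /walsh /v big_seq [RHS]big_seq.
  by apply: eq_bigr => T TS; rewrite H.
rewrite sqnorm2E; transitivity (\int[P]_w (v w ^+ 2)%:E).
  apply: ae_eq_integral => //.
  - apply/measurable_EFinP/measurable_funX.
    by apply: measurable_sum => T; apply: measurable_funM.
  - by apply/measurable_EFinP/measurable_funX.
  - by apply: filterS aew => w /(_ I) /= [->].
rewrite -sum_sign_meet (eq_integral (fun w => \sum_(T <- fpowerset S)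
    \sum_(T' <- fpowerset S) (c T * c T')%:E * (u T w * u T' w)%:E)); last first.
  move=> w _; rewrite expr2 /v mulr_suml -sumEFin; apply: eq_bigr => T _.
  rewrite mulr_sumr -sumEFin; apply: eq_bigr => T' _; rewrite -EFinM.
  by congr (_%:E); ring.
have iz T T' : P.-integrable setT (fun w => (c T * c T')%:E * (u T w * u T' w)%:E).
  by apply: integrableZl.
rewrite integral_sum//; last by move=> T; apply: integrable_sum.
rewrite -sumEFin; apply: eq_bigr => T _.
rewrite integral_sum// -sumEFin; apply: eq_bigr => T' _.
rewrite integralZl//.
rewrite uu [RHS]EFinM fineK// ge0_fin_numE//; apply: integral_ge0 => w _.
by rewrite mule_ge0// cond_ge0.
Unshelve. all: by end_near. Qed.

End walsh_norm.

(** * Minimal energy on a finite set of edges *)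

Section quadratic_minimization.
Context {R : realType} {J : choiceType}.
Implicit Types (x a b eta : J -> R) (F : {fset J}) (W : (J -> R) -> Prop).

Definition wdot F x a b : R := \sum_(i <- F) x i * a i * b i.

Definition is_subspace W := W (fun=> 0) /\
  forall (c : R) a b, W a -> W b -> W (fun i => a i + c * b i).

Lemma wdotC F x a b : wdot F x a b = wdot F x b a.
Proof. by apply: eq_bigr => i _; ring. Qed.

Lemma wdotDl F x (c : R) a b eta :
  wdot F x (fun i => a i + c * b i) eta = wdot F x a eta + c * wdot F x b eta.
Proof. by rewrite /wdot mulr_sumr -big_split/=; apply: eq_bigr => i _; ring. Qed.

Lemma wdotDr F x (c : R) a b eta :
  wdot F x eta (fun i => a i + c * b i) = wdot F x eta a + c * wdot F x eta b.
Proof. by rewrite wdotC wdotDl; congr (_ + _ * _); rewrite wdotC. Qed.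

Lemma wdot_ge0 F x a : (forall i, 0 < x i) -> 0 <= wdot F x a a.
Proof.
move=> x0; apply: sumr_ge0 => i _; rewrite -mulrA mulr_ge0 ?(ltW (x0 i))//.
by rewrite -expr2 sqr_ge0.
Qed.

Lemma wdot_ge_term F x a e : (forall i, 0 < x i) -> e \in F ->
  x e * a e ^+ 2 <= wdot F x a a.
Proof.
move=> x0 eF; rewrite /wdot (big_fsetD1 e)//= -mulrA -expr2 lerDl.
apply: sumr_ge0 => i _; rewrite -mulrA mulr_ge0 ?(ltW (x0 i))//.
by rewrite -expr2 sqr_ge0.
Qed.

Lemma coord_measurable_wdot F (a b : (J -> R) -> J -> R) :
  (forall i, coord_measurable (fun x => (a x i)%:E)) ->
  (forall i, coord_measurable (fun x => (b x i)%:E)) ->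
  coord_measurable (fun x => (wdot F x (a x) (b x))%:E).
Proof.
move=> ma mb d T y my y0; apply/measurable_EFinP; apply: measurable_sum => i.
apply: measurable_funM; first apply: measurable_funM => //.
- by apply/measurable_EFinP; apply: ma.
- by apply/measurable_EFinP; apply: mb.
Qed.

(* Gram-Schmidt, one coordinate of [F] at a time; it is run for all weights [x]
   at once in order to keep track of measurability in [x]. *)
Lemma projection F W a : is_subspace W ->
  exists p : (J -> R) -> J -> R,
  [/\ forall x, W (p x),
      forall x eta, (forall i, 0 < x i) -> W eta ->
        wdot F x a eta = wdot F x (p x) eta &
      forall i, coord_measurable (fun x => (p x i)%:E)].
Proof.
elim/(@fset_indU1 J): F W a => [|e F eF IH] W a [W0 WD].
  exists (fun _ _ => 0); split => //; first by move=> x eta _ _; rewrite /wdot !big_nil.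
  by move=> i d T y my y0; exact: measurable_cst.
(* On vectors vanishing at [e] the weight of [e] is invisible, so the induction hypothesis for [F]
   still computes the right scalar products. *)
pose W' eta := W eta /\ eta e = 0.
have W'sub : is_subspace W'.
  by split=> [|c u v [Wu u0] [Wv v0]]; split => //; [exact: WD|rewrite u0 v0; ring].
have dotU x u v : wdot (e |` F)%fset x u v = x e * u e * v e + wdot F x u v.
  by rewrite /wdot big_fsetU1.
have [p' [Wp' op' mp']] := IH W' a W'sub.
have [[eta0 [Weta0 eta0e]]|nW] := pselect (exists eta, W eta /\ eta e != 0); last first.
  exists p'; split => //; first by move=> x; have [] := Wp' x.
  move=> x eta x0 Weta; have etae : eta e = 0.
    by apply/eqP/negPn/negP => he; apply: nW; exists eta.
  by rewrite !dotU etae !mulr0 !add0r op'.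
pose eta1 i := 0 + (eta0 e)^-1 * eta0 i.
have Weta1 : W eta1 by exact: WD.
have eta1e : eta1 e = 1 by rewrite /eta1 add0r mulVf.
have [q [Wq oq mq]] := IH W' eta1 W'sub.
(* [n x] spans the orthogonal complement of [W'] in [W]; being 1 at [e], it has positive norm, so
   the last coefficient of the projection is well defined. *)
pose n x i := eta1 i + (-1) * q x i.
have Wn x : W (n x) by apply: WD => //; have [] := Wq x.
have ne x : n x e = 1 by have [_ qe] := Wq x; rewrite /n qe eta1e; ring.
pose c x := (wdot (e |` F)%fset x (fun i => a i + (-1) * p' x i) (n x)) *
   (wdot (e |` F)%fset x (n x) (n x))^-1.
have n0 x : (forall i, 0 < x i) -> 0 < wdot (e |` F)%fset x (n x) (n x).
  by move=> x0; rewrite dotU ne !mulr1 ltr_pwDl// wdot_ge0.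
have mn i : coord_measurable (fun x => (n x i)%:E).
  move=> d T y my y0; apply/measurable_EFinP/measurable_funD => //.
  by apply: measurable_funM => //; apply/measurable_EFinP; apply: mq.
have mc : coord_measurable (fun x => (c x)%:E).
  move=> d T y my y0; apply/measurable_EFinP; apply: measurable_funM.
    have ma i : coord_measurable (fun x => (a i + (-1) * p' x i)%:E).
      move=> d' T' y' my' y0'; apply/measurable_EFinP/measurable_funD => //.
      by apply: measurable_funM => //; apply/measurable_EFinP; apply: mp'.
    apply/measurable_EFinP; exact: (coord_measurable_wdot _ ma mn my y0).
  rewrite (_ : (fun _ => _) = (fun t => (wdot (e |` F)%fset (y t) (n (y t)) (n (y t))) `^ (-1))).
    apply: (measurableT_comp (measurable_powR _)).
    by apply/measurable_EFinP; exact: (coord_measurable_wdot _ mn mn my y0).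
  by apply/funext => t; rewrite powR_inv1// ltW// n0.
exists (fun x i => p' x i + c x * n x i); split.
- by move=> x; apply: WD => //; have [] := Wp' x.
- move=> x eta x0 Weta.
  have [zeta [k [W'z ->]]] : exists zeta k, W' zeta /\
      eta = (fun i => zeta i + k * n x i).
    exists (fun i => eta i + (- eta e) * n x i), (eta e); split.
      by split; [exact: WD|rewrite ne; ring].
    by apply/funext => i; ring.
  have on : wdot (e |` F)%fset x (n x) zeta = 0.
    rewrite dotU W'z.2 mulr0 add0r /n wdotDl (oq _ _ x0 W'z); ring.
  have op : wdot (e |` F)%fset x a zeta = wdot (e |` F)%fset x (p' x) zeta.
    by rewrite !dotU W'z.2 !mulr0 !add0r op'.
  rewrite (wdotDl _ _ (c x) (p' x) (n x)) !(wdotDr _ _ k zeta (n x)) on op; set D := wdot _ x (n x) (n x).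
  have D0 : D != 0 by rewrite gt_eqF// n0.
  rewrite /c -/D (wdotDl _ _ (-1) a (p' x)) mulN1r; set u := wdot _ _ _ _; set v := wdot _ _ _ _.
  set w := wdot _ _ _ _; by field.
- move=> i d T y my y0; apply/measurable_EFinP/measurable_funD.
    by apply/measurable_EFinP; apply: mp'.
  apply: measurable_funM; first by apply/measurable_EFinP; apply: mc.
  by apply/measurable_EFinP; apply: mn.
Qed.

End quadratic_minimization.

Section min_energy.
Context {R : realType} {J : choiceType}.
Implicit Types (x theta g eta : J -> R).
Variables (F : {fset J}) (W : (J -> R) -> Prop) (a : J -> R).
Hypothesis Wsub : is_subspace W.

Definition upd x e s : J -> R := fun i => if i == e then s else x i.

Lemma upd_gt0 x e s : (forall i, 0 < x i) -> 0 < s -> forall i, 0 < upd x e s i.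
Proof. by move=> x0 s0 i; rewrite /upd; case: ifP. Qed.

Lemma upd_upd x e s t : upd (upd x e s) e t = upd x e t.
Proof. by apply/funext => i; rewrite /upd; case: eqP. Qed.

Lemma updC x e e' s t : e != e' -> upd (upd x e s) e' t = upd (upd x e' t) e s.
Proof.
by move=> ee'; apply/funext => i; rewrite /upd; case: eqVneq => // ->;
  rewrite eq_sym (negbTE ee').
Qed.

Lemma wdot_upd x e s b c : e \in F ->
  wdot F (upd x e s) b c = wdot F x b c + (s - x e) * b e * c e.
Proof.
move=> eF; rewrite /wdot !(big_fsetD1 e eF)/= /upd eqxx.
rewrite (eq_big_seq (fun i => x i * b i * c i)); first by ring.
by move=> i; rewrite in_fsetD1 => /andP[/negbTE->].
Qed.

(** The first-order condition for minimizing the energy on the affine space through [a] directed by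
    [W]; [optimal_pythagoras] shows that it suffices. *)
Definition optimal x theta :=
  W (fun i => theta i + (-1) * a i) /\
  forall eta, W eta -> wdot F x theta eta = 0.

(** [g] represents evaluation at [e] on [W]. It is the row of [e] in the kernel of the orthogonal
    projection on [W], up to the factor [x e]. *)
Definition is_riesz x e g :=
  W g /\ forall eta, W eta -> wdot F x g eta = eta e.

Definition is_min_energy (f : (J -> R) -> R) := forall x, (forall i, 0 < x i) ->
  exists2 theta, optimal x theta & f x = wdot F x theta theta.

Lemma exists_riesz x e : (forall i, 0 < x i) -> e \in F -> exists g, is_riesz x e g.
Proof.
move=> x0 eF.
pose b i := if i == e then (x e)^-1 else 0.
have [p [Wp op _]] := projection F b Wsub.
exists (p x); split=> // eta Weta; rewrite -op// /wdot (big_fsetD1 e)//= /b eqxx.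
rewrite mulfV ?gt_eqF// mul1r big_seq big1 ?addr0// => i.
by rewrite in_fsetD1 => /andP[/negbTE-> _]; rewrite mulr0 mul0r.
Qed.

Lemma exists_min_energy : exists f : (J -> R) -> R,
  [/\ is_min_energy f, forall x, 0 <= f x & coord_measurable (fun x => (f x)%:E)].
Proof.
have [p [Wp op mp]] := projection F a Wsub.
pose th x i := a i + (-1) * p x i.
(* The absolute value makes the function nonnegative at configurations that are not positive as
   well. *)
exists (fun x => `|wdot F x (th x) (th x)|); split=> //; last first.
  have mth i : coord_measurable (fun x => (th x i)%:E).
    move=> d T y my y0; apply/measurable_EFinP/measurable_funD => //.
    by apply: measurable_funM => //; apply/measurable_EFinP; apply: mp.
  move=> d T y my y0; apply/measurable_EFinP; apply: measurableT_comp => //.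
  by apply/measurable_EFinP; exact: (coord_measurable_wdot _ mth mth my y0).
move=> x x0; exists (th x); last by rewrite ger0_norm// wdot_ge0.
split.
  rewrite (_ : (fun _ => _) = fun i => 0 + (-1) * p x i).
    by apply: Wsub.2 => //; exact: Wsub.1.
  by apply/funext => i; rewrite /th; ring.
by move=> eta Weta; rewrite /th wdotDl op// mulN1r subrr.
Qed.

Lemma optimal_pythagoras x theta eta : optimal x theta ->
  W (fun i => eta i + (-1) * a i) ->
  wdot F x eta eta = wdot F x theta theta +
    wdot F x (fun i => eta i + (-1) * theta i) (fun i => eta i + (-1) * theta i).
Proof.
move=> [Wt ot] We; set z := fun i => _.
have Wz : W z.
  rewrite (_ : z = fun i => (eta i + (-1) * a i) + (-1) * (theta i + (-1) * a i)).
    exact: Wsub.2.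
  by apply/funext => i; rewrite /z; ring.
have zE : eta = (fun i => theta i + 1 * z i).
  by apply/funext => i; rewrite /z; ring.
clearbody z; rewrite zE.
rewrite (wdotDl _ _ 1 theta z) !(wdotDr _ _ 1 theta z) (wdotC _ _ z theta) (ot z Wz).
by ring.
Qed.

Lemma optimal_unique x theta theta' : (forall i, 0 < x i) ->
  optimal x theta -> optimal x theta' ->
  wdot F x theta theta = wdot F x theta' theta'.
Proof.
move=> x0 o o'.
have := optimal_pythagoras o' o.1; have := optimal_pythagoras o o'.1.
have := wdot_ge0 F (fun i => theta' i + (-1) * theta i) x0.
have := wdot_ge0 F (fun i => theta i + (-1) * theta' i) x0.
by lra.
Qed.

(** The reproducing property turns the energy of [g] into [g e], and the term of [e] alone is
    already [x e * g e ^+ 2]. *)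
Lemma riesz_diag x e g : (forall i, 0 < x i) -> e \in F -> is_riesz x e g ->
  [/\ wdot F x g g = g e, 0 <= g e & x e * g e <= 1].
Proof.
move=> x0 eF [Wg og]; have gg := og _ Wg.
have ge0 : 0 <= g e by rewrite -gg wdot_ge0.
split=> //; have := wdot_ge_term g x0 eF; rewrite gg => h.
have := x0 e; have [->|g0] := eqVneq (g e) 0; first by rewrite mulr0.
have gp : 0 < g e by rewrite lt_neqAle eq_sym g0.
by move=> _; rewrite -(ler_pM2r gp) mul1r -mulrA -expr2.
Qed.

Lemma riesz_sym x e e' g g' : is_riesz x e g -> is_riesz x e' g' -> g e' = g' e.
Proof. by move=> [Wg og] [Wg' og']; rewrite -og'// -og// wdotC. Qed.

(* Rank-one (Sherman-Morrison) update of the solution of a linear problem. *)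
Lemma wdot_rank_one x e s b g eta : e \in F -> is_riesz x e g -> W eta ->
  1 + g e * (s - x e) != 0 ->
  wdot F (upd x e s)
    (fun i => b i + (- (b e * ((s - x e) / (1 + g e * (s - x e))))) * g i) eta =
  wdot F x b eta.
Proof.
move=> eF [_ og] Weta D0; rewrite wdot_upd// wdotDl og//; field.
by rewrite D0.
Qed.

(** With [k = x e * g e] in [[0, 1]] and [q = s / x e], the denominator is [1 + k (q - 1)], a convex
    combination of 1 and [q]. *)
Lemma rank_one_denom x e g s : (forall i, 0 < x i) -> e \in F ->
  is_riesz x e g -> 0 < s ->
  Num.min 1 (s / x e) <= 1 + g e * (s - x e) <= Num.max 1 (s / x e).
Proof.
move=> x0 eF rg s0; have [_ g0 xg1] := riesz_diag x0 eF rg.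
have xe := x0 e; set q := s / x e.
have -> : s - x e = x e * (q - 1) by rewrite /q; field; rewrite gt_eqF.
have q0 : 0 < q by rewrite divr_gt0.
have -> : 1 + g e * (x e * (q - 1)) = 1 + (x e * g e) * (q - 1) by ring.
have k0 : 0 <= x e * g e by rewrite mulr_ge0// ltW.
move: k0 xg1; set k := x e * g e => k0 k1.
by case: (leP 1 q) => q1; apply/andP; split; nra.
Qed.

Lemma rank_one_denom_gt0 x e g s : (forall i, 0 < x i) -> e \in F ->
  is_riesz x e g -> 0 < s -> 0 < 1 + g e * (s - x e).
Proof.
move=> x0 eF rg s0; have /andP[+ _] := rank_one_denom x0 eF rg s0.
by apply: lt_le_trans; rewrite lt_min ltr01 divr_gt0.
Qed.

Lemma optimal_upd x e s theta g : (forall i, 0 < x i) -> e \in F -> 0 < s ->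
  optimal x theta -> is_riesz x e g ->
  let h := (s - x e) / (1 + g e * (s - x e)) in
  let theta' := fun i => theta i + (- (theta e * h)) * g i in
  optimal (upd x e s) theta' /\
  wdot F (upd x e s) theta' theta' = wdot F x theta theta + theta e ^+ 2 * h.
Proof.
move=> x0 eF s0 [Wt ot] rg h theta'; have D0 := rank_one_denom_gt0 x0 eF rg s0.
have Dn : 1 + g e * (s - x e) != 0 by rewrite gt_eqF.
have od eta : W eta -> wdot F (upd x e s) theta' eta = 0.
  by move=> We; rewrite wdot_rank_one// ot.
split; first split=> //.
  rewrite (_ : (fun _ => _) = fun i => (theta i + (-1) * a i) + (- (theta e * h)) * g i).
    by apply: Wsub.2 => //; have [] := rg.
  by apply/funext => i; rewrite /theta'; ring.
(* [theta'] differs from [theta] by a multiple of [g], which lies in [W] and is orthogonal to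
   [theta'] for the new weights. *)
transitivity (wdot F (upd x e s) theta' theta).
  by rewrite (wdotDr _ _ (- (theta e * h)) theta g theta') (od g rg.1) mulr0 addr0.
rewrite wdot_upd// wdotC (wdotDr _ _ (- (theta e * h)) theta g theta).
rewrite (ot g rg.1) mulr0 addr0 /theta'.
by rewrite /h; field.
Qed.

Lemma riesz_upd x e e' s g g' : (forall i, 0 < x i) -> e \in F -> 0 < s ->
  is_riesz x e g -> is_riesz x e' g' ->
  let h := (s - x e) / (1 + g e * (s - x e)) in
  is_riesz (upd x e s) e' (fun i => g' i + (- (g' e * h)) * g i).
Proof.
move=> x0 eF s0 rg [Wg' og'] h; have D0 := rank_one_denom_gt0 x0 eF rg s0.
split; first by apply: Wsub.2 => //; have [] := rg.
by move=> eta Weta; rewrite wdot_rank_one// ?og'// gt_eqF.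
Qed.

Variable f : (J -> R) -> R.
Hypothesis ff : is_min_energy f.

Lemma min_energyE x theta : (forall i, 0 < x i) -> optimal x theta ->
  f x = wdot F x theta theta.
Proof. by move=> x0 o; have [theta' o' ->] := ff x0; exact: optimal_unique. Qed.

Lemma min_energy_depends : depends_on F (fun x => (f x)%:E).
Proof.
move=> x y x0 y0 xy; have [theta [Wt ot] ->] := ff x0.
have E b c : wdot F x b c = wdot F y b c.
  by apply: eq_big_seq => i iF; rewrite xy.
by rewrite E -(min_energyE y0)//; split=> // eta We; rewrite -E ot.
Qed.

Lemma min_energy_upd x e s theta g : (forall i, 0 < x i) -> e \in F -> 0 < s ->
  optimal x theta -> is_riesz x e g ->
  f (upd x e s) = f x + theta e ^+ 2 * ((s - x e) / (1 + g e * (s - x e))).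
Proof.
move=> x0 eF s0 o rg; have [ho E] := optimal_upd x0 eF s0 o rg.
by rewrite (min_energyE (upd_gt0 e x0 s0) ho) E (min_energyE x0 o).
Qed.

(** From the reference value 1 at [e], the energy is a homographic function of the resistance of
    [e], so a difference equals [theta e ^+ 2 * (s - t) / (u v)] with denominators between 1 and
    [s], resp. 1 and [t]. Both bounds share the factor [T = theta e ^+ 4], which carries all
    dependence on the other edges. *)
Lemma min_energy_sqr_diff x e : (forall i, 0 < x i) -> e \in F ->
  exists2 T, 0 <= T & forall s t, 0 < s -> 0 < t ->
  T * (Num.max (s - t) 0 ^+ 2 * Num.min 1 (1 / s ^+ 4)) <=
    (f (upd x e s) - f (upd x e t)) ^+ 2 <=
  T * ((s - t) ^+ 2 * Num.max 1 (1 / s ^+ 2) * Num.max 1 (1 / t ^+ 2)).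
Proof.
move=> x0 eF; pose z := upd x e 1.
have z0 : forall i, 0 < z i by exact: upd_gt0.
have ze : z e = 1 by rewrite /z /upd eqxx.
have [theta o _] := ff z0; have [g rg] := exists_riesz z0 eF.
exists (theta e ^+ 4); first by rewrite exprn_even_ge0.
move=> s t s0 t0.
have /andP[ls us] := rank_one_denom z0 eF rg s0.
have /andP[lo ut] := rank_one_denom z0 eF rg t0.
have Ds := rank_one_denom_gt0 z0 eF rg s0.
have Dt := rank_one_denom_gt0 z0 eF rg t0.
have <- : upd z e s = upd x e s by rewrite /z upd_upd.
have <- : upd z e t = upd x e t by rewrite /z upd_upd.
rewrite !(min_energy_upd z0 eF _ o rg)// ze.
move: ls us lo ut Ds Dt; rewrite ze !divr1; move: (theta e) (g e) => A al.
set u := 1 + _; set v := 1 + _ => ls us lo ut Ds Dt.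
have -> : (f z + A ^+ 2 * ((s - 1) / u) - (f z + A ^+ 2 * ((t - 1) / v))) ^+ 2 =
    A ^+ 4 * ((s - t) ^+ 2 * (u^-1 ^+ 2 * v^-1 ^+ 2)).
  have [un vn] : u != 0 /\ v != 0 by rewrite !gt_eqF.
  by rewrite /u /v in un vn *; field; rewrite un vn.
have A4 : 0 <= A ^+ 4 by rewrite exprn_even_ge0.
have bound (w c : R) : 0 < c -> Num.min 1 c <= w -> w <= Num.max 1 c -> 0 < w ->
    Num.min 1 (1 / c ^+ 2) <= w^-1 ^+ 2 <= Num.max 1 (1 / c ^+ 2).
  move=> c0 lw uw w0; rewrite div1r -!exprVn.
  have c2 := exprn_gt0 2 c0.
  have wV : 0 < w^-1 by rewrite invr_gt0.
  have cV : 0 < c^-1 by rewrite invr_gt0.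
  have lwV : Num.min 1 c^-1 <= w^-1.
    case: (leP 1 c) uw lw => c1 uw lw; last first.
      by rewrite ge_min -(invr1) lef_pV2 ?posrE// uw.
    by rewrite ge_min lef_pV2 ?posrE// uw orbT.
  have uwV : w^-1 <= Num.max 1 c^-1.
    case: (leP 1 c) uw lw => c1 uw lw; rewrite le_max.
      by rewrite -[X in _ <= X](invr1) lef_pV2 ?posrE// lw.
    by rewrite [X in _ || X]lef_pV2 ?posrE// lw orbT.
  apply/andP; split.
    move: lwV; rewrite !ge_min => /orP[h|h]; apply/orP; [left|right].
      by rewrite exprn_ege1.
    by rewrite lerXn2r// nnegrE ltW.
  move: uwV; rewrite !le_max => /orP[h|h]; apply/orP; [left|right].
    by rewrite exprn_ile1// ltW.
  by rewrite lerXn2r// nnegrE ltW.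
have /andP[bu1 bu2] := bound u s s0 ls us Ds.
have /andP[bv1 bv2] := bound v t t0 lo ut Dt.
apply/andP; split; rewrite ler_wpM2l//; last first.
  rewrite -mulrA ler_wpM2l ?sqr_ge0//; apply: ler_pM => //; exact: sqr_ge0.
case: (leP (s - t) 0) => st.
  by rewrite expr0n/= mul0r mulr_ge0 ?sqr_ge0// mulr_ge0 ?sqr_ge0.
rewrite ler_wpM2l ?sqr_ge0//.
have m0 (c : R) : 0 < c -> 0 <= Num.min 1 (1 / c ^+ 2).
  by move=> c0; rewrite le_min ler01 divr_ge0// sqr_ge0.
(* Since [t < s], the factor of [t] is bounded below in terms of [s] alone; this is why the
   denominator of the ratio contains a positive part. *)
apply: (@le_trans _ _ (Num.min 1 (1 / s ^+ 2) * Num.min 1 (1 / s ^+ 2))).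
  have s2 := exprn_gt0 2 s0; have s4 := exprn_gt0 4 s0.
  case: (leP 1 s) => s1.
    have h2 : 1 / s ^+ 2 <= 1 by rewrite ler_pdivrMr// mul1r exprn_ege1.
    have sE : 1 / s ^+ 2 * (1 / s ^+ 2) = 1 / s ^+ 4 by field; rewrite gt_eqF.
    by rewrite (min_idPr h2) sE ge_min lexx orbT.
  have h2 : 1 <= 1 / s ^+ 2 by rewrite ler_pdivlMr// mul1r exprn_ile1// ltW.
  by rewrite (min_idPl h2) mulr1 ge_min lexx.
apply: ler_pM => //; rewrite ?m0//.
apply: le_trans bv1; rewrite !le_min !ge_min lexx /=.
rewrite !div1r lef_pV2 ?posrE ?exprn_gt0//; apply/orP; right.
by apply: lerXn2r; rewrite ?nnegrE; lra.
Qed.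

End min_energy.

(** * The mixed second difference of the minimal energy *)

Section mixed_difference_bound.
Context {R : realType}.
Implicit Types (s c : R).

Definition distortion s c : R := Num.max (s / c) (c / s).

Lemma distortion_ge1 s c : 0 < s -> 0 < c -> 1 <= distortion s c.
Proof.
move=> s0 c0; rewrite /distortion le_max; apply/orP.
by case: (leP c s) => h; [left|right]; rewrite ler_pdivlMr//; lra.
Qed.

Lemma distortion_min_max s c : 0 < s -> 0 < c ->
  distortion s c * Num.min 1 (s / c) = Num.max 1 (s / c).
Proof.
move=> s0 c0; rewrite /distortion; have -> : c / s = (s / c)^-1 by rewrite invf_div.
have : 0 < s / c by rewrite divr_gt0.
move: (s / c) => q q0; have qn : q != 0 by rewrite gt_eqF.
case: (leP 1 q) => q1.
  have : q^-1 <= q by apply: (le_trans _ q1); rewrite invf_le1.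
  by move=> qq; rewrite (max_idPl qq) mulr1.
have : q <= q^-1 by apply: (le_trans (ltW q1)); rewrite ltW// invf_gt1.
by move=> qq; rewrite (max_idPr qq) mulVf.
Qed.

(** In the application [u] is the rank-one denominator at an edge and [u * a] the same denominator
    after another edge has changed. Both obey the bounds of [rank_one_denom], so their quotient [a]
    is at least the inverse distortion. *)
Lemma rank_one_factor_bound s c u a : 0 < s -> 0 < c ->
  Num.min 1 (s / c) <= u <= Num.max 1 (s / c) -> Num.min 1 (s / c) <= u * a ->
  0 < a /\ 1 <= distortion s c * a.
Proof.
move=> s0 c0 /andP[lu uu] lua.
have q0 : 0 < s / c by rewrite divr_gt0.
have m0 : 0 < Num.min 1 (s / c) by rewrite lt_min ltr01.
have u0 : 0 < u by exact: lt_le_trans lu.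
have a0 : 0 < a by rewrite -(pmulr_rgt0 _ u0); exact: lt_le_trans lua.
split=> //; have d1 := distortion_ge1 s0 c0.
rewrite -(ler_pM2l u0) mulr1 mulrCA; apply: le_trans uu _.
by rewrite -distortion_min_max// ler_wpM2l// (le_trans _ d1).
Qed.

Lemma rank_one_step_bound s c u : 0 < s -> 0 < c ->
  Num.min 1 (s / c) <= u -> `|(s - c) / u| <= c * (distortion s c - 1).
Proof.
move=> s0 c0 lu.
have q0 : 0 < s / c by rewrite divr_gt0.
have m0 : 0 < Num.min 1 (s / c) by rewrite lt_min ltr01.
have u0 : 0 < u by exact: lt_le_trans lu.
rewrite normrM normfV (gtr0_norm u0) ler_pdivrMr//.
rewrite -[X in X <= _](_ : c * `|s / c - 1| = _); last first.
  rewrite -{1}(gtr0_norm c0) -normrM mulrBr mulr1 mulrCA divff ?mulr1 ?gt_eqF//.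
rewrite -mulrA ler_wpM2l ?(ltW c0)//.
have d1 := distortion_ge1 s0 c0; have dE := distortion_min_max s0 c0.
apply: (@le_trans _ _ ((distortion s c - 1) * Num.min 1 (s / c))).
  rewrite mulrBl dE mul1r.
  by case: (leP 1 (s / c)) => h; [rewrite ger0_norm|rewrite ler0_norm]; lra.
by rewrite ler_wpM2l// subr_ge0.
Qed.

(** Dimensionless form of the mixed difference: [w] is the normalized kernel entry, [p] and [k] are
    the two normalized steps and [a] is their interaction. The bracket is at most [al^2 m + be^2 n]
    in absolute value. In each resulting term one step joins its own jump, while the other, divided
    by [a], is at most the square of its distortion. *)
Lemma mixed_bound (w p k al be a m n : R) : 0 < a -> 1 <= m -> 1 <= n ->
  1 <= m * a -> 1 <= n * a -> `|p| <= m - 1 -> `|k| <= n - 1 -> `|w| <= 1 ->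
  (w * p * k * (w * p * al ^+ 2 + w * k * be ^+ 2 - 2 * al * be) / a) ^+ 2 <=
  2 * w ^+ 2 * ((al ^+ 2 * p) ^+ 2 * m ^+ 2 * n ^+ 4 +
                (be ^+ 2 * k) ^+ 2 * n ^+ 2 * m ^+ 4).
Proof.
move=> a0 m1 n1 ma na pm kn w1.
set X := _ - 2 * al * be.
have X2 : X ^+ 2 <= 2 * (al ^+ 4 * m ^+ 2 + be ^+ 4 * n ^+ 2).
  have bnd (z l : R) : `|z| <= l -> `|w * z| <= l.
    move=> zl; rewrite normrM -[l]mul1r; apply: ler_pM => //.
  have /andP[x1 x2] : - (m - 1) <= w * p <= m - 1 by rewrite -ler_norml bnd.
  have /andP[y1 y2] : - (n - 1) <= w * k <= n - 1 by rewrite -ler_norml bnd.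
  have A0 : 0 <= al ^+ 2 by exact: sqr_ge0.
  have B0 : 0 <= be ^+ 2 by exact: sqr_ge0.
  have U : `|X| <= al ^+ 2 * m + be ^+ 2 * n.
    have s1 : 0 <= (al + be) ^+ 2 by exact: sqr_ge0.
    have s2 : 0 <= (al - be) ^+ 2 by exact: sqr_ge0.
    rewrite ler_norml; apply/andP; split; rewrite /X; nra.
  have U2 : X ^+ 2 <= (al ^+ 2 * m + be ^+ 2 * n) ^+ 2.
    rewrite -[X in X <= _]real_normK ?num_real// lerXn2r ?nnegrE//.
    exact: le_trans U.
  apply: (le_trans U2).
  have := sqr_ge0 (al ^+ 2 * m - be ^+ 2 * n); nra.
have sq (z l : R) : `|z| <= l - 1 -> 1 <= l -> 1 <= l * a -> (z / a) ^+ 2 <= l ^+ 4.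
  move=> zl l1 la; rewrite -[X in X <= _]real_normK ?num_real//.
  rewrite -[4%N]/(2 * 2)%N exprM lerXn2r ?nnegrE ?sqr_ge0//.
  rewrite normrM normfV (gtr0_norm a0) ler_pdivrMr//.
  have ? : `|z| <= l by lra.
  by rewrite expr2 -mulrA; apply: (le_trans (y := l * 1)); [lra|rewrite ler_wpM2l//; lra].
have kq := sq _ _ kn n1 na; have pq := sq _ _ pm m1 ma.
have -> : (w * p * k * X / a) ^+ 2 = w ^+ 2 * ((p * (k / a)) ^+ 2 * X ^+ 2).
  by field; rewrite gt_eqF.
rewrite [2 * w ^+ 2]mulrC -(mulrA (w ^+ 2) 2) ler_wpM2l ?sqr_ge0//.
apply: (@le_trans _ _ ((p * (k / a)) ^+ 2 * (2 * (al ^+ 4 * m ^+ 2 + be ^+ 4 * n ^+ 2)))).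
  by rewrite ler_wpM2l ?sqr_ge0.
have -> : (p * (k / a)) ^+ 2 * (2 * (al ^+ 4 * m ^+ 2 + be ^+ 4 * n ^+ 2)) =
  2 * ((al ^+ 2 * p) ^+ 2 * m ^+ 2 * (k / a) ^+ 2 +
       (be ^+ 2 * k) ^+ 2 * n ^+ 2 * (p / a) ^+ 2).
  by field; rewrite gt_eqF.
rewrite ler_wpM2l//; apply: lerD; rewrite ler_wpM2l// mulr_ge0 ?sqr_ge0//.
Qed.

End mixed_difference_bound.

Section min_energy_mixed.
Context {R : realType} {J : choiceType}.
Implicit Types (x theta g eta : J -> R).
Variables (F : {fset J}) (W : (J -> R) -> Prop) (a : J -> R).
Hypothesis Wsub : is_subspace W.
Variable f : (J -> R) -> R.
Hypothesis ff : is_min_energy F W a f.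

Definition mixed_diff (f : (J -> R) -> R) x e e' s t :=
  f (upd (upd x e s) e' t) - f (upd x e s) - f (upd x e' t) + f x.

Lemma min_energy_mixed_diff x : (forall i, 0 < x i) ->
  exists G : J -> J -> R,
  [/\ forall e e', e \in F -> e' \in F -> 0 <= G e e',
      forall e e', e \in F -> e' \in F -> G e e' = G e' e,
      forall e, e \in F -> \sum_(e' <- F | e' != e) G e e' <= 1 &
      forall e e' s t, e \in F -> e' \in F -> e != e' -> 0 < s -> 0 < t ->
      mixed_diff f x e e' s t ^+ 2 <= 2 * G e e' *
        ((f (upd x e s) - f x) ^+ 2 *
           distortion s (x e) ^+ 2 * distortion t (x e') ^+ 4 +
         (f (upd x e' t) - f x) ^+ 2 *
           distortion t (x e') ^+ 2 * distortion s (x e) ^+ 4)].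
Proof.
move=> x0; have [theta o fx] := ff x0.
have /boolp.choice[gam rgam] : forall e, exists g,
    e \in F -> is_riesz F W x e g.
  move=> e; have [eF|eF] := boolP (e \in F); last by exists (fun=> 0).
  by have [g rg] := exists_riesz Wsub x0 eF; exists g.
(* The row sum over all of [F] is [x e] times the energy of [gam e], that is [x e * gam e e], a
   diagonal entry of a projection. *)
have G1 e : e \in F -> \sum_(e' <- F) x e * x e' * gam e e' ^+ 2 <= 1.
  move=> eF; have [gg _ g1] := riesz_diag x0 eF (rgam e eF).
  apply: le_trans g1; rewrite -gg /wdot mulr_sumr.
  by apply: ler_sum => i _; rewrite expr2 !mulrA.
have G0 e e' : 0 <= x e * x e' * gam e e' ^+ 2.
  by rewrite mulr_ge0 ?sqr_ge0// mulr_ge0// ltW.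
exists (fun e e' => x e * x e' * gam e e' ^+ 2); split => //.
- move=> e e' eF eF'; rewrite (riesz_sym (rgam e eF) (rgam e' eF')).
  by rewrite [x e * _]mulrC.
- move=> e eF; apply: le_trans (G1 e eF); rewrite big_mkcond.
  by apply: ler_sum => i _; case: ifP.
move=> e e' s t eF eF' ee' s0 t0.
have re := rgam e eF; have re' := rgam e' eF'.
have sym := riesz_sym re re'.
have xs0 := upd_gt0 e x0 s0; have xt0 := upd_gt0 e' x0 t0.
have [os _] := optimal_upd Wsub x0 eF s0 o re.
have rs := riesz_upd Wsub x0 eF s0 re re'.
have rt := riesz_upd Wsub x0 eF' t0 re' re.
have es := rank_one_denom x0 eF re s0.
have et := rank_one_denom x0 eF' re' t0.
have ets := rank_one_denom xs0 eF' rs t0.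
have est := rank_one_denom xt0 eF rt s0.
have xse' : upd x e s e' = x e' by rewrite /upd eq_sym (negbTE ee').
have xte : upd x e' t e = x e by rewrite /upd (negbTE ee').
rewrite /mixed_diff (min_energy_upd Wsub ff xs0 eF' t0 os rs).
rewrite (min_energy_upd Wsub ff x0 eF s0 o re) (min_energy_upd Wsub ff x0 eF' t0 o re').
rewrite xse'; rewrite xse' in ets; rewrite xte in est.
move: es et ets est; rewrite -sym.
have := G1 e eF; rewrite (big_fsetD1 e')//= => h1.
have {h1} G2 : x e * x e' * gam e e' ^+ 2 <= 1.
  by apply: le_trans h1; rewrite lerDl sumr_ge0.
move: G2 (x0 e) (x0 e'); move: (x e) (x e') (theta e) (theta e') (f x).
move: (gam e e) (gam e' e') (gam e e') => al be ga c c' A B f0 G2 c0 c'0.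
set h := (s - c) / _; set tau := (t - c') / _ => es et.
(* Changing one edge multiplies the denominator at the other by [aa]. This factor is symmetric in
   the two edges, hence bounded below by either inverse distortion. *)
set aa := 1 - ga ^+ 2 * h * tau.
have /andP[es1 es2] := es; have /andP[et1 et2] := et.
have min0 (q : R) : 0 < q -> 0 < Num.min 1 q by move=> ?; rewrite lt_min ltr01.
have u0 : 0 < 1 + al * (s - c) by apply: lt_le_trans es1; rewrite min0// divr_gt0.
have v0 : 0 < 1 + be * (t - c') by apply: lt_le_trans et1; rewrite min0// divr_gt0.
have un : 1 + al * (s - c) != 0 by rewrite gt_eqF.
have vn : 1 + be * (t - c') != 0 by rewrite gt_eqF.
have vaE : 1 + (be + - (ga * h) * ga) * (t - c') = (1 + be * (t - c')) * aa.
  by rewrite /aa /tau; field.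
have uaE : 1 + (al + - (ga * tau) * ga) * (s - c) = (1 + al * (s - c)) * aa.
  by rewrite /aa /h; field.
rewrite vaE uaE => /andP[ets1 _] /andP[est1 _].
have [a0 ma] := rank_one_factor_bound s0 c0 es est1.
have [_ na] := rank_one_factor_bound t0 c'0 et ets1.
have hb := rank_one_step_bound s0 c0 es1.
have taub := rank_one_step_bound t0 c'0 et1.
rewrite -/h in hb; rewrite -/tau in taub.
(* Square roots of the weights normalize the kernel entry, whose absolute value is then at most 1
   because a single term of the row sum is. *)
pose m := Num.sqrt c; pose n := Num.sqrt c'.
have m0 : 0 < m by rewrite sqrtr_gt0.
have n0 : 0 < n by rewrite sqrtr_gt0.
have mE : c = m ^+ 2 by rewrite sqr_sqrtr// ltW.
have nE : c' = n ^+ 2 by rewrite sqr_sqrtr// ltW.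
have w1 : `|ga * m * n| <= 1.
  rewrite -(@ler_sqr _ `|_|) ?nnegrE// real_normK ?num_real// expr1n.
  by apply: le_trans G2; rewrite mE nE !exprMn; lra.
have pb : `|h / c| <= distortion s c - 1.
  by rewrite normrM normfV (gtr0_norm c0) ler_pdivrMr// mulrC.
have kb : `|tau / c'| <= distortion t c' - 1.
  by rewrite normrM normfV (gtr0_norm c'0) ler_pdivrMr// mulrC.
have := mixed_bound (m * A) (n * B) a0 (distortion_ge1 s0 c0)
  (distortion_ge1 t0 c'0) ma na pb kb w1.
have cn : c != 0 by rewrite gt_eqF.
have c'n : c' != 0 by rewrite gt_eqF.
have an : aa != 0 by rewrite gt_eqF.
have -> : (m * A) ^+ 2 * (h / c) = A ^+ 2 * h by rewrite exprMn -mE; field.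
have -> : (n * B) ^+ 2 * (tau / c') = B ^+ 2 * tau by rewrite exprMn -nE; field.
have -> : (ga * m * n) ^+ 2 = c * c' * ga ^+ 2 by rewrite mE nE; ring.
have -> : f0 + A ^+ 2 * h - f0 = A ^+ 2 * h by ring.
have -> : f0 + B ^+ 2 * tau - f0 = B ^+ 2 * tau by ring.
apply: le_trans; rewrite le_eqVlt; apply/orP; left; apply/eqP; congr (_ ^+ 2).
have -> : (t - c') / ((1 + be * (t - c')) * aa) = tau / aa.
  by rewrite /tau; field; rewrite vn an.
rewrite [X in _ = X / aa](_ : _ = ga * h * tau *
    (ga * A ^+ 2 * h + ga * B ^+ 2 * tau - 2 * A * B)); last first.
  by rewrite mE nE; field; rewrite !gt_eqF.
by rewrite /aa; field; rewrite -/aa.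
Qed.

End min_energy_mixed.

(** * Single-edge resampling *)

Section single_site.
Context {R : realType} d (Omega : measurableType d) (P : probability Omega R)
  (J : choiceType) (r : J -> {RV P >-> R}).
Hypothesis ind : mutually_independent r.
Hypothesis r_gt0 : forall i w, (0 < r i w)%R.
Local Open Scope ereal_scope.
Implicit Types (x y : J -> R) (S T : {fset J}) (g : (J -> R) -> \bar R).

(** [powR] at exponent -1 gives the inverse of nonnegative reals, hence the passage through the
    square; at 0 both sides are 0. *)
Lemma measurable_invr : measurable_fun setT (GRing.inv : R -> R).
Proof.
rewrite (_ : GRing.inv = fun x : R => (x * (x ^+ 2) `^ (-1))%R).
  apply: measurable_funM => //; apply: (measurableT_comp (measurable_powR _)).
  exact: measurable_funX.
apply/funext => x; rewrite powR_inv1 ?sqr_ge0//.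
have [->|x0] := eqVneq x 0%R; first by rewrite invr0 mul0r.
by rewrite expr2 invfM mulrA mulfV// mul1r.
Qed.

Definition coord_measurable2 (G : (J -> R) -> R -> \bar R) :=
  forall d (T : measurableType d) (y : T -> J -> R) (s : T -> R),
    (forall i, measurable_fun setT (fun t => y t i)) -> measurable_fun setT s ->
    (forall t i, (0 < y t i)%R) -> (forall t, (0 < s t)%R) ->
    measurable_fun setT (fun t => G (y t) (s t)).

Lemma measurable_upd d' (T : measurableType d') (y : T -> J -> R) e (s : T -> R) i :
  (forall i, measurable_fun setT (fun t => y t i)) -> measurable_fun setT s ->
  measurable_fun setT (fun t => upd (y t) e (s t) i).
Proof. by move=> my ms; rewrite /upd; case: (i == e). Qed.

Lemma coord_measurable_upd2 e g : coord_measurable g ->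
  coord_measurable2 (fun x s => g (upd x e s)).
Proof.
move=> mg d' T y s my ms y0 s0; apply: mg; first by move=> i; exact: measurable_upd.
by move=> t; exact: upd_gt0.
Qed.

Lemma coord_measurable_int e (G : (J -> R) -> R -> \bar R) :
  coord_measurable2 G -> (forall x s, 0 <= G x s) ->
  coord_measurable (fun x => \int[P]_w G x (r e w)).
Proof.
move=> mG G0 d' T y my y0.
apply: (measurable_fun_fubini_tonelli_F (m2 := P)
  (fun z : T * Omega => G (y z.1) (r e z.2))) => //.
apply: mG => //.
- by move=> i; apply: (measurableT_comp (my i)); exact: measurable_fst.
- by apply: measurableT_comp => //; exact: measurable_snd.
Qed.

Definition resample e g x := \int[P]_w g (upd x e (r e w)).

Lemma coord_measurable_resample e g : coord_measurable g ->
  (forall x, 0 <= g x) -> coord_measurable (resample e g).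
Proof.
move=> mg g0; apply: (@coord_measurable_int e (fun x s => g (upd x e s))) => //.
exact: coord_measurable_upd2.
Qed.

Lemma resample_ge0 e g x : (forall x, 0 <= g x) -> 0 <= resample e g x.
Proof. by move=> g0; apply: integral_ge0. Qed.

Lemma resample_cond F e g x : depends_on F g -> (forall i, (0 < x i)%R) ->
  cond r (F `\ e)%fset g x = resample e g x.
Proof.
move=> gF x0; apply: eq_integral => w _; apply: gF.
- by apply: mix_gt0 => //; exact: config_gt0.
- exact: upd_gt0.
move=> i iF; rewrite /mix /upd in_fsetD1 iF andbT /config.
by case: eqVneq => [->|].
Qed.

(** By [mean_cond] for the singleton, the value at [e] and the other coordinates may come from
    different copies; Tonelli exchanges the copies. *)
Lemma mean_resample e g : coord_measurable g -> (forall x, 0 <= g x) ->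
  mean r (resample e g) = mean r g.
Proof.
move=> mg g0; rewrite -(mean_cond ind r_gt0 [fset e]%fset mg g0) /mean /cond.
have mh : measurable_fun setT (fun z : Omega * Omega =>
    g (mix [fset e]%fset (config r z.1) (config r z.2))).
  apply: mg; last by move=> t; apply: mix_gt0; exact: config_gt0.
  move=> i; apply: measurable_mix.
    by apply: (measurableT_comp (measurable_config r i)); exact: measurable_fst.
  by apply: (measurableT_comp (measurable_config r i)); exact: measurable_snd.
have h0 (z : Omega * Omega) :
    0 <= g (mix [fset e]%fset (config r z.1) (config r z.2)) by [].
rewrite [RHS](_ : _ = \int[P \x P]_z
   g (mix [fset e]%fset (config r z.1) (config r z.2))); last first.
  by rewrite (fubini_tonelli1 _ mh h0).
rewrite (fubini_tonelli2 _ mh h0).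
apply: eq_integral => w _; apply: eq_integral => w' _; congr g.
by apply/funext => i; rewrite /mix /upd in_fset1 /config; case: eqVneq => [->|].
Qed.

Lemma measurable_RV_pair (i : J) : measurable_fun setT (fun z : Omega * Omega => r i z.1)
  /\ measurable_fun setT (fun z : Omega * Omega => r i z.2).
Proof.
by split; apply: measurableT_comp.
Qed.

(* [K c] is a squared difference with reference point [c]: restricting the
   reference point to an event of probability at least [1/2] is harmless. *)
Lemma restrict_reference (chi : Omega -> R) (K : Omega -> Omega -> \bar R) :
  measurable_fun setT chi -> (forall w, 0 <= chi w)%R ->
  (2^-1)%:E <= \int[P]_w (chi w)%:E ->
  measurable_fun setT (fun z : Omega * Omega => K z.1 z.2) ->
  (forall c w, 0 <= K c w) ->
  (forall c a w, K a w <= 2%:E * K c a + 2%:E * K c w) ->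
  \int[P]_a \int[P]_w K a w <= 8%:E * \int[P]_c ((chi c)%:E * \int[P]_w K c w).
Proof.
move=> mchi chi0 chi2 mK K0 Ktri.
have mKc c : measurable_fun setT (K c).
  by have := measurableT_comp mK (pair1_measurable c).
have mIK : measurable_fun setT (fun c => \int[P]_w K c w).
  exact: (measurable_fun_fubini_tonelli_F (m2 := P) _ mK (fun z => K0 z.1 z.2)).
have IK0 c : 0 <= \int[P]_w K c w by apply: integral_ge0.
have mchiE : measurable_fun setT (fun w => (chi w)%:E) by apply/measurable_EFinP.
have chiE0 c : 0 <= (chi c)%:E by rewrite lee_fin.
set I := \int[P]_a _.
have I0 : 0 <= I by apply: integral_ge0.
have int1 (k : \bar R) : \int[P]_w k = k.
  by rewrite integral_cst//= probability_setT mule1.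
have Ic c : I <= 4%:E * \int[P]_w K c w.
  apply: (@le_trans _ _ (\int[P]_a (2%:E * K c a + 2%:E * \int[P]_w K c w))).
    apply: ge0_le_integral => //.
      by apply: emeasurable_funD => //; apply: measurable_funeM.
    move=> a _; apply: (@le_trans _ _ (\int[P]_w (2%:E * K c a + 2%:E * K c w))).
      apply: ge0_le_integral => //.
      by apply: emeasurable_funD => //; apply: measurable_funeM.
    rewrite ge0_integralD//; last 3 first.
    - by move=> w _; rewrite mule_ge0.
    - by move=> w _; rewrite mule_ge0.
    - exact: measurable_funeM.
    by rewrite int1 ge0_integralZl.
  rewrite ge0_integralD//; last 3 first.
  - by move=> w _; rewrite mule_ge0.
  - exact: measurable_funeM.
  - by move=> w _; rewrite mule_ge0.
  rewrite int1 ge0_integralZl// -ge0_muleDl// -EFinD.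
  by rewrite (_ : (2 + 2 = 4)%R)//; ring.
have h : (2^-1)%:E * I <= 4%:E * \int[P]_c ((chi c)%:E * \int[P]_w K c w).
  apply: (@le_trans _ _ (\int[P]_c ((chi c)%:E * I))).
    rewrite ge0_integralZr//.
    exact: lee_wpmul2r.
  rewrite -ge0_integralZl//; last 2 first.
  - by apply: emeasurable_funM => //; apply/measurable_EFinP.
  - by move=> c _; rewrite mule_ge0// lee_fin.
  apply: ge0_le_integral => //.
  - by move=> c _; rewrite mule_ge0// lee_fin.
  - by apply: emeasurable_funM => //; apply/measurable_EFinP.
  - by apply: measurable_funeM; apply: emeasurable_funM => //; apply/measurable_EFinP.
  - by move=> c _; rewrite muleCA lee_wpmul2l// lee_fin.
rewrite [X in X <= _](_ : _ = 2%:E * ((2^-1)%:E * I)); last first.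
  by rewrite muleA -EFinM mulfV// mul1e.
rewrite (_ : 8%:E = 2%:E * 4%:E); last by rewrite -EFinM; congr (_%:E); ring.
by rewrite -muleA lee_wpmul2l.
Qed.

(** Both means are unchanged when the coordinate [e] is resampled. This makes the reference value an
    independent variable, and [restrict_reference] applies with all other coordinates fixed. *)
Lemma mean_restrict_reference e (chi : R -> R) (G : (J -> R) -> R -> \bar R) :
  measurable_fun setT chi -> (forall s, 0 <= chi s)%R ->
  (2^-1)%:E <= \int[P]_w (chi (r e w))%:E ->
  coord_measurable2 G -> (forall x s, 0 <= G x s) ->
  (forall x a c s, (forall i, (0 < x i)%R) -> (0 < a)%R -> (0 < c)%R -> (0 < s)%R ->
     G (upd x e a) s <= 2%:E * G (upd x e c) a + 2%:E * G (upd x e c) s) ->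
  mean r (fun x => \int[P]_w G x (r e w)) <=
  8%:E * mean r (fun x => (chi (x e))%:E * \int[P]_w G x (r e w)).
Proof.
move=> mchi chi0 chi2 mG G0 Gtri.
pose h x := \int[P]_w G x (r e w).
have mh : coord_measurable h by exact: coord_measurable_int.
have h0 x : 0 <= h x by apply: integral_ge0.
have mchih : coord_measurable (fun x => (chi (x e))%:E * h x).
  apply: coord_measurableM => // d' T y my y0.
  by apply/measurable_EFinP; apply: measurableT_comp.
have chih0 x : 0 <= (chi (x e))%:E * h x by rewrite mule_ge0// lee_fin.
rewrite -[leLHS](mean_resample e mh h0) -[X in _ * X](mean_resample e mchih chih0).
rewrite /mean -ge0_integralZl//; last 2 first.
- by apply: measurable_comp_config => //; exact: coord_measurable_resample.
- by move=> w _; exact: resample_ge0.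
apply: ge0_le_integral => //.
- by move=> w _; exact: resample_ge0.
- by apply: measurable_comp_config => //; exact: coord_measurable_resample.
- apply: measurable_funeM.
  by apply: measurable_comp_config => //; exact: coord_measurable_resample.
move=> w _; rewrite /resample /h.
have c0 := config_gt0 r_gt0 w.
under [X in _ <= _ * X]eq_integral => w' _ do rewrite /upd eqxx -/(upd _ _ _).
apply: (@restrict_reference (fun w' => chi (r e w'))
  (fun a w' => G (upd (config r w) e (r e a)) (r e w'))) => //.
- exact: measurableT_comp.
- have [m1 m2] := measurable_RV_pair e.
  apply: mG => //.
  + by move=> i; apply: measurable_upd.
  + by move=> t; apply: upd_gt0.
- by move=> c a w'; exact: Gtri.
Qed.

End single_site.

(** * First and mixed differences as squared norms of projections *)

Section jensen.
Context {R : realType} d (T : measurableType d) (P : probability T R).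
Local Open Scope ereal_scope.

(** Integrate [(X - Y - m)^2 >= 0] with [m = p - q]. Splitting [m] into positive and negative parts
    and moving terms across keeps every integrand nonnegative, so no square integrability is
    required in advance. *)
Lemma sqr_integral_diff_le (X Y : T -> R) (p q : R) :
  measurable_fun setT X -> measurable_fun setT Y ->
  (forall w, 0 <= X w)%R -> (forall w, 0 <= Y w)%R ->
  \int[P]_w (X w)%:E = p%:E -> \int[P]_w (Y w)%:E = q%:E ->
  ((p - q) ^+ 2)%:E <= \int[P]_w ((X w - Y w) ^+ 2)%:E.
Proof.
move=> mX mY X0 Y0 Xp Yq.
have mXE : measurable_fun setT (fun w => (X w)%:E) by apply/measurable_EFinP.
have mYE : measurable_fun setT (fun w => (Y w)%:E) by apply/measurable_EFinP.
pose m : R := (p - q)%R; pose mp : R := Num.max m 0%R; pose mn : R := Num.max (- m)%R 0%R.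
have mp0 : (0 <= mp)%R by rewrite le_max lexx orbT.
have mn0 : (0 <= mn)%R by rewrite le_max lexx orbT.
have mE : (m = mp - mn)%R.
  by rewrite /mp /mn; case: (leP m 0%R) => h; case: (leP (- m)%R 0%R) => h'; lra.
have lin (a b c : R) : (0 <= a)%R -> (0 <= b)%R -> (0 <= c)%R ->
    \int[P]_w (a + b * X w + c * Y w)%:E = (a + b * p + c * q)%:E.
  rewrite -!lee_fin => a0 b0 c0; under eq_integral do rewrite 2!EFinD 2!EFinM.
  have bX w : 0 <= b%:E * (X w)%:E by rewrite mule_ge0// lee_fin.
  have cY w : 0 <= c%:E * (Y w)%:E by rewrite mule_ge0// lee_fin.
  have mbX : measurable_fun setT (fun w => b%:E * (X w)%:E) by exact: measurable_funeM.
  have mcY : measurable_fun setT (fun w => c%:E * (Y w)%:E) by exact: measurable_funeM.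
  rewrite ge0_integralD//; last 2 first.
  - by move=> w _; rewrite adde_ge0.
  - exact: emeasurable_funD.
  rewrite ge0_integralD//.
  rewrite integral_cst//= probability_setT mule1 !ge0_integralZl//; try by move=> w _; rewrite lee_fin.
  by rewrite Xp Yq.
have mD : measurable_fun setT (fun w => ((X w - Y w) ^+ 2)%:E).
  by apply/measurable_EFinP/measurable_funX/measurable_funB.
have m20 : (0 <= m ^+ 2)%R by exact: sqr_ge0.
have : \int[P]_w (0 + (2 * mp) * X w + (2 * mn) * Y w)%:E <=
    \int[P]_w (((X w - Y w) ^+ 2)%:E + (m ^+ 2 + (2 * mn) * X w + (2 * mp) * Y w)%:E).
  have mlin (a b c : R) : measurable_fun setT (fun w => (a + b * X w + c * Y w)%:E).
    apply/measurable_EFinP/measurable_funD; last exact: measurable_funM.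
    by apply: measurable_funD => //; exact: measurable_funM.
  apply: ge0_le_integral => //.
  - by move=> w _; rewrite lee_fin !addr_ge0 ?mulr_ge0.
  - exact: emeasurable_funD.
  move=> w _; rewrite -EFinD lee_fin.
  rewrite mE; clearbody mp mn.
  have := sqr_ge0 (X w - Y w - (mp - mn))%R; lra.
rewrite ge0_integralD//; last 3 first.
- by move=> w _; rewrite lee_fin sqr_ge0.
- by move=> w _; rewrite lee_fin !addr_ge0 ?m20 ?mulr_ge0.
- apply/measurable_EFinP/measurable_funD; last exact: measurable_funM.
  by apply: measurable_funD => //; exact: measurable_funM.
rewrite !lin ?m20 ?mulr_ge0//.
have : 0 <= \int[P]_w ((X w - Y w) ^+ 2)%:E.
  by apply: integral_ge0 => w _; rewrite lee_fin sqr_ge0.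
case: (\int[P]_w _) => [I||]; [|by move=> _ _; exact: leey|by []].
rewrite -EFinD !lee_fin -/m => I0.
have mm : (2 * (mp - mn) * (p - q) = 2 * m ^+ 2)%R by rewrite -mE -/m; ring.
clearbody mp mn m; lra.
Qed.

End jensen.

Section efron_stein.
Context {R : realType} d (Omega : measurableType d) (P : probability Omega R)
  (J : choiceType) (r : J -> {RV P >-> R}).
Hypothesis ind : mutually_independent r.
Hypothesis r_gt0 : forall i w, (0 < r i w)%R.
Local Open Scope ereal_scope.
Variables (F : {fset J}) (f : (J -> R) -> R).
Hypothesis f0 : forall x, (0 <= f x)%R.
Let g x := (f x)%:E.
Hypothesis mg : coord_measurable g.
Hypothesis gF : depends_on F g.
Hypothesis cond_fin : forall T x, (forall i, 0 < x i)%R -> cond r T g x < +oo.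
Variable v : {fset J} -> R.
Hypothesis phiE : forall T, phi r g T = (v T)%:E.

Implicit Types (x : J -> R) (T : {fset J}).

Let g0 x : 0 <= g x. Proof. by rewrite /g lee_fin. Qed.

Lemma mean_add (h k : (J -> R) -> \bar R) : coord_measurable h ->
  coord_measurable k -> (forall x, 0 <= h x) -> (forall x, 0 <= k x) ->
  mean r (fun x => h x + k x) = mean r h + mean r k.
Proof.
move=> mh mk h0 k0; rewrite /mean ge0_integralD//.
- exact: measurable_comp_config.
- exact: measurable_comp_config.
Qed.

Lemma mean_scale (c : R) (h : (J -> R) -> \bar R) : coord_measurable h ->
  (forall x, 0 <= h x) -> (0 <= c)%R ->
  mean r (fun x => c%:E * h x) = c%:E * mean r h.
Proof.
by move=> mh h0 c0; rewrite /mean ge0_integralZl//; exact: measurable_comp_config.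
Qed.

Lemma coord_measurableZ (c : R) (h : (J -> R) -> \bar R) : coord_measurable h ->
  coord_measurable (fun x => c%:E * h x).
Proof. by move=> mh d' S y my y0; apply: measurable_funeM; exact: mh. Qed.

Let u T x := fine (cond r T g x).

Let uE T x : (forall i, 0 < x i)%R -> (u T x)%:E = cond r T g x.
Proof. by move=> x0; rewrite /u fineK// ge0_fin_numE ?cond_ge0//; exact: cond_fin. Qed.

Let u0 T x : (0 <= u T x)%R.
Proof. by apply: fine_ge0; exact: cond_ge0. Qed.

Let mu_ T : coord_measurable (fun x => (u T x)%:E).
Proof.
move=> d' S y my y0; apply/measurable_EFinP; apply: measurableT_comp => //.
have := coord_measurable_cond r_gt0 T mg g0; exact.
Qed.

Let mmu T T' : coord_measurable (fun x => (u T x * u T' x)%:E).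
Proof.
move=> d' S y my y0; apply/measurable_EFinP/measurable_funM; apply/measurable_EFinP.
  exact: mu_.
exact: mu_.
Qed.

Let muu T T' : mean r (fun x => (u T x * u T' x)%:E) = phi r g (T `&` T')%fset.
Proof.
rewrite -(mean_cond_cond ind r_gt0 T T' mg g0); apply: (eq_mean r_gt0) => x x0.
by rewrite EFinM !uE.
Qed.

Let diff2 e e' x : R :=
  (u F x - u (F `\ e)%fset x - u (F `\ e')%fset x + u ((F `\ e) `\ e')%fset x)%R.

(** The mean of a product of two projections is [phi] at the intersection of their sets, and all
    intersections are again among the four sets. *)
Lemma mean_mixed_projection e e' :
  mean r (fun x => (diff2 e e' x ^+ 2)%:E) =
  (v F - v (F `\ e)%fset - v (F `\ e')%fset
   + v ((F `\ e) `\ e')%fset)%:E.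
Proof.
have comb (s : seq ({fset J} * {fset J})) :
    mean r (fun x => (\sum_(k <- s) u k.1 x * u k.2 x)%:E) =
    (\sum_(k <- s) v (k.1 `&` k.2)%fset)%:E.
  elim: s => [|k s IH].
    rewrite big_nil /mean (eq_integral (cst 0)) ?integral0// => w _.
    by rewrite big_nil.
  rewrite big_cons EFinD -IH -phiE -muu -mean_add//.
  - by apply: (eq_mean r_gt0) => x x0; rewrite big_cons EFinD.
  - move=> d' S y my y0; apply/measurable_EFinP/measurable_sum => k'.
    by apply/measurable_EFinP; exact: mmu.
  - by move=> x; rewrite lee_fin mulr_ge0.
  - by move=> x; rewrite lee_fin sumr_ge0// => k' _; rewrite mulr_ge0.
pose D x := (diff2 e e' x ^+ 2)%:E.
have mq : coord_measurable D.
  move=> d' S y my y0; apply/measurable_EFinP/measurable_funX.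
  have m T : measurable_fun setT (fun t => u T (y t)).
    by apply/measurable_EFinP; exact: mu_.
  apply: measurable_funD => //; apply: measurable_funB => //.
  exact: measurable_funB.
have q0 x : 0 <= D x by rewrite lee_fin sqr_ge0.
pose T2 := (F `\ e)%fset; pose T3 := (F `\ e')%fset; pose T4 := ((F `\ e) `\ e')%fset.
(* [s1] lists the products with negative sign in the expanded square and [s2] the others, with
   multiplicity. Moving [s1] to the left leaves only sums of nonnegative terms. *)
pose s1 := [:: (F, T2); (F, T2); (F, T3); (F, T3); (T2, T4); (T2, T4); (T3, T4); (T3, T4)].
pose s2 := [:: (F, F); (T2, T2); (T3, T3); (T4, T4); (F, T4); (F, T4); (T2, T3); (T2, T3)].
have : mean r (fun x => D x + (\sum_(k <- s1) u k.1 x * u k.2 x)%:E) =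
    mean r (fun x => (\sum_(k <- s2) u k.1 x * u k.2 x)%:E).
  apply: (eq_mean r_gt0) => x x0; rewrite /D -EFinD; congr (_%:E).
  rewrite /s1 /s2 !big_cons !big_nil /= /diff2 -/T2 -/T3 -/T4.
  by move: (u F x) (u T2 x) (u T3 x) (u T4 x) => a b c k; ring.
rewrite mean_add//; last 2 first.
- move=> d' S y my y0; apply/measurable_EFinP/measurable_sum => k'.
  by apply/measurable_EFinP; exact: mmu.
- by move=> x; rewrite lee_fin sumr_ge0// => k' _; rewrite mulr_ge0.
rewrite !comb /s1 /s2 !big_cons !big_nil /= !fsetIid.
have -> : (F `&` T2 = T2)%fset by apply/fsetIidPr; exact: fsubD1set.
have -> : (F `&` T3 = T3)%fset by apply/fsetIidPr; exact: fsubD1set.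
have -> : (F `&` T4 = T4)%fset.
  by apply/fsetP => i; rewrite !(in_fsetI, in_fsetD1); case: (i \in F); rewrite ?andbF.
have -> : (T2 `&` T4 = T4)%fset by apply/fsetIidPr; exact: fsubD1set.
have -> : (T3 `&` T4 = T4)%fset.
  by apply/fsetP => i; rewrite !(in_fsetI, in_fsetD1); case: (i == e'); case: (i \in F); rewrite ?andbF.
have -> : (T2 `&` T3 = T4)%fset.
  by apply/fsetP => i; rewrite !(in_fsetI, in_fsetD1); case: (i == e'); case: (i \in F); rewrite ?andbF ?andbT.
rewrite -/T2 -/T3 -/T4 -/D.
have : 0 <= mean r D by apply: integral_ge0 => w _.
case: (mean r D) => [V||]// _.
by rewrite -EFinD => -[] hV; congr (_%:E); lra.
Qed.

(** Both squares have mean [v F], since resampling preserves the law, and the cross term has mean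
    [v] at [F] without [e]. *)
Lemma mean_sqr_resample_diff e :
  mean r (fun x => \int[P]_w ((f (upd x e (r e w)) - f x) ^+ 2)%:E) =
  (2 * (v F - v (F `\ e)%fset))%:E.
Proof.
pose h x s := ((f (upd x e s) - f x) ^+ 2)%:E.
have mf2 d' (S : measurableType d') (y : S -> J -> R) (s : S -> R) :
    (forall i, measurable_fun setT (fun t => y t i)) -> measurable_fun setT s ->
    (forall t i, (0 < y t i)%R) -> (forall t, (0 < s t)%R) ->
    measurable_fun setT (fun t => f (upd (y t) e (s t))).
  move=> my ms y0 s0; apply/measurable_EFinP.
  exact: (coord_measurable_upd2 e mg my ms y0 s0).
have mh : coord_measurable2 h.
  move=> d' S y s my ms y0 s0; apply/measurable_EFinP/measurable_funX/measurable_funB.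
    exact: mf2.
  by apply/measurable_EFinP; exact: mg.
have h0 x s : 0 <= h x s by rewrite lee_fin sqr_ge0.
pose H x := \int[P]_w h x (r e w).
have mH : coord_measurable H by exact: coord_measurable_int.
have H0 x : 0 <= H x by apply: integral_ge0.
pose gg x := (f x ^+ 2)%:E.
have mgg : coord_measurable gg.
  move=> d' S y my y0; apply/measurable_EFinP/measurable_funX.
  by apply/measurable_EFinP; exact: mg.
have gg0 x : 0 <= gg x by rewrite lee_fin sqr_ge0.
have mrg := coord_measurable_resample r_gt0 e mg g0.
have rsg0 x : 0 <= resample r e g x by exact: resample_ge0.
have mrgg := coord_measurable_resample r_gt0 e mgg gg0.
have rgg0 x : 0 <= resample r e gg x by exact: resample_ge0.
pose k x := g x * resample r e g x.
have mk : coord_measurable k by exact: coord_measurableM.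
have k0 x : 0 <= k x by exact: mule_ge0.
have kE : mean r k = phi r g (F `\ e)%fset.
  rewrite -[RHS](_ : phi r g (F `&` (F `\ e))%fset = _); last first.
    by congr phi; apply/fsetIidPr; exact: fsubD1set.
  rewrite -(mean_cond_cond ind r_gt0 _ _ mg g0); apply: (eq_mean r_gt0) => x x0.
  by rewrite (cond_depends r_gt0 gF x0) (resample_cond r_gt0 e gF x0).
have ggE : mean r gg = phi r g F.
  apply: (eq_mean r_gt0) => x x0.
  by rewrite (cond_depends r_gt0 gF x0) /gg expr2 EFinM.
have key x : (forall i, 0 < x i)%R -> H x + 2%:E * k x = gg x + resample r e gg x.
  move=> x0.
  have cx (i : J) : measurable_fun setT (fun w : Omega => x i) by [].
  have mr : measurable_fun setT (fun w => r e w) by [].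
  have mfx : measurable_fun setT (fun w => f (upd x e (r e w))).
    exact: (mf2 _ _ (fun=> x)).
  have mfxE : measurable_fun setT (fun w => (f (upd x e (r e w)))%:E).
    by apply/measurable_EFinP.
  transitivity (\int[P]_w (h x (r e w) + (2 * f x)%:E * (f (upd x e (r e w)))%:E)).
    have c2 : 0 <= (2 * f x)%:E by rewrite lee_fin mulr_ge0.
    have fw0 w : 0 <= (f (upd x e (r e w)))%:E by rewrite lee_fin.
    have mhx : measurable_fun setT (fun w => h x (r e w)) by exact: (mh _ _ (fun=> x)).
    have mcf : measurable_fun setT (fun w => (2 * f x)%:E * (f (upd x e (r e w)))%:E).
      exact: measurable_funeM.
    have cf0 w : 0 <= (2 * f x)%:E * (f (upd x e (r e w)))%:E by exact: mule_ge0.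
    rewrite (ge0_integralD P measurableT (fun w _ => h0 x (r e w)) mhx (fun w _ => cf0 w) mcf).
    rewrite (ge0_integralZl P measurableT mfxE (fun w _ => fw0 w) c2).
    by rewrite EFinM -muleA.
  transitivity (\int[P]_w (gg x + gg (upd x e (r e w)))).
    apply: eq_integral => w _; rewrite /h /gg -EFinM -!EFinD; congr (_%:E); ring.
  have mggx : measurable_fun setT (fun w => gg (upd x e (r e w))).
    by apply/measurable_EFinP/measurable_funX.
  rewrite (ge0_integralD P measurableT (fun w _ => gg0 x) (measurable_cst _)
    (fun w _ => gg0 _) mggx).
  by rewrite integral_cst//= probability_setT mule1.
have rggE := mean_resample ind r_gt0 e mgg gg0.
change (mean r H = (2 * (v F - v (F `\ e)%fset))%:E).
have := eq_mean r_gt0 key; move: rggE; set rg := resample r e gg in mrgg rgg0 key *.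
clearbody H k gg rg => rggE.
have k20 x : 0 <= 2%:E * k x by rewrite mule_ge0.
rewrite (mean_add mH (coord_measurableZ 2 mk) H0 k20).
rewrite (mean_add mgg mrgg gg0 rgg0) (mean_scale mk k0 (ler0n R 2)).
rewrite kE rggE ggE !phiE.
have : 0 <= mean r H by apply: integral_ge0 => w _.
case: (mean r H) => [V||]//.
by rewrite -EFinM -!EFinD => _ -[] hV; congr (_%:E); lra.
Qed.

(** [diff2] is the average of the mixed difference over independent new values at the two edges, so
    this is Jensen's inequality. *)
Lemma sqr_mixed_projection_le e e' x : (forall i, 0 < x i)%R ->
  (diff2 e e' x ^+ 2)%:E <=
  \int[P]_w \int[P]_w' (mixed_diff f x e e' (r e w) (r e' w') ^+ 2)%:E.
Proof.
move=> x0; have [me1 me2] := measurable_RV_pair r e.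
have [me1' me2'] := measurable_RV_pair r e'.
have cx (i : J) : measurable_fun setT (fun w : Omega * Omega => x i) by [].
have mb : measurable_fun setT (fun z : Omega * Omega => f (upd x e (r e z.1))).
  by apply/measurable_EFinP; exact: (coord_measurable_upd2 e mg cx me1).
have mc : measurable_fun setT (fun z : Omega * Omega => f (upd x e' (r e' z.2))).
  by apply/measurable_EFinP; exact: (coord_measurable_upd2 e' mg cx me2').
have md : measurable_fun setT (fun z : Omega * Omega =>
    f (upd (upd x e (r e z.1)) e' (r e' z.2))).
  apply/measurable_EFinP; apply: (coord_measurable_upd2 e' mg _ me2') => //.
    by move=> i; exact: measurable_upd.
  by move=> t; exact: upd_gt0.
have iter (h : Omega * Omega -> R) : measurable_fun setT h -> (forall z, 0 <= h z)%R ->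
    \int[P \x P]_z (h z)%:E = \int[P]_w \int[P]_w' (h (w, w'))%:E.
  move=> mh h0; rewrite fubini_tonelli1//; first exact/measurable_EFinP.
have rF h y : depends_on F h -> (forall i, 0 < y i)%R ->
   resample r e h y = cond r (F `\ e)%fset h y.
  by move=> hF y0; rewrite (resample_cond r_gt0 e hF y0).
have ID : \int[P \x P]_z (f (upd (upd x e (r e z.1)) e' (r e' z.2)))%:E =
    (u ((F `\ e) `\ e')%fset x)%:E.
  rewrite (iter _ md)//= uE//.
  have -> : ((F `\ e) `\ e' = (F `\ e') `&` (F `\ e))%fset.
    by apply/fsetP => i; rewrite !(in_fsetI, in_fsetD1); case: (i == e');
      case: (i \in F); rewrite ?andbF ?andbT.
  rewrite -(cond_cond ind r_gt0 _ _ mg g0 x0) -rF//; last first.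
    move=> y z y0 z0 yz; apply: depends_on_cond => // i.
    by rewrite in_fsetD1 => /andP[_]; exact: yz.
  apply: eq_integral => w _; rewrite (resample_cond r_gt0 e' gF)//.
  exact: upd_gt0.
have int1 (k : \bar R) : \int[P]_w k = k.
  by rewrite integral_cst//= probability_setT mule1.
have IB : \int[P \x P]_z (f (upd x e (r e z.1)))%:E = (u (F `\ e)%fset x)%:E.
  rewrite (iter _ mb)//= uE// (resample_cond r_gt0 e gF x0).
  by apply: eq_integral => w _; rewrite int1.
have IC : \int[P \x P]_z (f (upd x e' (r e' z.2)))%:E = (u (F `\ e')%fset x)%:E.
  by rewrite (iter _ mc)//= uE// (resample_cond r_gt0 e' gF x0) int1.
have IA : \int[P \x P]_z (f x)%:E = (u F x)%:E.
  by rewrite (iter (fun=> f x))//= uE// (cond_depends r_gt0 gF x0) !int1.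
have add (h k : Omega * Omega -> R) p q : measurable_fun setT h ->
    measurable_fun setT k -> (forall z, 0 <= h z)%R -> (forall z, 0 <= k z)%R ->
    \int[P \x P]_z (h z)%:E = p%:E -> \int[P \x P]_z (k z)%:E = q%:E ->
    \int[P \x P]_z (h z + k z)%:E = (p + q)%:E.
  move=> mh mk h0 k0 hp kq; under eq_integral do rewrite EFinD.
  rewrite ge0_integralD//; [by rewrite hp kq|..].
  - by move=> z _; rewrite lee_fin.
  - exact/measurable_EFinP.
  - by move=> z _; rewrite lee_fin.
  - exact/measurable_EFinP.
(* The terms of the mixed difference are grouped by sign into two nonnegative functions, as
   [sqr_integral_diff_le] requires. *)
have IX := add _ _ _ _ (measurable_cst (f x)) md (fun=> f0 x) (fun=> f0 _) IA ID.
have IY := add _ _ _ _ mb mc (fun=> f0 _) (fun=> f0 _) IB IC.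
have mX := measurable_funD (measurable_cst (f x)) md.
have mY := measurable_funD mb mc.
have := sqr_integral_diff_le mX mY (fun=> addr_ge0 (f0 _) (f0 _))
  (fun=> addr_ge0 (f0 _) (f0 _)) IX IY.
rewrite (iter (fun z => (_ - _) ^+ 2)%R) /=; last 2 first.
- by apply/measurable_funX/measurable_funB.
- by move=> z; exact: sqr_ge0.
rewrite [X in (X ^+ 2)%:E](_ : _ = diff2 e e' x); last by rewrite /diff2; ring.
move/le_trans; apply; rewrite le_eqVlt; apply/orP; left; apply/eqP.
apply: eq_integral => w _; apply: eq_integral => w' _; congr (_%:E).
by rewrite /mixed_diff; ring.
Qed.

Lemma measurable_mixed_diff e e' d' (S : measurableType d') (y : S -> J -> R)
    (s t : S -> R) :
  (forall i, measurable_fun setT (fun z => y z i)) -> measurable_fun setT s ->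
  measurable_fun setT t -> (forall z i, (0 < y z i)%R) ->
  (forall z, (0 < s z)%R) -> (forall z, (0 < t z)%R) ->
  measurable_fun setT (fun z => (mixed_diff f (y z) e e' (s z) (t z) ^+ 2)%:E).
Proof.
move=> my ms mt y0 s0 t0; apply/measurable_EFinP/measurable_funX.
have mys i : measurable_fun setT (fun z => upd (y z) e (s z) i).
  exact: measurable_upd.
have ys0 z i : (0 < upd (y z) e (s z) i)%R by exact: upd_gt0.
rewrite /mixed_diff; apply: measurable_funD; last by apply/measurable_EFinP; exact: mg.
apply: measurable_funB; last first.
  by apply/measurable_EFinP; exact: (coord_measurable_upd2 e' mg my mt y0 t0).
apply: measurable_funB; apply/measurable_EFinP.
  exact: (coord_measurable_upd2 e' mg mys mt ys0 t0).
exact: (coord_measurable_upd2 e mg my ms y0 s0).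
Qed.

Lemma coord_measurable_mixed_left e e' : coord_measurable2 (fun x s =>
  \int[P]_w' (mixed_diff f x e e' s (r e' w') ^+ 2)%:E).
Proof.
move=> d' S y s my ms y0 s0.
apply: (measurable_fun_fubini_tonelli_F (m2 := P) (fun z : S * Omega =>
  (mixed_diff f (y z.1) e e' (s z.1) (r e' z.2) ^+ 2)%:E)) => [|z].
  apply: measurable_mixed_diff => // [i||]; try exact: measurableT_comp.
  by apply: (measurableT_comp (my i)); exact: measurable_fst.
by rewrite lee_fin sqr_ge0.
Qed.

Lemma coord_measurable_mixed_right e e' : coord_measurable2 (fun x t =>
  \int[P]_w (mixed_diff f x e e' (r e w) t ^+ 2)%:E).
Proof.
move=> d' S y t my mt y0 t0.
apply: (measurable_fun_fubini_tonelli_F (m2 := P) (fun z : S * Omega =>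
  (mixed_diff f (y z.1) e e' (r e z.2) (t z.1) ^+ 2)%:E)) => [|z].
  apply: measurable_mixed_diff => // [i||]; try exact: measurableT_comp.
  by apply: (measurableT_comp (my i)); exact: measurable_fst.
by rewrite lee_fin sqr_ge0.
Qed.

Lemma mixed_influence_le e e' :
  (v F - v (F `\ e)%fset - v (F `\ e')%fset
   + v ((F `\ e) `\ e')%fset)%:E <=
  mean r (fun x => \int[P]_w \int[P]_w' (mixed_diff f x e e' (r e w) (r e' w') ^+ 2)%:E).
Proof.
rewrite -mean_mixed_projection; apply: ge0_le_integral => //.
- by move=> w _; rewrite lee_fin sqr_ge0.
- apply/measurable_EFinP/measurable_funX.
  have m T : measurable_fun setT (fun t => u T (config r t)).
    by apply/measurable_EFinP; exact: (measurable_comp_config r_gt0 (@mu_ T)).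
  apply: measurable_funD => //; apply: measurable_funB => //.
  exact: measurable_funB.
- pose G x s := \int[P]_w' (mixed_diff f x e e' s (r e' w') ^+ 2)%:E.
  have G0 x s : 0 <= G x s by apply: integral_ge0 => w _; rewrite lee_fin sqr_ge0.
  have mG : coord_measurable2 G by exact: coord_measurable_mixed_left.
  have mI := coord_measurable_int r_gt0 e mG G0.
  exact: (measurable_comp_config r_gt0 mI).
- by move=> w _; apply: sqr_mixed_projection_le; exact: config_gt0.
Qed.

End efron_stein.

(** * Typical values of a resistance *)

Section typical_values.
Context {R : realType}.
Implicit Types s t c M : R.

Definition height s : R := distortion s 1.

Lemma heightE s : height s = Num.max s s^-1.
Proof. by rewrite /height /distortion divr1 div1r. Qed.

Lemma height_ge1 s : 0 < s -> 1 <= height s.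
Proof. by move=> s0; exact: distortion_ge1. Qed.

Lemma height_exp_le s n : 0 < s -> height s ^+ n <= s ^+ n + s ^- n.
Proof.
move=> s0; have sV : 0 < s^-1 by rewrite invr_gt0.
have h1 := exprn_gt0 n s0; have h2 := exprn_gt0 n sV.
rewrite heightE -exprVn; case: (leP s s^-1) => _; lra.
Qed.

Lemma distortion_le_height s c : 0 < s -> 0 < c ->
  distortion s c <= height s * height c.
Proof.
move=> s0 c0; have sV : 0 < s^-1 by rewrite invr_gt0.
have cV : 0 < c^-1 by rewrite invr_gt0.
rewrite /distortion ge_max !heightE; apply/andP; split; last rewrite mulrC;
  by apply: ler_pM; rewrite ?le_max ?lexx ?orbT// ltW.
Qed.

(** Indicator of an event of probability at least one half when [M] bounds the mean of [height ^+ 8]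
    ([typical_half]). *)
Definition typical M s : R := (height s ^+ 8 <= 2 * M)%R%:R.

Lemma typical_ge0 M s : 0 <= typical M s. Proof. exact: ler0n. Qed.

Lemma typical_le1 M s : typical M s <= 1.
Proof. by rewrite /typical; case: (height s ^+ 8 <= 2 * M). Qed.

Lemma typical_height M s n : 0 < s -> 0 < M -> (n <= 8)%N ->
  typical M s * height s ^+ n <= 2 * M.
Proof.
move=> s0 M0 n8; rewrite /typical; case: (boolP (height s ^+ 8 <= 2 * M)) => [h|_] /=.
  rewrite mul1r; apply: le_trans h; apply: ler_weXn2l => //; exact: height_ge1.
by rewrite mul0r mulr_ge0// ltW.
Qed.

Lemma measurable_height : measurable_fun setT height.
Proof.
rewrite (_ : height = fun s => Num.max s s^-1); last by apply/funext => s; exact: heightE.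
by apply: measurable_maxr => //; exact: measurable_invr.
Qed.

Lemma measurable_typical M : measurable_fun setT (typical M).
Proof.
have mb : measurable_fun setT (fun s => (height s ^+ 8 <= 2 * M)%R).
  by apply: measurable_fun_ler => //; apply: measurable_funX; exact: measurable_height.
rewrite (_ : typical M = fun s => if (height s ^+ 8 <= 2 * M)%R then 1 else 0).
  exact: measurable_fun_ifT.
by apply/funext => s; rewrite /typical; case: (height s ^+ 8 <= 2 * M).
Qed.

(* The pointwise comparison between the second and fourth powers of the
   distortion is AM-GM with weight [lam]. *)
Lemma typical_distortion_le M lam T k s c : 0 < s -> 0 < c -> 0 < M -> 0 < lam ->
  0 <= T -> 0 <= k ->
  k <= T * ((s - c) ^+ 2 * Num.max 1 (1 / s ^+ 2) * Num.max 1 (1 / c ^+ 2)) ->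
  typical M c * (k * distortion s c ^+ 2) <=
  lam / 2 * k + M / lam * T * ((s - c) ^+ 2 * (1 / s ^+ 6 + s ^+ 6)).
Proof.
move=> s0 c0 M0 lam0 T0 k0 kT.
have hs1 := height_ge1 s0; have hc1 := height_ge1 c0.
have hd := distortion_le_height s0 c0; have d1 := distortion_ge1 s0 c0.
set x := typical M c; set D := distortion s c in hd d1 *.
have x0 : 0 <= x by exact: typical_ge0.
have x1 : x <= 1 by exact: typical_le1.
have D4 : x * k * D ^+ 4 <= 2 * M * T * ((s - c) ^+ 2 * (1 / s ^+ 6 + s ^+ 6)).
  have hD4 : D ^+ 4 <= height s ^+ 4 * height c ^+ 4.
    by rewrite -exprMn lerXn2r ?nnegrE//; lra.
  have mc : Num.max 1 (1 / c ^+ 2) <= height c ^+ 2.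
    rewrite ge_max; apply/andP; split; first exact: exprn_ege1.
    rewrite div1r -exprVn lerXn2r ?nnegrE ?invr_ge0 ?(ltW c0)//; first by lra.
    by rewrite heightE le_max lexx orbT.
  have mch : x * (Num.max 1 (1 / c ^+ 2) * height c ^+ 4) <= 2 * M.
    apply: (@le_trans _ _ (x * height c ^+ 6)); last exact: typical_height.
    by rewrite ler_wpM2l// -[6%N]/(2 + 4)%N exprD ler_wpM2r// exprn_ge0//; lra.
  have msh : Num.max 1 (1 / s ^+ 2) * height s ^+ 4 <= 1 / s ^+ 6 + s ^+ 6.
    rewrite heightE !div1r -!exprVn; have sV : 0 < s^-1 by rewrite invr_gt0.
    have s6 := exprn_gt0 6 s0; have s6V := exprn_gt0 6 sV.
    have ssV : s * s^-1 = 1 by rewrite mulfV// gt_eqF.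
    case: (leP s s^-1) => ss.
      have sV1 : 1 <= s^-1.
        by rewrite leNgt; apply/negP => h; nra.
      have : 1 <= s^-1 ^+ 2 by exact: exprn_ege1.
      by move=> h; rewrite (max_idPr h) -exprD; lra.
    have s1 : 1 <= s by rewrite leNgt; apply/negP => h; nra.
    have : s^-1 ^+ 2 <= 1 by apply: exprn_ile1; [lra|nra].
    move=> h; rewrite (max_idPl h) mul1r.
    have : s ^+ 4 <= s ^+ 6 by apply: ler_weXn2l.
    by lra.
  apply: (@le_trans _ _ (x * (T * ((s - c) ^+ 2 * Num.max 1 (1 / s ^+ 2) *
      Num.max 1 (1 / c ^+ 2))) * (height s ^+ 4 * height c ^+ 4))).
    apply: ler_pM => //; first by rewrite mulr_ge0.
      by rewrite exprn_ge0//; lra.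
    by rewrite ler_wpM2l.
  set u := Num.max 1 (1 / s ^+ 2) in kT msh *.
  set w := Num.max 1 (1 / c ^+ 2) in kT mc mch *.
  rewrite [leLHS](_ : _ = T * (s - c) ^+ 2 * ((u * height s ^+ 4) * (x * (w * height c ^+ 4)))); last by ring.
  rewrite [leRHS](_ : _ = T * (s - c) ^+ 2 * ((1 / s ^+ 6 + s ^+ 6) * (2 * M))); last by ring.
  have u0 : 0 <= u by rewrite le_max ler01.
  have w0 : 0 <= w by rewrite le_max ler01.
  have hs4 : 0 <= height s ^+ 4 by rewrite exprn_ge0//; lra.
  have hc4 : 0 <= height c ^+ 4 by rewrite exprn_ge0//; lra.
  apply: ler_wpM2l; first by rewrite mulr_ge0 ?sqr_ge0.
  by apply: ler_pM => //; [exact: mulr_ge0|apply: mulr_ge0 => //; exact: mulr_ge0].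
have amgm : 2 * D ^+ 2 <= lam + D ^+ 4 / lam.
  have -> : lam + D ^+ 4 / lam = 2 * D ^+ 2 + (lam - D ^+ 2) ^+ 2 / lam.
    by field; rewrite gt_eqF.
  by rewrite lerDl divr_ge0 ?sqr_ge0// ltW.
have xk0 : 0 <= x * k by rewrite mulr_ge0.
apply: (@le_trans _ _ (x * k * ((lam + D ^+ 4 / lam) / 2))).
  by rewrite (mulrA x k) ler_wpM2l// ler_pdivlMr// mulrC.
rewrite [leLHS](_ : _ = lam / 2 * (x * k) + (x * k * D ^+ 4) / (2 * lam)); last first.
  by field; rewrite gt_eqF.
apply: lerD.
  by apply: ler_wpM2l; [rewrite divr_ge0// ltW|exact: ler_piMl].
rewrite ler_pdivrMr ?mulr_gt0//; apply: le_trans D4 _.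
rewrite le_eqVlt; apply/orP; left; apply/eqP; field.
by rewrite !gt_eqF.
Qed.

End typical_values.

(** * The level-two inequality *)

Section level_two_inequality.
Context {R : realType} d (Omega : measurableType d) (P : probability Omega R)
  (J : choiceType) (r : J -> {RV P >-> R}).
Hypothesis ind : mutually_independent r.
Hypothesis r_gt0 : forall i w, (0 < r i w)%R.
Local Open Scope ereal_scope.
Variables (F : {fset J}) (f : (J -> R) -> R).
Hypothesis f0 : forall x, (0 <= f x)%R.
Hypothesis mf : coord_measurable (fun x => (f x)%:E).
Hypothesis fF : depends_on F (fun x => (f x)%:E).

(** [lam] is the AM-GM weight of [typical_distortion_le]; in the end it is the square root of
    [M * rho]. *)
Variables M rho lam : R.
Hypothesis M0 : (0 < M)%R.
Hypothesis lam0 : (0 < lam)%R.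
Hypothesis lamE : (M * rho <= lam ^+ 2)%R.
Hypothesis moments : forall e,
  \int[P]_w (r e w ^+ 8)%:E + \int[P]_w (r e w ^- 8)%:E <= M%:E.
Hypothesis rho0 : (0 <= rho)%R.
Hypothesis ratio_le : forall e,
  \int[P \x P]_z ((r e z.1 - r e z.2) ^+ 2 * (1 / r e z.1 ^+ 6 + r e z.1 ^+ 6))%:E <=
  rho%:E * \int[P \x P]_z
    (Num.max (r e z.1 - r e z.2)%R 0%R ^+ 2 * Num.min 1%R (1 / r e z.1 ^+ 4))%:E.

(** This bound and the next are all that is retained of the variational structure of [f]. *)
Hypothesis sqr_diff_bounds : forall x e, (forall i, 0 < x i)%R -> e \in F ->
  exists2 T : R, (0 <= T)%R & forall s t : R, (0 < s)%R -> (0 < t)%R ->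
  (T * (Num.max (s - t) 0 ^+ 2 * Num.min 1 (1 / s ^+ 4)) <=
    (f (upd x e s) - f (upd x e t)) ^+ 2 <=
  T * ((s - t) ^+ 2 * Num.max 1 (1 / s ^+ 2) * Num.max 1 (1 / t ^+ 2)))%R.

Hypothesis mixed_diff_bounds : forall x, (forall i, 0 < x i)%R ->
  exists G : J -> J -> R,
  [/\ forall e e', e \in F -> e' \in F -> (0 <= G e e')%R,
      forall e e', e \in F -> e' \in F -> G e e' = G e' e,
      forall e, e \in F -> (\sum_(e' <- F | e' != e) G e e' <= 1)%R &
      forall e e' (s t : R), e \in F -> e' \in F -> e != e' -> (0 < s)%R -> (0 < t)%R ->
      (mixed_diff f x e e' s t ^+ 2 <= 2 * G e e' *
        ((f (upd x e s) - f x) ^+ 2 *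
           distortion s (x e) ^+ 2 * distortion t (x e') ^+ 4 +
         (f (upd x e' t) - f x) ^+ 2 *
           distortion t (x e') ^+ 2 * distortion s (x e) ^+ 4))%R].

Implicit Types (x : J -> R) (e : J).

Let int_cst1 (k : \bar R) : \int[P]_w k = k.
Proof. by rewrite integral_cst//= probability_setT mule1. Qed.

Let mr e : measurable_fun setT (fun w => r e w : R).
Proof. by []. Qed.

Lemma measurable_expV e n : measurable_fun setT (fun w => r e w ^- n : R).
Proof.
by apply: (measurableT_comp measurable_invr); exact: measurable_funX.
Qed.

Lemma integral_height8 e : \int[P]_w (height (r e w) ^+ 8)%:E <= M%:E.
Proof.
apply: le_trans (moments e); rewrite -ge0_integralD//.
- apply: ge0_le_integral => //.
  + by move=> w _; rewrite lee_fin exprn_ge0// (le_trans ler01)// height_ge1.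
  + apply/measurable_EFinP/measurable_funX.
    by apply: (measurableT_comp measurable_height).
  + apply: emeasurable_funD; apply/measurable_EFinP; first exact: measurable_funX.
    exact: measurable_expV.
  + by move=> w _; rewrite -EFinD lee_fin; exact: height_exp_le.
- by move=> w _; rewrite lee_fin exprn_ge0// ltW.
- exact/measurable_EFinP/measurable_funX.
- by move=> w _; rewrite lee_fin invr_ge0 exprn_ge0// ltW.
- by apply/measurable_EFinP; exact: measurable_expV.
Qed.

(** Markov's inequality: the complementary indicator is at most [height ^+ 8 / (2 * M)], whose mean
    is at most one half. *)
Lemma typical_half e : (2^-1)%:E <= \int[P]_w (typical M (r e w))%:E.
Proof.
have mt : measurable_fun setT (fun w => (typical M (r e w))%:E).
  by apply/measurable_EFinP; apply: (measurableT_comp (measurable_typical M)).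
have mh : measurable_fun setT (fun w => (height (r e w) ^+ 8)%:E).
  by apply/measurable_EFinP/measurable_funX; apply: (measurableT_comp measurable_height).
have h0 w : (0 <= height (r e w) ^+ 8)%R.
  by rewrite exprn_ge0// (le_trans ler01)// height_ge1.
have M2 : (0 <= (2 * M)^-1)%R by rewrite invr_ge0 mulr_ge0// ltW.
have key : 1 <= \int[P]_w (typical M (r e w))%:E + (2 * M)^-1%:E * M%:E.
  apply: (@le_trans _ _ (\int[P]_w (typical M (r e w))%:E +
     (2 * M)^-1%:E * \int[P]_w (height (r e w) ^+ 8)%:E)); last first.
    by rewrite leeD2l// lee_wpmul2l// integral_height8.
  rewrite -ge0_integralZl//; try by move=> w _; rewrite lee_fin.
  rewrite -ge0_integralD//; last 3 first.
  - by move=> w _; rewrite lee_fin typical_ge0.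
  - by move=> w _; rewrite mule_ge0// lee_fin.
  - exact: measurable_funeM.
  rewrite -[leLHS](int_cst1 1); apply: ge0_le_integral => //.
    by apply: emeasurable_funD => //; exact: measurable_funeM.
  move=> w _; rewrite -EFinM -EFinD lee_fin /typical.
  case: (boolP (height (r e w) ^+ 8 <= 2 * M)%R) => [_|] /=.
    by rewrite lerDl mulr_ge0.
  rewrite -ltNge add0r => h; have M20 : (0 < 2 * M)%R by rewrite mulr_gt0.
  by rewrite -(ler_pM2l M20) mulVKf ?gt_eqF// mulr1 ltW.
move: key; have : 0 <= \int[P]_w (typical M (r e w))%:E.
  by apply: integral_ge0 => w _; rewrite lee_fin typical_ge0.
case: (\int[P]_w _) => [k||]; [move=> _|by move=> _ _; exact: leey|by []].
have -> : (2 * M)^-1%:E * M%:E = (2^-1)%:E.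
  by rewrite -EFinM; congr (_%:E); field; rewrite gt_eqF.
rewrite -EFinD !lee_fin; lra.
Qed.

Definition jump e x s : R := ((f (upd x e s) - f x) ^+ 2)%R.

Lemma measurable_jump e d' (S : measurableType d') (y : S -> J -> R) (s : S -> R) :
  (forall i, measurable_fun setT (fun t => y t i)) -> measurable_fun setT s ->
  (forall t i, (0 < y t i)%R) -> (forall t, (0 < s t)%R) ->
  measurable_fun setT (fun t => jump e (y t) (s t)).
Proof.
move=> my ms y0 s0; apply/measurable_funX/measurable_funB; apply/measurable_EFinP.
  exact: (coord_measurable_upd2 e mf my ms y0 s0).
exact: (mf my y0).
Qed.

Lemma measurable_distortion d' (S : measurableType d') (s c : S -> R) :
  measurable_fun setT s -> measurable_fun setT c ->
  measurable_fun setT (fun t => distortion (s t) (c t)).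
Proof.
move=> ms mc; apply: measurable_maxr; apply: measurable_funM => //.
  exact: (measurableT_comp measurable_invr).
exact: (measurableT_comp measurable_invr).
Qed.

Definition mean_jump e x : \bar R := \int[P]_w (jump e x (r e w))%:E.

(** A squared first difference weighted by the square of its distortion, seen from a typical
    reference value. *)
Definition distorted_jump e x : \bar R := (typical M (x e))%:E *
  \int[P]_w (jump e x (r e w) * distortion (r e w) (x e) ^+ 2)%:E.

Lemma coord_measurable_mean_jump e : coord_measurable (mean_jump e).
Proof.
apply: (@coord_measurable_int _ _ _ _ _ _ r_gt0 e (fun x s => (jump e x s)%:E)).
  move=> d' S y s my ms y0 s0; apply/measurable_EFinP; exact: measurable_jump.
by move=> x s; rewrite lee_fin sqr_ge0.
Qed.

Lemma mean_jump_ge0 e x : 0 <= mean_jump e x.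
Proof. by apply: integral_ge0 => w _; rewrite lee_fin sqr_ge0. Qed.

Lemma coord_measurable_distorted_jump e : coord_measurable (distorted_jump e).
Proof.
apply: coord_measurableM.
  move=> d' S y my y0; apply/measurable_EFinP.
  exact: (measurableT_comp (measurable_typical M)).
apply: (@coord_measurable_int _ _ _ _ _ _ r_gt0 e
  (fun x s => (jump e x s * distortion s (x e) ^+ 2)%:E)).
  move=> d' S y s my ms y0 s0; apply/measurable_EFinP; apply: measurable_funM.
    exact: measurable_jump.
  by apply: measurable_funX; exact: measurable_distortion.
by move=> x s; rewrite lee_fin mulr_ge0 ?sqr_ge0.
Qed.

Lemma distorted_jump_ge0 e x : 0 <= distorted_jump e x.
Proof.
rewrite mule_ge0 ?lee_fin ?typical_ge0//; apply: integral_ge0 => w _.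
by rewrite lee_fin mulr_ge0 ?sqr_ge0.
Qed.

(** After the reference value is resampled as well, both sides are double integrals over two
    independent values at [e], with the same factor [T]. The upper bound for a jump produces the
    numerator of the ratio, and the lower bound turns its denominator back into a jump. *)
Lemma mean_distorted_jump_le e : e \in F ->
  mean r (distorted_jump e) <= (2 * lam)%:E * mean r (mean_jump e).
Proof.
move=> eF; have mY := coord_measurable_distorted_jump e.
have mH := coord_measurable_mean_jump e.
have Y0 := distorted_jump_ge0 e; have H0 := mean_jump_ge0 e.
rewrite -(mean_resample ind r_gt0 e mY Y0) -(mean_resample ind r_gt0 e mH H0).
have mrY := coord_measurable_resample r_gt0 e mY Y0.
have mrH := coord_measurable_resample r_gt0 e mH H0.
have rH0 x : 0 <= resample r e (mean_jump e) x by exact: resample_ge0.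
have rY0 x : 0 <= resample r e (distorted_jump e) x by exact: resample_ge0.
have l2 : (0 <= 2 * lam)%R by rewrite mulr_ge0// ltW.
rewrite -(mean_scale r_gt0 mrH rH0 l2).
apply: ge0_le_integral => //.
- exact: (measurable_comp_config r_gt0 mrY).
- by apply: measurable_funeM; exact: (measurable_comp_config r_gt0 mrH).
move=> w0 _; have := config_gt0 r_gt0 w0; move: (config r w0) => x x0.
have [T T0 HT] := sqr_diff_bounds x0 eF.
have [m1 m2] := measurable_RV_pair r e.
have cx (i : J) : measurable_fun setT (fun z : Omega * Omega => x i) by [].
pose k (z : Omega * Omega) := ((f (upd x e (r e z.1)) - f (upd x e (r e z.2))) ^+ 2)%R.
have mk : measurable_fun setT k.
  by apply/measurable_funX/measurable_funB; apply/measurable_EFinP;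
    [exact: (coord_measurable_upd2 e mf cx m1)|exact: (coord_measurable_upd2 e mf cx m2)].
have k0 z : (0 <= k z)%R by exact: sqr_ge0.
have mt : measurable_fun setT (fun z : Omega * Omega => typical M (r e z.2)).
  exact: (measurableT_comp (measurable_typical M)).
have md : measurable_fun setT (fun z : Omega * Omega => distortion (r e z.1) (r e z.2)).
  exact: measurable_distortion.
pose Yz (z : Omega * Omega) :=
  (typical M (r e z.2) * (k z * distortion (r e z.1) (r e z.2) ^+ 2))%R.
have mYz : measurable_fun setT Yz.
  by apply: measurable_funM => //; apply: measurable_funM => //; exact: measurable_funX.
have Yz0 z : (0 <= Yz z)%R.
  by rewrite mulr_ge0 ?typical_ge0// mulr_ge0// sqr_ge0.
have EY : resample r e (distorted_jump e) x = \int[P \x P]_z (Yz z)%:E.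
  have mYE : measurable_fun setT (fun z => (Yz z)%:E) by exact/measurable_EFinP.
  have YE0 z : 0 <= (Yz z)%:E by rewrite lee_fin.
  rewrite (fubini_tonelli2 (m1 := P) (m2 := P) _ mYE YE0).
  apply: eq_integral => a _; rewrite /distorted_jump -ge0_integralZl//.
  - by apply: eq_integral => w _; rewrite /Yz /k /jump /= upd_upd /upd eqxx -EFinM.
  - apply/measurable_EFinP; apply: measurable_funM.
      by apply: (@measurable_jump e _ _ (fun=> upd x e (r e a))) => // w; exact: upd_gt0.
    by apply: measurable_funX; exact: measurable_distortion.
  - by move=> w _; rewrite lee_fin mulr_ge0 ?sqr_ge0.
  - by rewrite lee_fin typical_ge0.
have EH : resample r e (mean_jump e) x = \int[P \x P]_z (k z)%:E.
  have mkE : measurable_fun setT (fun z => (k z)%:E) by exact/measurable_EFinP.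
  have kE0 z : 0 <= (k z)%:E by rewrite lee_fin.
  rewrite (fubini_tonelli2 (m1 := P) (m2 := P) _ mkE kE0).
  by apply: eq_integral => a _; apply: eq_integral => w _; rewrite /jump /k /= upd_upd.
rewrite EY EH; set I := \int[P \x P]_z (k z)%:E.
pose nu (z : Omega * Omega) :=
  ((r e z.1 - r e z.2) ^+ 2 * (1 / r e z.1 ^+ 6 + r e z.1 ^+ 6))%R.
have mnu : measurable_fun setT nu.
  apply: measurable_funM; first by apply/measurable_funX/measurable_funB.
  apply: measurable_funD; last exact: measurable_funX.
  apply: measurable_funM => //; apply: (measurableT_comp measurable_invr).
  exact: measurable_funX.
have nu0 z : (0 <= nu z)%R.
  rewrite mulr_ge0 ?sqr_ge0// addr_ge0// ?divr_ge0// exprn_ge0// ltW//.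
pose de (z : Omega * Omega) := (Num.max (r e z.1 - r e z.2)%R 0%R ^+ 2 *
  Num.min 1%R (1 / r e z.1 ^+ 4))%R.
have mde : measurable_fun setT de.
  apply: measurable_funM.
    by apply/measurable_funX/measurable_maxr => //; exact: measurable_funB.
  apply: measurable_minr => //; apply: measurable_funM => //.
  by apply: (measurableT_comp measurable_invr); exact: measurable_funX.
have de0 z : (0 <= de z)%R.
  by rewrite mulr_ge0 ?sqr_ge0// le_min ler01 divr_ge0// exprn_ge0// ltW.
have TD : T%:E * \int[P \x P]_z (de z)%:E <= I.
  rewrite -ge0_integralZl//; last 2 first.
  - exact/measurable_EFinP.
  - by move=> z _; rewrite lee_fin.
  apply: ge0_le_integral => //.
  - by move=> z _; rewrite mule_ge0// lee_fin.
  - by apply: measurable_funeM; exact/measurable_EFinP.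
  - exact/measurable_EFinP.
  - by move=> z _; rewrite -EFinM lee_fin; have /andP[] := HT _ _ (r_gt0 e z.1) (r_gt0 e z.2).
have c1 : (0 <= lam / 2)%R by rewrite divr_ge0// ltW.
have c2 : (0 <= M / lam * T)%R by rewrite mulr_ge0// divr_ge0// ltW.
have I0 : 0 <= I by apply: integral_ge0 => z _; rewrite lee_fin.
apply: (@le_trans _ _ ((lam / 2)%:E * I + (M / lam * T)%:E * \int[P \x P]_z (nu z)%:E)).
  rewrite -!ge0_integralZl//; try (by move=> z _; rewrite lee_fin);
    try exact/measurable_EFinP; try (by rewrite lee_fin).
  rewrite -ge0_integralD//; last 4 first.
  - by move=> z _; rewrite mule_ge0// lee_fin.
  - by apply: measurable_funeM; exact/measurable_EFinP.
  - by move=> z _; rewrite mule_ge0// lee_fin.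
  - by apply: measurable_funeM; exact/measurable_EFinP.
  apply: ge0_le_integral => //.
  - by move=> z _; rewrite lee_fin.
  - exact/measurable_EFinP.
  - by apply: emeasurable_funD; apply: measurable_funeM; exact/measurable_EFinP.
  - move=> z _; rewrite -!EFinM -EFinD lee_fin; apply: typical_distortion_le => //.
    by have /andP[] := HT _ _ (r_gt0 e z.1) (r_gt0 e z.2).
apply: (@le_trans _ _ ((lam / 2)%:E * I + (M / lam)%:E * (rho%:E * I))).
  rewrite leeD2l// EFinM -muleA; apply: lee_wpmul2l.
    by rewrite lee_fin divr_ge0// ltW.
  apply: (@le_trans _ _ (T%:E * (rho%:E * \int[P \x P]_z (de z)%:E))).
    by apply: lee_wpmul2l => //; exact: ratio_le.
  by rewrite muleCA; apply: lee_wpmul2l => //; rewrite lee_fin.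
rewrite muleA -EFinM -ge0_muleDl ?lee_fin ?mulr_ge0 ?invr_ge0 ?(ltW M0) ?(ltW lam0)//.
rewrite -EFinD; apply: lee_wpmul2r => //; rewrite lee_fin.
(* The two halves of AM-GM thus cost [lam / 2] and at most [lam]. *)
have : (M / lam * rho <= lam)%R.
  by rewrite mulrAC ler_pdivrMr// -expr2.
lra.
Qed.

Definition mean_mixed e e' x : \bar R :=
  \int[P]_w \int[P]_w' (mixed_diff f x e e' (r e w) (r e' w') ^+ 2)%:E.

(** The distortion is at most a product of heights: the one of [c] is bounded because [c] is
    typical, the other in mean by the moments. *)
Lemma typical_distortion4 e c : (0 < c)%R ->
  (typical M c)%:E * \int[P]_w (distortion (r e w) c ^+ 4)%:E <= (2 * M ^+ 2)%:E.
Proof.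
move=> c0; have md : measurable_fun setT (fun w => (distortion (r e w) c ^+ 4)%:E).
  by apply/measurable_EFinP/measurable_funX; exact: measurable_distortion.
have mh : measurable_fun setT (fun w => (height (r e w) ^+ 8)%:E).
  by apply/measurable_EFinP/measurable_funX; apply: (measurableT_comp measurable_height).
have d0 w : 0 <= (distortion (r e w) c ^+ 4)%:E.
  by rewrite lee_fin exprn_ge0// (le_trans ler01)// distortion_ge1.
have h0 w : 0 <= (height (r e w) ^+ 8)%:E.
  by rewrite lee_fin exprn_ge0// (le_trans ler01)// height_ge1.
have t0 : 0 <= (typical M c)%:E by rewrite lee_fin typical_ge0.
have M2 : 0 <= (2 * M)%:E by rewrite lee_fin mulr_ge0// ltW.
apply: (@le_trans _ _ ((2 * M)%:E * \int[P]_w (height (r e w) ^+ 8)%:E)); last first.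
  rewrite (_ : (2 * M ^+ 2)%R = (2 * M * M)%R); last by rewrite expr2 mulrA.
  by rewrite (EFinM (2 * M) M); apply: lee_wpmul2l => //; exact: integral_height8.
rewrite -!ge0_integralZl//; apply: ge0_le_integral => //.
- by move=> w _; rewrite mule_ge0.
- exact: measurable_funeM.
- exact: measurable_funeM.
move=> w _; rewrite -!EFinM lee_fin.
have hs := height_ge1 (r_gt0 e w); have hc := height_ge1 c0.
have hd := distortion_le_height (r_gt0 e w) c0.
have d1 := distortion_ge1 (r_gt0 e w) c0.
apply: (@le_trans _ _ (typical M c * height c ^+ 4 * height (r e w) ^+ 8)%R); last first.
  by rewrite ler_wpM2r// ?exprn_ge0 ?(le_trans ler01)// typical_height.
rewrite -mulrA ler_wpM2l ?typical_ge0//.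
apply: (@le_trans _ _ (height c ^+ 4 * height (r e w) ^+ 4)%R).
  by rewrite -exprMn mulrC; apply: lerXn2r; rewrite ?nnegrE//; nra.
by rewrite ler_wpM2l ?exprn_ge0 ?(le_trans ler01)// ler_weXn2l.
Qed.

(** In each term of the bound the jump and its distortion involve one new value and the fourth power
    of the distortion the other, so the double integral factorizes; [typical_distortion4] bounds the
    second factor. *)
Lemma mixed_pair_le x (G : R) e e' : (forall i, 0 < x i)%R -> (0 <= G)%R ->
  (forall s t : R, (0 < s)%R -> (0 < t)%R ->
    (mixed_diff f x e e' s t ^+ 2 <= 2 * G *
        (jump e x s * distortion s (x e) ^+ 2 * distortion t (x e') ^+ 4 +
         jump e' x t * distortion t (x e') ^+ 2 * distortion s (x e) ^+ 4))%R) ->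
  (typical M (x e))%:E * ((typical M (x e'))%:E * mean_mixed e e' x) <=
  (4 * M ^+ 2 * G)%:E * (distorted_jump e x + distorted_jump e' x).
Proof.
move=> x0 G0 HG.
have cx (i : J) : measurable_fun setT (fun w : Omega => x i) by [].
pose A e w := (jump e x (r e w) * distortion (r e w) (x e) ^+ 2)%R.
pose B e w := (distortion (r e w) (x e) ^+ 4)%R.
have mA i : measurable_fun setT (fun w => (A i w)%:E).
  apply/measurable_EFinP; apply: measurable_funM.
    exact: (@measurable_jump i _ _ (fun=> x)).
  by apply: measurable_funX; exact: measurable_distortion.
have mB i : measurable_fun setT (fun w => (B i w)%:E).
  by apply/measurable_EFinP; apply: measurable_funX; exact: measurable_distortion.
have A0 i w : 0 <= (A i w)%:E by rewrite lee_fin mulr_ge0 ?sqr_ge0.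
have B0 i w : 0 <= (B i w)%:E.
  by rewrite lee_fin exprn_ge0// (le_trans ler01)// distortion_ge1.
have IA0 i : 0 <= \int[P]_w (A i w)%:E by apply: integral_ge0.
have IB0 i : 0 <= \int[P]_w (B i w)%:E by apply: integral_ge0.
have G20 : 0 <= (2 * G)%:E by rewrite lee_fin mulr_ge0.
have D2le : mean_mixed e e' x <= (2 * G)%:E *
    (\int[P]_w (A e w)%:E * \int[P]_w (B e' w)%:E +
     \int[P]_w (A e' w)%:E * \int[P]_w (B e w)%:E).
  have inner w : \int[P]_w' ((2 * G)%:E * ((A e w)%:E * (B e' w')%:E + (A e' w')%:E * (B e w)%:E)) =
      (2 * G)%:E * ((A e w)%:E * \int[P]_w (B e' w)%:E + \int[P]_w (A e' w)%:E * (B e w)%:E).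
    have m1 : measurable_fun setT (fun w' => (A e w)%:E * (B e' w')%:E).
      exact: measurable_funeM.
    have m2 : measurable_fun setT (fun w' => (A e' w')%:E * (B e w)%:E).
      by apply: emeasurable_funM => //; exact: mA.
    have p1 w' : 0 <= (A e w)%:E * (B e' w')%:E by exact: mule_ge0.
    have p2 w' : 0 <= (A e' w')%:E * (B e w)%:E by exact: mule_ge0.
    rewrite (ge0_integralZl P measurableT (emeasurable_funD m1 m2)
      (fun w' _ => adde_ge0 (p1 w') (p2 w')) G20).
    rewrite (ge0_integralD P measurableT (fun w' _ => p1 w') m1 (fun w' _ => p2 w') m2).
    rewrite (ge0_integralZl P measurableT (mB e') (fun w' _ => B0 e' w') (A0 e w)).
    by rewrite (ge0_integralZr P measurableT (mA e') (fun w' _ => A0 e' w') (B0 e w)).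
  apply: (@le_trans _ _ (\int[P]_w \int[P]_w' ((2 * G)%:E *
      ((A e w)%:E * (B e' w')%:E + (A e' w')%:E * (B e w)%:E)))).
    have mm w : measurable_fun setT (fun w' =>
        (mixed_diff f x e e' (r e w) (r e' w') ^+ 2)%:E).
      exact: (@measurable_mixed_diff _ _ f mf e e' _ _ (fun=> x)).
    apply: ge0_le_integral => //.
    - by move=> w _; apply: integral_ge0 => w' _; rewrite lee_fin sqr_ge0.
    - have mG : coord_measurable2 (fun x s =>
          \int[P]_w' (mixed_diff f x e e' s (r e' w') ^+ 2)%:E).
        exact: coord_measurable_mixed_left.
      exact: (mG _ _ (fun=> x)).
    - under eq_fun do rewrite inner.
      apply: measurable_funeM; apply: emeasurable_funD.
        by apply: emeasurable_funM => //; exact: mA.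
      exact: measurable_funeM.
    move=> w _; apply: ge0_le_integral => //.
    - by move=> w' _; rewrite lee_fin sqr_ge0.
    - apply: measurable_funeM; apply: emeasurable_funD; first exact: measurable_funeM.
      by apply: emeasurable_funM => //; exact: mA.
    - by move=> w' _; rewrite lee_fin; exact: HG.
  under eq_integral do rewrite inner.
  have m1 : measurable_fun setT (fun w => (A e w)%:E * \int[P]_w (B e' w)%:E).
    by apply: emeasurable_funM => //; exact: mA.
  have m2 : measurable_fun setT (fun w => \int[P]_w (A e' w)%:E * (B e w)%:E).
    exact: measurable_funeM.
  have p1 w : 0 <= (A e w)%:E * \int[P]_w (B e' w)%:E by exact: mule_ge0.
  have p2 w : 0 <= \int[P]_w (A e' w)%:E * (B e w)%:E by exact: mule_ge0.
  rewrite (ge0_integralZl P measurableT (emeasurable_funD m1 m2)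
    (fun w _ => adde_ge0 (p1 w) (p2 w)) G20).
  rewrite (ge0_integralD P measurableT (fun w _ => p1 w) m1 (fun w _ => p2 w) m2).
  rewrite (ge0_integralZr P measurableT (mA e) (fun w _ => A0 e w) (IB0 e')).
  by rewrite (ge0_integralZl P measurableT (mB e) (fun w _ => B0 e w) (IA0 e')).
have TB e'' := typical_distortion4 e'' (x0 e'').
have YE e'' : distorted_jump e'' x = (typical M (x e''))%:E * \int[P]_w (A e'' w)%:E by [].
rewrite !YE.
move: D2le (TB e) (TB e') (IA0 e) (IA0 e') (IB0 e) (IB0 e').
rewrite -/(B e _) -/(B e' _).
have := typical_ge0 M (x e); have := typical_ge0 M (x e').
rewrite -!lee_fin.
move: (\int[P]_w (A e w)%:E) (\int[P]_w (A e' w)%:E) => a a'.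
move: (\int[P]_w (B e w)%:E) (\int[P]_w (B e' w)%:E) => b b'.
move: (mean_mixed e e' x) ((typical M (x e))%:E) ((typical M (x e'))%:E) => D t t'.
move=> t0 t'0 Dle tb tb' a0 a'0 b0 b'0.
apply: (@le_trans _ _ (t * (t' * ((2 * G)%:E * (a * b' + a' * b))))).
  by do 2 apply: lee_wpmul2l => //.
rewrite (_ : t * _ = (2 * G)%:E * ((t * a) * (t' * b') + (t' * a') * (t * b))); last first.
  rewrite [t' * _]muleCA [t * _]muleCA; congr (_ * _).
  rewrite ge0_muleDr ?mule_ge0// ge0_muleDr ?mule_ge0//; congr (_ + _).
    by rewrite -(muleA t a) (muleCA a t').
  by rewrite [RHS]muleCA -(muleA t' a' b).
rewrite (_ : (4 * M ^+ 2 * G)%:E = (2 * G)%:E * (2 * M ^+ 2)%:E); last first.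
  by rewrite -EFinM; congr (_%:E); ring.
rewrite -(muleA (2 * G)%:E); apply: lee_wpmul2l => //.
rewrite ge0_muleDr ?mule_ge0//; apply: leeD.
  by rewrite muleC; apply: lee_wpmul2r => //; exact: mule_ge0.
by rewrite muleC; apply: lee_wpmul2r => //; exact: mule_ge0.
Qed.

(** The row sums of [G] absorb the inner sum, and by symmetry of [G] the two terms of
    [mixed_pair_le] contribute equally. *)
Lemma sum_mixed_le x : (forall i, 0 < x i)%R ->
  \sum_(e <- F) \sum_(e' <- F | e' != e)
    (typical M (x e))%:E * ((typical M (x e'))%:E * mean_mixed e e' x) <=
  (8 * M ^+ 2)%:E * \sum_(e <- F) distorted_jump e x.
Proof.
move=> x0; have [G [G0 Gsym G1 HG]] := mixed_diff_bounds x0.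
pose c := (4 * M ^+ 2)%R; have c0 : (0 <= c)%R by rewrite mulr_ge0 ?sqr_ge0.
pose Y e := distorted_jump e x; have Y0 e : 0 <= Y e by exact: distorted_jump_ge0.
apply: (@le_trans _ _ (\sum_(e <- F) \sum_(e' <- F | e' != e)
   ((c * G e e')%:E * Y e + (c * G e e')%:E * Y e'))).
  rewrite big_seq [leRHS]big_seq; apply: lee_sum => e eF.
  rewrite big_seq_cond [leRHS]big_seq_cond; apply: lee_sum => e' /andP[eF' ee'].
  rewrite -ge0_muleDr//; apply: mixed_pair_le => //; first exact: G0.
  by move=> s t s0 t0; apply: HG => //; rewrite eq_sym.
have half : \sum_(e <- F) \sum_(e' <- F | e' != e) (c * G e e')%:E * Y e <=
    c%:E * \sum_(e <- F) Y e.
  rewrite ge0_sume_distrr//; rewrite big_seq [leRHS]big_seq; apply: lee_sum => e eF.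
  rewrite big_seq_cond -ge0_sume_distrl; last first.
    by move=> e' /andP[eF' _]; rewrite lee_fin mulr_ge0// G0.
  apply: lee_wpmul2r => //; rewrite -big_seq_cond sumEFin lee_fin -mulr_sumr.
  by rewrite -[leRHS]mulr1 ler_wpM2l// G1.
have half' : \sum_(e <- F) \sum_(e' <- F | e' != e) (c * G e e')%:E * Y e' <=
    c%:E * \sum_(e <- F) Y e.
  apply: le_trans half; rewrite (exchange_big_dep predT)//=.
  rewrite big_seq [leRHS]big_seq; apply: lee_sum => e eF.
  rewrite big_seq_cond [leRHS]big_seq_cond.
  rewrite (eq_bigl (fun i => (i \in F) && (i != e))); last by move=> i; rewrite eq_sym.
  by apply: lee_sum => e' /andP[eF' _]; rewrite Gsym.
under eq_bigr do rewrite big_split/=.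
rewrite big_split/=; apply: le_trans (leeD half half') _.
rewrite -ge0_muleDl// -EFinD (_ : (c + c = 8 * M ^+ 2)%R)//.
by rewrite /c; ring.
Qed.

Let sqr_sub_le (a b : R) : ((a - b) ^+ 2 <= 2 * b ^+ 2 + 2 * a ^+ 2)%R.
Proof. by have := sqr_ge0 (a + b)%R; nra. Qed.

(** The reference values at the two edges are restricted in turn, each at the cost of a factor 8. *)
Lemma mean_mixed_typical e e' : e != e' ->
  mean r (mean_mixed e e') <= 64%:E *
  mean r (fun x => (typical M (x e))%:E * ((typical M (x e'))%:E * mean_mixed e e' x)).
Proof.
move=> ee'.
have mt := measurable_typical M; have t0 := typical_ge0 M.
pose q x s t := (mixed_diff f x e e' s t ^+ 2)%:E.
have q0 x s t : 0 <= q x s t by rewrite lee_fin sqr_ge0.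
pose G1 x s := \int[P]_w' q x s (r e' w').
have mG1 : coord_measurable2 G1 by exact: coord_measurable_mixed_left.
have G10 x s : 0 <= G1 x s by apply: integral_ge0.
(* The weight from the first restriction is carried along; it is unaffected by changes at [e']
   because the edges differ. *)
pose G2 x t := (typical M (x e))%:E * \int[P]_w q x (r e w) t.
have mG2 : coord_measurable2 G2.
  move=> d' S y t my mt' y0 t0'; apply: emeasurable_funM.
    by apply/measurable_EFinP; exact: (measurableT_comp mt).
  exact: (coord_measurable_mixed_right r_gt0 mf e e' my mt' y0 t0').
have G20 x t : 0 <= G2 x t by rewrite mule_ge0 ?lee_fin// integral_ge0.
have mq x : (forall i, 0 < x i)%R ->
    measurable_fun setT (fun z : Omega * Omega => q x (r e z.1) (r e' z.2)).
  move=> x0; have [m1 _] := measurable_RV_pair r e; have [_ m2] := measurable_RV_pair r e'.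
  exact: (@measurable_mixed_diff _ _ f mf e e' _ _ (fun=> x)).
have mq1 x (s : R) : (forall i, 0 < x i)%R -> (0 < s)%R ->
    measurable_fun setT (fun w => q x s (r e' w)).
  by move=> x0 s0; exact: (@measurable_mixed_diff _ _ f mf e e' _ _ (fun=> x) (fun=> s)).
have mq2 x (t : R) : (forall i, 0 < x i)%R -> (0 < t)%R ->
    measurable_fun setT (fun w => q x (r e w) t).
  by move=> x0 s0; exact: (@measurable_mixed_diff _ _ f mf e e' _ _ (fun=> x) _ (fun=> t)).
have swap x : (forall i, 0 < x i)%R ->
    \int[P]_w' G2 x (r e' w') = (typical M (x e))%:E * mean_mixed e e' x.
  move=> x0.
  have mQ : measurable_fun setT (fun w' => \int[P]_w q x (r e w) (r e' w')).
    have := @coord_measurable_mixed_right _ _ _ P _ r r_gt0 f mf e e'.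
    by move=> /(_ _ _ (fun=> x) (fun w => r e' w)); apply.
  have Q0 w' : 0 <= \int[P]_w q x (r e w) (r e' w') by apply: integral_ge0.
  have tE0 : 0 <= (typical M (x e))%:E by rewrite lee_fin.
  rewrite /G2 (ge0_integralZl P measurableT mQ (fun w' _ => Q0 w') tE0).
  have q0' (z : Omega * Omega) : 0 <= q x (r e z.1) (r e' z.2) by [].
  have F1 := fubini_tonelli1 (m1 := P) (m2 := P) _ (mq x x0) q0'.
  have F2 := fubini_tonelli2 (m1 := P) (m2 := P) _ (mq x x0) q0'.
  rewrite /mean_mixed -[X in _ = _ * X]/(\int[P]_w fubini_F P (fun z => q x (r e z.1) (r e' z.2)) w).
  by rewrite -F1 F2.
have two0 : (0 : \bar R) <= 2%:E by [].
have comb (h h1 h2 : Omega -> \bar R) : (forall w, 0 <= h w) -> (forall w, 0 <= h1 w) ->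
    (forall w, 0 <= h2 w) -> measurable_fun setT h -> measurable_fun setT h1 ->
    measurable_fun setT h2 -> (forall w, h w <= 2%:E * h1 w + 2%:E * h2 w) ->
    \int[P]_w h w <= 2%:E * \int[P]_w h1 w + 2%:E * \int[P]_w h2 w.
  move=> h0 h10 h20 mh mh1 mh2 hh.
  have z1 w : 0 <= 2%:E * h1 w by exact: mule_ge0.
  have z2 w : 0 <= 2%:E * h2 w by exact: mule_ge0.
  have n1 : measurable_fun setT (fun w => 2%:E * h1 w) by exact: measurable_funeM.
  have n2 : measurable_fun setT (fun w => 2%:E * h2 w) by exact: measurable_funeM.
  rewrite -(ge0_integralZl P measurableT mh1 (fun w _ => h10 w) two0).
  rewrite -(ge0_integralZl P measurableT mh2 (fun w _ => h20 w) two0).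
  rewrite -(ge0_integralD P measurableT (fun w _ => z1 w) n1 (fun w _ => z2 w) n2).
  by apply: ge0_le_integral => //; exact: emeasurable_funD.
(* A mixed difference based at [a] is the difference of two based at [c], since the terms taken at
   [c] cancel. *)
have tri1 x (a c s : R) : (forall i, 0 < x i)%R -> (0 < a)%R -> (0 < c)%R -> (0 < s)%R ->
    G1 (upd x e a) s <= 2%:E * G1 (upd x e c) a + 2%:E * G1 (upd x e c) s.
  move=> x0 a0 c0 s0; apply: comb => // [|||w].
  - by apply: mq1 => //; exact: upd_gt0.
  - by apply: mq1 => //; exact: upd_gt0.
  - by apply: mq1 => //; exact: upd_gt0.
  rewrite /q -!EFinM -EFinD lee_fin.
  rewrite (_ : mixed_diff f (upd x e a) _ _ _ _ = mixed_diff f (upd x e c) e e' s (r e' w) -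
    mixed_diff f (upd x e c) e e' a (r e' w))%R; last first.
    by rewrite /mixed_diff !upd_upd; ring.
  exact: sqr_sub_le.
have tri2 x (a c s : R) : (forall i, 0 < x i)%R -> (0 < a)%R -> (0 < c)%R -> (0 < s)%R ->
    G2 (upd x e' a) s <= 2%:E * G2 (upd x e' c) a + 2%:E * G2 (upd x e' c) s.
  move=> x0 a0 c0 s0; rewrite /G2 (_ : upd x e' a e = x e); last by rewrite /upd (negbTE ee').
  rewrite (_ : upd x e' c e = x e); last by rewrite /upd (negbTE ee').
  have t0E : 0 <= (typical M (x e))%:E by rewrite lee_fin.
  rewrite ![2%:E * (_ * _)]muleCA -ge0_muleDr; last 2 first.
  - by rewrite mule_ge0// integral_ge0.
  - by rewrite mule_ge0// integral_ge0.
  apply: lee_wpmul2l => //.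
  apply: comb => // [|||w].
  - by apply: mq2 => //; exact: upd_gt0.
  - by apply: mq2 => //; exact: upd_gt0.
  - by apply: mq2 => //; exact: upd_gt0.
  rewrite /q -!EFinM -EFinD lee_fin.
  rewrite (_ : mixed_diff f (upd x e' a) _ _ _ _ = mixed_diff f (upd x e' c) e e' (r e w) s -
    mixed_diff f (upd x e' c) e e' (r e w) a)%R; last first.
    rewrite /mixed_diff ![upd (upd (upd _ e' _) e _) e' _](updC _ _ _ ee') !upd_upd.
    rewrite ![upd (upd x e' _) e _](updC x _ _ _) 1?eq_sym//.
    rewrite ![upd (upd x e _) e' _](updC x _ _ ee').
    by ring.
  exact: sqr_sub_le.
have half := mean_restrict_reference ind r_gt0 mt t0 (typical_half e) mG1 G10 tri1.
have half' := mean_restrict_reference ind r_gt0 mt t0 (typical_half e') mG2 G20 tri2.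
apply: (le_trans half).
rewrite (_ : 64%:E = 8%:E * 8%:E); last by rewrite -EFinM; congr (_%:E); ring.
rewrite -(muleA 8%:E); apply: lee_wpmul2l => //.
rewrite (eq_mean r_gt0 (g' := fun x => \int[P]_w' G2 x (r e' w'))); last first.
  by move=> x x0; rewrite swap.
apply: (le_trans half'); apply: lee_wpmul2l => //.
rewrite (eq_mean r_gt0 (g' := fun x => (typical M (x e))%:E *
   ((typical M (x e'))%:E * mean_mixed e e' x)))//.
by move=> x x0; rewrite swap// muleCA.
Qed.

Hypothesis cond_fin : forall T x, (forall i, 0 < x i)%R ->
  cond r T (fun x => (f x)%:E) x < +oo.
Variable v : {fset J} -> R.
Hypothesis phiE : forall T, phi r (fun x => (f x)%:E) T = (v T)%:E.

Lemma level_two_le :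
  (\sum_(e <- F) \sum_(e' <- F | e' != e)
     (v F - v (F `\ e)%fset - v (F `\ e')%fset + v ((F `\ e) `\ e')%fset) <=
   2048 * M ^+ 2 * lam * \sum_(e <- F) (v F - v (F `\ e)%fset))%R.
Proof.
have mmix e e' : coord_measurable (mean_mixed e e').
  apply: (@coord_measurable_int _ _ _ P _ r r_gt0 e (fun x s =>
    \int[P]_w' (mixed_diff f x e e' s (r e' w') ^+ 2)%:E)).
    exact: coord_measurable_mixed_left.
  by move=> x s; apply: integral_ge0 => w _; rewrite lee_fin sqr_ge0.
have mix0 e e' x : 0 <= mean_mixed e e' x.
  by apply: integral_ge0 => w _; apply: integral_ge0 => w' _; rewrite lee_fin sqr_ge0.
pose h e e' x := (typical M (x e))%:E * ((typical M (x e'))%:E * mean_mixed e e' x).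
have mtyp e : coord_measurable (fun x => (typical M (x e))%:E).
  move=> d' S y my y0; apply/measurable_EFinP.
  exact: (measurableT_comp (measurable_typical M)).
have mh e e' : coord_measurable (h e e').
  apply: coord_measurableM => //; apply: coord_measurableM => //.
have h0 e e' x : 0 <= h e e' x by rewrite !mule_ge0// lee_fin typical_ge0.
have msum (I : eqType) (s : seq I) (p : pred I) (k : I -> (J -> R) -> \bar R) :
    (forall i, coord_measurable (k i)) -> (forall i x, 0 <= k i x) ->
    mean r (fun x => \sum_(i <- s | p i) k i x) = \sum_(i <- s | p i) mean r (k i).
  move=> mk k0; rewrite /mean -[RHS]big_filter.
  under eq_integral do rewrite -big_filter.
  rewrite ge0_integral_sum//.
  by move=> i; exact: (measurable_comp_config r_gt0 (mk i)).
have msumm (I : eqType) (s : seq I) (p : pred I) (k : I -> (J -> R) -> \bar R) :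
    (forall i, coord_measurable (k i)) -> coord_measurable (fun x => \sum_(i <- s | p i) k i x).
  move=> mk d' S y my y0; under eq_fun do rewrite -big_filter.
  by apply: emeasurable_sum => i; exact: (mk i _ _ _ my y0).
rewrite -lee_fin.
apply: (@le_trans _ _ (\sum_(e <- F) \sum_(e' <- F | e' != e) mean r (mean_mixed e e'))).
  rewrite -sumEFin; apply: lee_sum => e _; rewrite -sumEFin; apply: lee_sum => e' _.
  exact: (mixed_influence_le ind r_gt0 f0 mf fF cond_fin phiE).
apply: (@le_trans _ _ (64%:E * \sum_(e <- F) \sum_(e' <- F | e' != e) mean r (h e e'))).
  have s0 e : 0 <= \sum_(e' <- F | e' != e) mean r (h e e').
    by apply: sume_ge0 => e' _; apply: integral_ge0.
  rewrite ge0_sume_distrr//; apply: lee_sum => e _.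
  rewrite ge0_sume_distrr; last by move=> e' _; apply: integral_ge0.
  by apply: lee_sum => e' ee'; apply: mean_mixed_typical; rewrite eq_sym.
have mY e := coord_measurable_distorted_jump e.
have Y0 e x := distorted_jump_ge0 e x.
apply: (@le_trans _ _ (64%:E * ((8 * M ^+ 2)%:E * \sum_(e <- F) mean r (distorted_jump e)))).
  apply: lee_wpmul2l => //.
  have c0 : (0 <= 8 * M ^+ 2)%R by rewrite mulr_ge0 ?sqr_ge0.
  under eq_bigr do rewrite -msum//.
  rewrite -msum//; last 2 first.
  - by move=> e; exact: msumm.
  - by move=> e x; apply: sume_ge0.
  rewrite -msum// -(mean_scale r_gt0)//; last 2 first.
  - exact: msumm.
  - by move=> x; apply: sume_ge0.
  apply: ge0_le_integral => //.
  - by move=> w _; apply: sume_ge0 => e _; apply: sume_ge0.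
  - apply: (measurable_comp_config r_gt0 (g := fun x => \sum_(e <- F) \sum_(e' <- F | e' != e) h e e' x)).
    by apply: (@msumm _) => e; exact: msumm.
  - apply: measurable_funeM.
    apply: (measurable_comp_config r_gt0 (g := fun x => \sum_(e <- F) distorted_jump e x)).
    exact: msumm.
  by move=> w _; apply: sum_mixed_le; exact: config_gt0.
(* [2048 = 64 * 8 * 2 * 2]: the restriction to typical values, the row sums, the factor [2 * lam]
   and the 2 of [mean_sqr_resample_diff]. *)
have -> : (2048 * M ^+ 2 * lam * \sum_(e <- F) (v F - v (F `\ e)%fset))%R%:E =
  64%:E * ((8 * M ^+ 2)%:E * \sum_(e <- F) ((2 * lam)%:E * mean r (mean_jump e))).
  under [in RHS]eq_bigr do rewrite (mean_sqr_resample_diff ind r_gt0 f0 mf fF phiE) -EFinM.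
  rewrite sumEFin -!EFinM -!mulr_sumr; congr (_%:E); ring.
apply: lee_wpmul2l => //; apply: lee_wpmul2l.
  by rewrite lee_fin mulr_ge0 ?sqr_ge0.
rewrite big_seq [leRHS]big_seq; apply: lee_sum => e eF.
exact: mean_distorted_jump_le.
Qed.

End level_two_inequality.

(** * From finite levels to all levels *)

Section level_concentration.
Context {R : realType} {J : choiceType}.
Implicit Types (v : {fset J} -> R) (F S T : {fset J}).

Lemma sum_moebius_neq0 F v :
  \sum_(S <- (fpowerset F `\ fset0)%fset) moebius v S = v F - v fset0.
Proof.
have m0 : moebius v fset0 = v fset0.
  by rewrite /moebius fpowerset0 big_seq_fset1 fsetDv cardfs0 expr0 mul1r.
have F0 : fset0 \in fpowerset F by rewrite fpowersetE fsub0set.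
by rewrite -[v F](sum_moebius F v) (big_fsetD1 fset0 F0)/= m0 addrAC subrr add0r.
Qed.

Lemma ler_sum_fsubset (I : choiceType) (A B : {fset I}) (a : I -> R) :
  (A `<=` B)%fset -> (forall i, 0 <= a i) ->
  \sum_(i <- A) a i <= \sum_(i <- B) a i.
Proof.
move=> AB a0; rewrite [leRHS](big_fsetID _ (mem A))/=.
have -> : [fset i in B | i \in A]%fset = A.
  apply/fsetP => i; rewrite !inE/=; case: (boolP (i \in A)); rewrite ?andbT ?andbF//.
  by move=> /(fsubsetP AB).
by rewrite lerDl sumr_ge0.
Qed.

(** The hypothesis bounds the second moment of the cardinal by [1 + A] times the first; AM-GM bounds
    twice the latter by the second moment plus [(1 + A)^2] times the mass, and one finite second
    moment cancels. The empty set has cardinal 0, so its mass can be omitted. *)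
Lemma sum_card2_moebius_le F v (A : R) : 0 <= A ->
  (forall S, 0 <= moebius v S) ->
  \sum_(e <- F) \sum_(e' <- F | e' != e)
    (v F - v (F `\ e)%fset - v (F `\ e')%fset + v ((F `\ e) `\ e')%fset) <=
    A * \sum_(e <- F) (v F - v (F `\ e)%fset) ->
  \sum_(S <- fpowerset F) #|` S|%:R ^+ 2 * moebius v S <=
    (1 + A) ^+ 2 * (v F - v fset0).
Proof.
move=> A0 w0 H.
have h1 : \sum_(S <- fpowerset F) #|` S|%:R ^+ 2 * moebius v S <=
    (1 + A) * \sum_(S <- fpowerset F) #|` S|%:R * moebius v S.
  by rewrite sum_card2_moebius sum_card_moebius mulrDl mul1r lerD2l.
(* AM-GM: [2 (1 + A) |S| <= |S|^2 + (1 + A)^2]. *)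
have h2 : 2 * ((1 + A) * \sum_(S <- fpowerset F) #|` S|%:R * moebius v S) <=
    \sum_(S <- fpowerset F) #|` S|%:R ^+ 2 * moebius v S +
    (1 + A) ^+ 2 * \sum_(S <- (fpowerset F `\ fset0)%fset) moebius v S.
  have F0 : fset0 \in fpowerset F by rewrite fpowersetE fsub0set.
  have D0 (c : nat -> R) : c 0%N = 0 -> \sum_(S <- fpowerset F) c #|` S| * moebius v S =
      \sum_(S <- (fpowerset F `\ fset0)%fset) c #|` S| * moebius v S.
    move=> c0; rewrite (big_fsetD1 fset0 F0)/= [X in X + _](_ : _ = 0) ?add0r//.
    by rewrite ?cardfs0 c0 mul0r.
  rewrite (D0 (fun n => n%:R))// (D0 (fun n => n%:R ^+ 2)) ?expr0n//.
  rewrite !mulr_sumr -big_split/=; apply: ler_sum => S _.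
  have := w0 S; have : 0 <= (#|` S|%:R - (1 + A)) ^+ 2 :> R by exact: sqr_ge0.
  move: (#|` S|%:R) (moebius v S) => n w n0 w0'.
  rewrite -subr_ge0; have -> : n ^+ 2 * w + (1 + A) ^+ 2 * w - 2 * ((1 + A) * (n * w)) =
    (n - (1 + A)) ^+ 2 * w by ring.
  exact: mulr_ge0.
rewrite sum_moebius_neq0 in h2; lra.
Qed.

Lemma cvg_sumr (I : Type) (s : seq I) (a : I -> nat -> R) (l : I -> R) :
  (forall i, a i n @[n --> \oo] --> l i) ->
  (\sum_(i <- s) a i n) @[n --> \oo] --> \sum_(i <- s) l i.
Proof.
move=> al; elim: s => [|i s IH].
  by under eq_fun do rewrite big_nil; rewrite big_nil; exact: cvg_cst.
by under eq_fun do rewrite big_cons; rewrite big_cons; exact: cvgD.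
Qed.

(** The set function and the finite set vary together. On the right, [vn n (Fn n)] is dominated by
    [v (Fn n)], which the full sum controls uniformly in [n], so only [vn n fset0] has to converge
    there. *)
Lemma esum_card2_le v (vn : nat -> {fset J} -> R) (Fn : nat -> {fset J}) (B : R) :
  0 <= B ->
  (forall S, 0 <= moebius v S) -> (forall n S, 0 <= moebius (vn n) S) ->
  (forall n T, vn n T <= v T) ->
  (forall T, (vn n T) @[n --> \oo] --> v T) ->
  (forall S, \forall n \near \oo, S `<=` Fn n)%fset ->
  (forall n, \sum_(S <- fpowerset (Fn n)) #|` S|%:R ^+ 2 * moebius (vn n) S <=
    B * (vn n (Fn n) - vn n fset0)) ->
  (\esum_(S in [set: {fset J}]) ((#|` S|%:R ^+ 2)%:E * (moebius v S)%:E) <=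
   B%:E * \esum_(S in [set S : {fset J} | S <> fset0]) (moebius v S)%:E)%E.
Proof.
move=> B0 w0 wn0 vnv cv exh H.
set Sg := (X in (_ <= _ * X)%E).
have Sg0 : (0 <= Sg)%E by apply: esum_ge0 => S _; rewrite lee_fin w0.
(* For [B = 0] the right-hand side is 0 even when the sum is infinite, so each term on the left must
   be shown to vanish. *)
have [Bz|Bp] := eqVneq B 0.
  rewrite Bz mul0e.
  have z n S : (S `<=` Fn n)%fset -> #|` S|%:R ^+ 2 * moebius (vn n) S = 0.
    move=> SF; have := H n; rewrite Bz mul0r (big_fsetD1 S)/= ?fpowersetE// => h.
    have t0 T : 0 <= #|` T|%:R ^+ 2 * moebius (vn n) T :> R by rewrite mulr_ge0 ?sqr_ge0.
    apply/eqP; rewrite eq_le t0 andbT; apply: le_trans h.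
    by rewrite lerDl sumr_ge0.
  rewrite esum1// => S _; rewrite -EFinM; congr (_%:E).
  have cm : (#|` S|%:R ^+ 2 * moebius (vn n) S) @[n --> \oo] --> #|` S|%:R ^+ 2 * moebius v S.
    by apply: cvgM; [exact: cvg_cst|]; apply: cvg_sumr => T; apply: cvgM => //; exact: cvg_cst.
  apply: (cvg_unique _ cm) => //; apply: cvg_near_cst.
  by apply: filterS (exh S) => n; exact: z.
have {Bp}B1 : 0 < B by rewrite lt_neqAle eq_sym Bp.
have [->|Sgfin] := eqVneq Sg +oo%E; first by rewrite gt0_muley ?lte_fin// leey.
have Sgr : Sg = (fine Sg)%:E by rewrite fineK// ge0_fin_numE// lt_neqAle Sgfin leey.
apply: ub_ereal_sup => _ [X [finX _] <-].
rewrite (fsbig_finite _ _ finX)//= Sgr -EFinM.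
under eq_bigr do rewrite -EFinM.
rewrite sumEFin lee_fin; set X' := fset_set X.
have cX : (\sum_(S <- X') #|` S|%:R ^+ 2 * moebius (vn n) S) @[n --> \oo] -->
    \sum_(S <- X') #|` S|%:R ^+ 2 * moebius v S.
  apply: cvg_sumr => S; apply: cvgM; first exact: cvg_cst.
  by apply: cvg_sumr => T; apply: cvgM => //; exact: cvg_cst.
have cR : (B * (fine Sg + v fset0 - vn n fset0)) @[n --> \oo] --> B * fine Sg.
  rewrite (_ : B * fine Sg = B * (fine Sg + v fset0 - v fset0)); last by rewrite addrK.
  apply: cvgM; first exact: cvg_cst.
  by apply: cvgB; [exact: cvg_cst|exact: cv].
apply: (ler_cvg_to cX cR).
(* Once [Fn n] contains the union of the finitely many sets in [X], all of them are counted in the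
   hypothesis at [n]. *)
pose U := (\bigcup_(S <- X') S)%fset.
apply: filterS (exh U) => n UF.
have vF : v (Fn n) - v fset0 <= fine Sg.
  rewrite -sum_moebius_neq0 -lee_fin -Sgr -sumEFin; apply: esum_ge.
  exists [set` (fpowerset (Fn n) `\ fset0)%fset].
    by split; [exact: finite_fset|move=> S /=; rewrite in_fsetD1 => /andP[/eqP]].
  by rewrite fsbig_finite ?finite_fset//= set_fsetK.
apply: (@le_trans _ _ (\sum_(S <- fpowerset (Fn n)) #|` S|%:R ^+ 2 * moebius (vn n) S)).
  apply: ler_sum_fsubset; last by move=> S; rewrite mulr_ge0 ?sqr_ge0.
  apply/fsubsetP => S SX; rewrite fpowersetE; apply: fsubset_trans UF.
  exact: bigfcup_sup.
apply: (le_trans (H n)); rewrite ler_wpM2l//.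
have := vnv n (Fn n); lra.
Qed.

End level_concentration.

(** * Exhaustion of the graph *)

Section flow_space.
Context {R : realType} {G : graph}.
Implicit Types (theta : edge G -> R) (x y u v : G) (e : edge G).

Lemma opp_edgeK : involutive (@opp_edge G).
Proof. by move=> [[x y] xy]; apply: val_inj. Qed.

Lemma finite_star x : finite_set [set e : edge G | edge_src e = x].
Proof.
apply: (@sub_finite_set _ _ (sval @^-1` [set (x, y) | y in [set y | adj x y]])).
  by move=> [[a b] ab]; rewrite /edge_src /= => ax; subst a; exists b.
apply: finite_preimage; last exact/finite_image/adj_locfin.
by move=> e e' _ _; exact: val_inj.
Qed.

Definition star x : {fset edge G} := fset_set [set e : edge G | edge_src e = x].

Lemma in_star x e : (e \in star x) = (edge_src e == x).
Proof.
by rewrite in_fset_set; [apply/idP/idP; rewrite inE => /eqP|exact: finite_star].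
Qed.

Lemma divergenceE theta x : divergence theta x = \sum_(e <- star x) theta e.
Proof. by rewrite /divergence fsbig_finite//; exact: finite_star. Qed.

Lemma divergenceD (c : R) theta theta' x :
  divergence (fun e => theta e + c * theta' e) x =
  divergence theta x + c * divergence theta' x.
Proof. by rewrite !divergenceE mulr_sumr big_split. Qed.

Lemma sum_star_pred1 x e : \sum_(e' <- star x) (e' == e)%:R = (edge_src e == x)%:R :> R.
Proof.
have [ex|ex] := boolP (e \in star x).
  rewrite (big_fsetD1 e)//= eqxx -in_star ex big_seq big1 ?addr0// => e'.
  by rewrite in_fsetD1 => /andP[/negbTE->].
rewrite -in_star (negbTE ex) big_seq big1// => e' e'x.
by case: eqP => // ee; rewrite -ee e'x in ex.
Qed.

(** Unit currents along successive edges are added, so a path with repeated vertices or edges does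
    no harm. *)
Lemma exists_path_flow u v : exists (theta : edge G -> R) (A : seq (edge G)),
  [/\ forall e, theta (opp_edge e) = - theta e,
      forall e, e \notin A -> theta e = 0 &
      forall x, divergence theta x = (x == u)%:R - (x == v)%:R].
Proof.
have [p up <-] := adj_connected u v.
elim: p u up => [|y p IH] u /=.
  move=> _; exists (fun=> 0), [::]; split=> // [e|x]; first by rewrite oppr0.
  by rewrite divergenceE big1// subrr.
move=> /andP[uy yp]; have [theta [A [ta tA tdiv]]] := IH y yp.
pose e0 : edge G := exist _ (u, y) uy.
exists (fun e => theta e + 1 * ((e == e0)%:R + (-1) * (e == opp_edge e0)%:R)),
  (e0 :: opp_edge e0 :: A); split.
- move=> e; rewrite ta (can2_eq opp_edgeK opp_edgeK).
  by rewrite (inj_eq (inv_inj opp_edgeK)); ring.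
- move=> e; rewrite !inE !negb_or => /and3P[/negbTE-> /negbTE-> eA].
  by rewrite tA//; ring.
- move=> x; rewrite !divergenceD tdiv !divergenceE !sum_star_pred1 /edge_src/=.
  by rewrite (eq_sym u) (eq_sym y); ring.
Qed.

End flow_space.

Section half_edges.
Context {R : realType} {G : graph} {H : pred (edge G)}.
Hypothesis half : is_half H.
Let J : Type := half_edge H.
Implicit Types (t a : half_edge H -> R) (x : G) (e : edge G).

(** The last case cannot occur when [is_half H] holds. *)
Definition antisym_ext t e : R :=
  match (insub e : option (half_edge H)), (insub (opp_edge e) : option (half_edge H)) with
  | Some j, _ => t j
  | None, Some j => - t j
  | _, _ => 0
  end.

Lemma antisym_ext_sval t (j : half_edge H) : antisym_ext t (sval j) = t j.
Proof. by rewrite /antisym_ext (valK j : insub (sval j) = Some j). Qed.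

Lemma antisym_ext_opp t e : antisym_ext t (opp_edge e) = - antisym_ext t e.
Proof.
rewrite /antisym_ext opp_edgeK; have := half e.
by case: insubP => [j1 h1 _|/negbTE h1]; case: insubP => [j2 h2 _|/negbTE h2];
  rewrite ?h1 ?h2 ?opprK.
Qed.

Lemma antisym_extD (c : R) t t' e :
  antisym_ext (fun i => t i + c * t' i) e = antisym_ext t e + c * antisym_ext t' e.
Proof.
by rewrite /antisym_ext; case: insub => [j|]; [|case: insub => [j|]]; ring.
Qed.

Lemma antisym_ext_restrict (theta : edge G -> R) :
  (forall e, theta (opp_edge e) = - theta e) ->
  antisym_ext (fun j => theta (sval j)) = theta.
Proof.
move=> ta; apply/funext => e; rewrite /antisym_ext; have := half e.
case: insubP => [j1 h1 j1e _|/negbTE->]; first by rewrite -[sval j1]/(val j1) j1e.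
case: insubP => [j2 h2 j2e|/negbTE->//] _.
by rewrite -[sval j2]/(val j2) j2e ta opprK.
Qed.

Lemma divergence_antisym_extD (c : R) t t' x :
  divergence (antisym_ext (fun i => t i + c * t' i)) x =
  divergence (antisym_ext t) x + c * divergence (antisym_ext t') x.
Proof.
by rewrite -divergenceD; congr divergence; apply/funext => e; exact: antisym_extD.
Qed.

Definition first_vertices n : seq G := pmap (@choice.unpickle G) (iota 0 n).

Lemma mem_first_vertices x n : (choice.pickle x < n)%N -> x \in first_vertices n.
Proof.
move=> xn; rewrite mem_pmap; apply/mapP; exists (choice.pickle x); last by rewrite choice.pickleK.
by rewrite mem_iota add0n xn.
Qed.

Lemma first_vertices_sub n m : (n <= m)%N -> {subset first_vertices n <= first_vertices m}.
Proof.
move=> nm x; rewrite !mem_pmap => /mapP[k kn ->]; apply/mapP; exists k => //.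
by move: kn; rewrite !mem_iota !add0n => /leq_trans; exact.
Qed.

Definition incident n : {fset half_edge H} :=
  [fset j | j in pmap (insub : edge G -> option (half_edge H))
    (flatten [seq (star x : seq _) | x <- first_vertices n] ++
     [seq opp_edge e | e <- flatten [seq (star x : seq _) | x <- first_vertices n]])]%fset.

Lemma in_incident n (j : half_edge H) : (j \in incident n) =
  (edge_src (sval j) \in first_vertices n) ||
  (edge_src (opp_edge (sval j)) \in first_vertices n).
Proof.
have fl e : (e \in flatten [seq (star x : seq _) | x <- first_vertices n]) =
    (edge_src e \in first_vertices n).
  apply/flatten_mapP/idP => [[x xn]|en]; first by rewrite in_star => /eqP->.
  by exists (edge_src e) => //; rewrite in_star.
rewrite in_fset/= mem_pmap_sub mem_cat fl; congr (_ || _).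
by rewrite -[X in X \in _]opp_edgeK mem_map ?fl//; exact: inv_inj opp_edgeK.
Qed.

Lemma incident_sub n m : (n <= m)%N -> (incident n `<=` incident m)%fset.
Proof.
move=> nm; apply/fsubsetP => j; rewrite !in_incident => /orP[] h; apply/orP; [left|right];
  exact: first_vertices_sub h.
Qed.

Lemma incident_near (S : {fset half_edge H}) :
  \forall n \near \oo, (S `<=` incident n)%fset.
Proof.
exists (\max_(j <- S) (choice.pickle (edge_src (sval j))).+1)%N => // n /= Sn.
apply/fsubsetP => j jS; rewrite in_incident mem_first_vertices//.
apply: leq_trans Sn.
by apply: (leq_bigmax_seq (F := fun j => (choice.pickle (edge_src (sval j))).+1) j).
Qed.

(** The constraints involve only edges in [incident n]; values elsewhere are free and carry no
    energy in the problem of rank [n]. *)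
Definition circulations n t :=
  forall x, x \in first_vertices n -> divergence (antisym_ext t) x = 0.

Lemma is_subspace_circulations n : is_subspace (circulations n).
Proof.
split=> [x _|c a b Wa Wb x xn]; last by rewrite divergence_antisym_extD Wa// Wb// mulr0 addr0.
rewrite divergenceE big1// => e _; rewrite /antisym_ext.
by case: insub => [//|]; case: insub => [_|//]; rewrite oppr0.
Qed.

End half_edges.

Section network.
Context {R : realType} {G : graph} {H : pred (edge G)}.
Hypothesis half : is_half H.
Variables u v : G.
Implicit Types (x t : half_edge H -> R).

Definition is_unit_flow t :=
  forall y, divergence (antisym_ext t) y = (y == u)%:R - (y == v)%:R.

Lemma exists_unit_flow : exists (t : half_edge H -> R) (A : {fset half_edge H}),
  is_unit_flow t /\ forall j, j \notin A -> t j = 0.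
Proof.
have [theta [A [ta tA tdiv]]] := @exists_path_flow R G u v.
exists (fun j => theta (sval j)),
  [fset j | j in pmap (insub : edge G -> option (half_edge H)) A]%fset; split.
  by move=> y; rewrite antisym_ext_restrict.
by move=> j; rewrite in_fset/= mem_pmap_sub => /tA.
Qed.

Variables (a : half_edge H -> R) (A : {fset half_edge H}).
Hypotheses (a_flow : is_unit_flow a) (aA : forall j, j \notin A -> a j = 0).
Variable f : nat -> (half_edge H -> R) -> R.
Hypothesis f_min : forall n, is_min_energy (incident n) (circulations n) a (f n).

Let sub n := @is_subspace_circulations R G H n.

(** A field satisfying the constraints of rank [n] differs from [a] by an element of
    [circulations n], so Pythagoras measures its excess energy. *)
Lemma min_energy_le_flow n x t : (forall i, 0 < x i) ->
  (forall y, y \in first_vertices n ->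
     divergence (antisym_ext t) y = (y == u)%:R - (y == v)%:R) ->
  exists2 theta, optimal (incident n) (circulations n) a x theta &
    wdot (incident n) x t t = f n x + wdot (incident n) x
      (fun i => t i + (-1) * theta i) (fun i => t i + (-1) * theta i).
Proof.
move=> x0 tdiv; have [theta o ->] := f_min n x0; exists theta => //.
apply: (optimal_pythagoras (sub n) o) => y yn.
by rewrite divergence_antisym_extD tdiv// a_flow; ring.
Qed.

(** A minimizer of rank [m] is admissible at rank [n], where moreover fewer edges are counted. *)
Lemma min_energy_nondecreasing x : (forall i, 0 < x i) ->
  nondecreasing_seq (fun n => f n x).
Proof.
move=> x0 n m nm; have [theta [Wt _] ->] := f_min m x0.
have tdiv y : y \in first_vertices n ->
    divergence (antisym_ext theta) y = (y == u)%:R - (y == v)%:R.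
  move=> yn; have := Wt y (first_vertices_sub nm yn).
  by rewrite divergence_antisym_extD a_flow => ?; lra.
have [theta' _ E] := min_energy_le_flow x0 tdiv.
apply: (@le_trans _ _ (wdot (incident n) x theta theta)).
    by rewrite E lerDl wdot_ge0.
apply: ler_sum_fsubset => [|j]; first exact: incident_sub.
by rewrite -mulrA mulr_ge0 ?(ltW (x0 _))// -expr2 sqr_ge0.
Qed.

Lemma min_energy_le_reference n x : (forall i, 0 < x i) ->
  f n x <= \sum_(j <- A) x j * a j ^+ 2.
Proof.
move=> x0; have [theta _ E] := min_energy_le_flow (n := n) x0 (fun y _ => a_flow y).
apply: (@le_trans _ _ (wdot (incident n) x a a)); first by rewrite E lerDl wdot_ge0.
have t0 j : 0 <= x j * a j ^+ 2 by rewrite mulr_ge0 ?(ltW (x0 _))// sqr_ge0.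
apply: (@le_trans _ _ (\sum_(j <- (incident n `|` A)%fset) x j * a j ^+ 2)).
  rewrite /wdot (eq_bigr (fun j => x j * a j ^+ 2)).
    by apply: ler_sum_fsubset => //; exact: fsubsetUl.
  by move=> j _; rewrite expr2 mulrA.
rewrite (big_fsetID _ (mem A))/= [X in _ + X]big1_seq ?addr0; last first.
  by move=> j /andP[_]; rewrite !inE => /andP[_ /aA->]; rewrite expr0n mulr0.
by apply: ler_sum_fsubset => //; apply/fsubsetP => j; rewrite !inE => /andP[].
Qed.

Lemma min_energy_cvg x : (forall i, 0 < x i) ->
  f ^~ x @ \oo --> sup (range (f ^~ x)).
Proof.
move=> x0; apply: nondecreasing_cvgn; first exact: min_energy_nondecreasing.
by exists (\sum_(j <- A) x j * a j ^+ 2) => _ [n _ <-]; exact: min_energy_le_reference.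
Qed.

Lemma min_energy_le_sup n x : (forall i, 0 < x i) -> f n x <= sup (range (f ^~ x)).
Proof.
move=> x0; rewrite -(cvg_lim _ (min_energy_cvg x0))//.
apply: (nondecreasing_cvgn_le (min_energy_nondecreasing x0)).
by apply/cvg_ex; eexists; exact: min_energy_cvg.
Qed.

Lemma min_energy_le_energy n x theta : (forall i, 0 < x i) ->
  unit_flow x u v theta -> ((f n x)%:E <= energy x theta)%E.
Proof.
move=> x0 [[ta _] tdiv].
have [|th _ E] := @min_energy_le_flow n x (fun j => theta (sval j)) x0.
  by move=> y _; rewrite antisym_ext_restrict.
apply: (@le_trans _ _ (wdot (incident n) x (fun j => theta (sval j))
    (fun j => theta (sval j)))%:E); first by rewrite lee_fin E lerDl wdot_ge0.
rewrite /wdot -sumEFin; apply: esum_ge; exists [set` incident n].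
  by split=> //; exact: finite_fset.
rewrite fsbig_finite ?finite_fset//= set_fsetK.
by rewrite le_eqVlt; apply/orP; left; apply/eqP; apply: eq_bigr => j _; rewrite expr2 mulrA.
Qed.

(* The minimizers converge on each edge: for [n <= m], the Pythagorean identity gives
   [x e * (theta_m e - theta_n e)^2 <= f m x - f n x]. *)
Lemma exists_limit_flow x : (forall i, 0 < x i) ->
  exists2 t, is_unit_flow t &
    (\esum_(j in [set: half_edge H]) (x j * t j ^+ 2)%:E <=
      (sup (range (f ^~ x)))%:E)%E.
Proof.
move=> x0; set L := sup _.
have /choice[th thP] : forall n, exists th,
    optimal (incident n) (circulations n) a x th /\
    f n x = wdot (incident n) x th th by move=> n; have [th] := f_min n x0; exists th.
have thdiv n y : y \in first_vertices n ->
    divergence (antisym_ext (th n)) y = (y == u)%:R - (y == v)%:R.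
  move=> yn; have [[Wt _] _] := thP n; have := Wt y yn.
  by rewrite divergence_antisym_extD a_flow => ?; lra.
have dist n m j : (n <= m)%N -> j \in incident n ->
    x j * (th m j - th n j) ^+ 2 <= L - f n x.
  move=> nm jn; have tdiv y : y \in first_vertices n ->
      divergence (antisym_ext (th m)) y = (y == u)%:R - (y == v)%:R.
    by move=> yn; apply: thdiv; exact: first_vertices_sub yn.
  have le : wdot (incident n) x (th m) (th m) <= L.
    apply: le_trans (min_energy_le_sup m x0); have [_ ->] := thP m.
    apply: ler_sum_fsubset => [|i]; first exact: incident_sub.
    by rewrite -mulrA mulr_ge0 ?(ltW (x0 _))// -expr2 sqr_ge0.
  have [on fE] := thP n.
  have E : wdot (incident n) x (th m) (th m) = f n x + wdot (incident n) x
      (fun i => th m i + (-1) * th n i) (fun i => th m i + (-1) * th n i).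
    rewrite fE; apply: (optimal_pythagoras (sub n) on) => y yn.
    by rewrite divergence_antisym_extD tdiv// a_flow; ring.
  have := wdot_ge_term (fun i => th m i + (-1) * th n i) x0 jn.
  by rewrite mulN1r; lra.
have cvg_th j : cvgn (fun n => th n j).
  apply/cauchy_cvgP/cauchy_exP => e e0.
  have [N [jN LN]] : exists N, j \in incident N /\ L - f N x < x j * e ^+ 2.
    have h1 : \forall n \near \oo, L - f n x < x j * e ^+ 2.
      have : (L - f n x) @[n --> \oo] --> L - L.
        by apply: cvgB; [exact: cvg_cst|exact: min_energy_cvg].
      rewrite subrr => h; apply: (cvgr_lt _ h).
      by rewrite mulr_gt0 ?x0// exprn_gt0.
    have h2 := @incident_near G H [fset j]%fset.
    have [N _ hN] : \forall n \near \oo, L - f n x < x j * e ^+ 2 /\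
      ([fset j] `<=` incident n)%fset by near=> n; split; near: n.
    exists N; have [lN /fsubsetP sN] := hN N (leqnn N); split=> //.
    by apply: sN; rewrite inE.
  exists (th N j), N => // m /= Nm; rewrite /ball/= -(ltr_pXn2r (n := 2))// ?nnegrE//.
    rewrite -(ltr_pM2l (x0 j)); apply: le_lt_trans LN.
    by rewrite real_normK ?num_real// -sqrrN opprB; exact: dist.
  exact: ltW.
pose t j := limn (fun n => th n j).
have ct j : th n j @[n --> \oo] --> t j by exact: cvg_th.
have cte e : antisym_ext (th n) e @[n --> \oo] --> antisym_ext t e.
  rewrite /antisym_ext; case: insub => [j|]; first exact: ct.
  by case: insub => [j|]; [apply: cvgN; exact: ct|exact: cvg_cst].
exists t.
  move=> y; rewrite divergenceE; have c : (\sum_(e <- star y) antisym_ext (th n) e)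
      @[n --> \oo] --> \sum_(e <- star y) antisym_ext t e by exact: cvg_sumr.
  apply: (cvg_unique _ c) => //; apply: cvg_near_cst.
  (* Conservation at [y] is imposed as soon as [n] exceeds the code of [y], so the divergence is
     eventually constant. *)
  exists (choice.pickle y).+1 => // n /= yn; rewrite -divergenceE; apply: thdiv.
  exact: mem_first_vertices.
apply: ub_ereal_sup => _ [X [finX _] <-].
rewrite (fsbig_finite _ _ finX)//= sumEFin lee_fin; set X' := fset_set X.
have cX : (\sum_(j <- X') x j * th n j ^+ 2) @[n --> \oo] -->
    \sum_(j <- X') x j * t j ^+ 2.
  apply: cvg_sumr => j; apply: cvgM; first exact: cvg_cst.
  by rewrite expr2; under eq_fun do rewrite expr2; apply: cvgM; exact: ct.
apply: (ler_cvg_to cX (cvg_cst L)).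
apply: filterS (@incident_near G H X') => n Xn.
apply: le_trans (min_energy_le_sup n x0); have [_ ->] := thP n.
have E : wdot (incident n) x (th n) (th n) = \sum_(j <- incident n) x j * th n j ^+ 2.
  by apply: eq_bigr => j _; rewrite expr2 mulrA.
rewrite E; apply: ler_sum_fsubset => // j.
by rewrite mulr_ge0 ?(ltW (x0 _))// sqr_ge0.
Unshelve. all: by end_near. Qed.

(** The limit flow attains at most the supremum, and every unit flow dominates every [f n x]. The
    infimum is in particular finite, so [fine] in [eff_res] loses nothing. *)
Lemma eff_resE x : (forall i, 0 < x i) -> eff_res u v x = sup (range (f ^~ x)).
Proof.
move=> x0; rewrite /eff_res; set L := sup _.
suff -> : ereal_inf [set energy x theta | theta in unit_flow x u v] = L%:E by [].
have [t tdiv tL] := exists_limit_flow x0.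
have tE : energy x (antisym_ext t) = \esum_(j in [set: half_edge H]) (x j * t j ^+ 2)%:E.
  by apply: eq_esum => j _; rewrite antisym_ext_sval.
apply/eqP; rewrite eq_le; apply/andP; split.
  apply: (le_trans _ tL); rewrite -tE; apply: ereal_inf_lbound.
  exists (antisym_ext t) => //; split; last exact: tdiv.
  split=> [e|]; first exact: antisym_ext_opp.
  by rewrite tE (le_lt_trans tL)// ltry.
apply: le_ereal_inf_tmp => _ [theta th <-].
have c : (f n x)%:E @[n --> \oo] --> L%:E by apply: cvg_EFin; [exact: nearW|exact: min_energy_cvg].
rewrite -(cvg_lim _ c)//; apply: lime_le; first by apply/cvg_ex; exists L%:E.
by apply: nearW => n; exact: min_energy_le_energy.
Qed.

Lemma cvg_eff_res x : (forall i, 0 < x i) -> f ^~ x @ \oo --> eff_res u v x.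
Proof. by move=> x0; rewrite eff_resE//; exact: min_energy_cvg. Qed.

End network.

(** * Passage to the limit *)

Section monotone_limit.
Context {R : realType} d (Omega : measurableType d) (P : probability Omega R)
  (J : choiceType) (r : J -> {RV P >-> R}).
Hypothesis r_gt0 : forall i w, (0 < r i w)%R.
Hypothesis sqr_moment : forall i, (\int[P]_w (r i w ^+ 2)%:E < +oo)%E.
Local Open Scope ereal_scope.

Lemma sqr_affine_lty (c : J -> R) (s : seq J) (D : R) :
  \int[P]_w ((\sum_(j <- s) c j * r j w + D) ^+ 2)%:E < +oo.
Proof.
have msum (s' : seq J) : measurable_fun setT (fun w => (\sum_(j <- s') c j * r j w + D)%R).
  by apply: measurable_funD => //; apply: measurable_sum => j; exact: measurable_funM.
elim: s => [|i s IH].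
  under eq_integral do rewrite big_nil add0r.
  by rewrite integral_cst//= probability_setT mule1 ltry.
pose X w := ((r i w ^+ 2)%:E : \bar R).
pose Y w := ((\sum_(j <- s) c j * r j w + D) ^+ 2)%:E.
have mX : measurable_fun setT X by apply/measurable_EFinP/measurable_funX.
have mY : measurable_fun setT Y by apply/measurable_EFinP/measurable_funX.
have X0 w : 0 <= X w by rewrite lee_fin sqr_ge0.
have Y0 w : 0 <= Y w by rewrite lee_fin sqr_ge0.
have k0 : (0 <= 2 * c i ^+ 2)%R by rewrite mulr_ge0// sqr_ge0.
apply: (@le_lt_trans _ _ (\int[P]_w ((2 * c i ^+ 2)%:E * X w + 2%:E * Y w))).
  apply: ge0_le_integral => //.
  - by move=> w _; rewrite lee_fin sqr_ge0.
  - by apply/measurable_EFinP/measurable_funX.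
  - by apply: emeasurable_funD; exact: measurable_funeM.
  move=> w _; rewrite /X /Y -!EFinM -EFinD lee_fin big_cons.
  by have := sqr_ge0 (c i * r i w - (\sum_(j <- s) c j * r j w + D))%R; lra.
have kX0 w : 0 <= (2 * c i ^+ 2)%:E * X w by rewrite mule_ge0.
have kY0 w : 0 <= 2%:E * Y w by rewrite mule_ge0.
rewrite (ge0_integralD P measurableT (fun w _ => kX0 w) (measurable_funeM _ mX)
  (fun w _ => kY0 w) (measurable_funeM _ mY)) !ge0_integralZl//.
by rewrite lte_add_pinfty// lte_mul_pinfty// ?sqr_moment ?IH// ge0_fin_numE.
Qed.

Lemma affine_lty (c : J -> R) (s : seq J) (D : R) : (forall j, 0 <= c j)%R -> (0 <= D)%R ->
  \int[P]_w (\sum_(j <- s) c j * r j w + D)%:E < +oo.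
Proof.
move=> c0 D0; pose X w := (\sum_(j <- s) c j * r j w + D)%R.
have mX : measurable_fun setT X.
  by apply: measurable_funD => //; apply: measurable_sum => j; exact: measurable_funM.
have X0 w : (0 <= X w)%R.
  by rewrite addr_ge0// sumr_ge0// => j _; rewrite mulr_ge0// ltW.
apply: (@le_lt_trans _ _ (\int[P]_w (1 + (X w ^+ 2)%:E))).
  apply: ge0_le_integral => //.
  - by move=> w _; rewrite lee_fin; exact: X0.
  - exact/measurable_EFinP.
  - by apply: emeasurable_funD => //; apply/measurable_EFinP/measurable_funX.
  by move=> w _; rewrite -EFinD lee_fin -/(X w); have := X0 w; nra.
rewrite ge0_integralD//.
- by rewrite integral_cst//= probability_setT mul1e lte_add_pinfty ?ltry ?sqr_affine_lty.
- by move=> w _; rewrite lee_fin sqr_ge0.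
- by apply/measurable_EFinP/measurable_funX.
Qed.

Section affine_bound.
Variables (f : (J -> R) -> R) (c : J -> R) (A : seq J).
Hypothesis f0 : forall x, (0 <= f x)%R.
Hypothesis mf : coord_measurable (fun x => (f x)%:E).
Hypothesis c0 : forall j, (0 <= c j)%R.
Hypothesis f_le : forall x, (forall i, 0 < x i)%R -> (f x <= \sum_(j <- A) c j * x j)%R.

Let lin x := (\sum_(j <- A) c j * x j)%R.

Let lin0 x : (forall i, 0 < x i)%R -> (0 <= lin x)%R.
Proof. by move=> x0; apply: sumr_ge0 => j _; rewrite mulr_ge0// ltW. Qed.

Lemma measurable_mix_config T x : (forall i, 0 < x i)%R ->
  measurable_fun setT (fun w => (f (mix T x (config r w)))%:E).
Proof.
move=> x0; apply: mf; last by move=> w; apply: mix_gt0 => //; exact: config_gt0.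
by move=> i; apply: measurable_mix => //; exact: measurable_config.
Qed.

(** A coordinate of a mixed configuration is at most the sum of the two candidates, so the linear
    bound splits into a random and a fixed part. *)
Let cond_le T x : (forall i, 0 < x i)%R ->
  cond r T (fun x => (f x)%:E) x <= \int[P]_w (lin (config r w) + lin x)%:E.
Proof.
move=> x0; apply: ge0_le_integral => //.
- by move=> w _; rewrite lee_fin.
- exact: measurable_mix_config.
- apply/measurable_EFinP/measurable_funD => //; apply: measurable_sum => j.
  by apply: measurable_funM => //; exact: measurable_config.
move=> w _; have w0 := config_gt0 r_gt0 w.
rewrite lee_fin; apply: (le_trans (f_le (mix_gt0 T x0 w0))).
rewrite -big_split/=; apply: ler_sum => j _; rewrite -mulrDr ler_wpM2l//.
by rewrite /mix; case: ifP => _; rewrite ?lerDl ?lerDr ltW.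
Qed.

Lemma affine_cond_lty T x : (forall i, 0 < x i)%R ->
  cond r T (fun x => (f x)%:E) x < +oo.
Proof.
by move=> x0; apply: (le_lt_trans (cond_le T x0)); apply: affine_lty => //; exact: lin0.
Qed.

Lemma affine_phi_lty T : phi r (fun x => (f x)%:E) T < +oo.
Proof.
have mlin : measurable_fun setT (fun w => (lin (config r w))%:E).
  apply/measurable_EFinP; apply: measurable_sum => j.
  by apply: measurable_funM => //; exact: measurable_config.
pose D := \int[P]_w (lin (config r w))%:E.
have D0 : 0 <= D by apply: integral_ge0 => w _; rewrite lee_fin lin0//; exact: config_gt0.
have Dfin : D = (fine D)%:E.
  rewrite fineK// ge0_fin_numE//; have := @affine_lty c A 0%R c0 (lexx _).
  by under eq_integral do rewrite addr0.
have cle x : (forall i, 0 < x i)%R -> cond r T (fun x => (f x)%:E) x <= (lin x + fine D)%:E.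
  move=> x0; apply: (le_trans (cond_le T x0)); under eq_integral do rewrite EFinD.
  rewrite ge0_integralD//.
  - by rewrite integral_cst//= probability_setT mule1 -/D Dfin -EFinD addrC lexx.
  - by move=> w _; rewrite lee_fin lin0//; exact: config_gt0.
  - by move=> w _; rewrite lee_fin lin0.
apply: (le_lt_trans _ (sqr_affine_lty c A (fine D))).
have mc := coord_measurable_cond r_gt0 T mf (fun x => f0 x).
apply: ge0_le_integral => //.
- by move=> w _; rewrite mule_ge0// cond_ge0.
- by apply: emeasurable_funM; exact: measurable_comp_config.
- apply/measurable_EFinP/measurable_funX; apply: measurable_funD => //.
  by apply: measurable_sum => j; exact: measurable_funM.
move=> w _; have w0 := config_gt0 r_gt0 w.
by rewrite expr2 EFinM; apply: lee_pmul; rewrite ?cond_ge0//; exact: cle.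
Qed.

Variable fn : nat -> (J -> R) -> R.
Hypothesis fn0 : forall n x, (0 <= fn n x)%R.
Hypothesis mfn : forall n, coord_measurable (fun x => (fn n x)%:E).
Hypothesis fn_nd : forall x, (forall i, 0 < x i)%R -> nondecreasing_seq (fn ^~ x).
Hypothesis fn_cvg : forall x, (forall i, 0 < x i)%R -> fn ^~ x @ \oo --> f x.

Let fn_le n x : (forall i, 0 < x i)%R -> (fn n x <= f x)%R.
Proof.
move=> x0; rewrite -(cvg_lim _ (fn_cvg x0))//.
apply: (nondecreasing_cvgn_le (fn_nd x0)).
by apply/cvg_ex; eexists; exact: fn_cvg.
Qed.

Lemma cond_cvg T x : (forall i, 0 < x i)%R ->
  cond r T (fun x => (fn n x)%:E) x @[n --> \oo] --> cond r T (fun x => (f x)%:E) x.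
Proof.
move=> x0; have x1 w : forall i, (0 < mix T x (config r w) i)%R.
  by apply: mix_gt0 => //; exact: config_gt0.
have := @cvg_monotone_convergence _ _ _ P setT measurableT
  (fun n w => (fn n (mix T x (config r w)))%:E).
rewrite /cond (eq_integral (fun w => (f (mix T x (config r w)))%:E)); last first.
  move=> w _; apply/cvg_lim => //; apply: cvg_EFin; first exact: nearW.
  exact: fn_cvg.
apply.
- move=> n; apply: mfn; last exact: x1.
  by move=> i; apply: measurable_mix => //; exact: measurable_config.
- by move=> n w _; rewrite lee_fin.
- by move=> w _ n m nm; rewrite lee_fin; exact: fn_nd.
Qed.

Lemma cond_le_limit n T x : (forall i, 0 < x i)%R ->
  cond r T (fun x => (fn n x)%:E) x <= cond r T (fun x => (f x)%:E) x.
Proof.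
move=> x0; apply: ge0_le_integral => //.
- by move=> w _; rewrite lee_fin.
- apply: mfn; last by move=> w; apply: mix_gt0 => //; exact: config_gt0.
  by move=> i; apply: measurable_mix => //; exact: measurable_config.
- exact: measurable_mix_config.
by move=> w _; rewrite lee_fin fn_le//; apply: mix_gt0 => //; exact: config_gt0.
Qed.

Let mcn n T := coord_measurable_cond r_gt0 T (mfn n) (fun x => fn0 n x).

Let cn0 n T x : 0 <= cond r T (fun x => (fn n x)%:E) x.
Proof. by apply: cond_ge0 => y; rewrite lee_fin. Qed.

Lemma phi_le_limit n T : phi r (fun x => (fn n x)%:E) T <= phi r (fun x => (f x)%:E) T.
Proof.
have mc := coord_measurable_cond r_gt0 T mf (fun x => f0 x).
apply: ge0_le_integral => //.
- by move=> w _; rewrite mule_ge0// cn0.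
- by apply: emeasurable_funM; apply: measurable_comp_config => //; exact: mcn.
- by apply: emeasurable_funM; exact: measurable_comp_config.
move=> w _; have w0 := config_gt0 r_gt0 w.
by apply: lee_pmul; rewrite ?cn0//; exact: cond_le_limit.
Qed.

(** Monotone convergence is used twice, inside [cond] and for its square; finiteness of the limiting
    [cond] makes the product converge. *)
Lemma phi_cvg T :
  phi r (fun x => (fn n x)%:E) T @[n --> \oo] --> phi r (fun x => (f x)%:E) T.
Proof.
pose g n w := cond r T (fun x => (fn n x)%:E) (config r w).
have g0 n w : 0 <= g n w by exact: cn0.
have := @cvg_monotone_convergence _ _ _ P setT measurableT (fun n w => g n w * g n w).
rewrite [X in _ --> X](eq_integral (fun w => cond r T (fun x => (f x)%:E) (config r w) *
    cond r T (fun x => (f x)%:E) (config r w))); last first.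
  move=> w _; have w0 := config_gt0 r_gt0 w; apply/cvg_lim => //.
  have fin : cond r T (fun x => (f x)%:E) (config r w) \is a fin_num.
    by rewrite ge0_fin_numE ?affine_cond_lty ?cond_ge0.
  by apply: cvgeM; [exact: mule_def_fin|exact: cond_cvg|exact: cond_cvg].
apply.
- by move=> n; apply: emeasurable_funM; apply: measurable_comp_config => //; exact: mcn.
- by move=> n w _; rewrite mule_ge0.
move=> w _ n m nm; have w0 := config_gt0 r_gt0 w.
have gg : g n w <= g m w.
  apply: ge0_le_integral => //.
  - by move=> w' _; rewrite lee_fin.
  - apply: mfn; last by move=> w'; apply: mix_gt0 => //; exact: config_gt0.
    by move=> i; apply: measurable_mix => //; exact: measurable_config.
  - apply: mfn; last by move=> w'; apply: mix_gt0 => //; exact: config_gt0.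
    by move=> i; apply: measurable_mix => //; exact: measurable_config.
  move=> w' _; rewrite lee_fin fn_nd//; apply: mix_gt0 => //; exact: config_gt0.
exact: lee_pmul.
Qed.

End affine_bound.

Lemma coord_measurable_cvg (fn : nat -> (J -> R) -> R) (f : (J -> R) -> R) :
  (forall n, coord_measurable (fun x => (fn n x)%:E)) ->
  (forall x, (forall i, 0 < x i)%R -> fn ^~ x @ \oo --> f x) ->
  coord_measurable (fun x => (f x)%:E).
Proof.
move=> mfn cfn d' S y my y0.
apply: (emeasurable_fun_cvg (fun n t => (fn n (y t))%:E)) => [n|t _]; first exact: mfn.
by apply: cvg_EFin; [exact: nearW|exact: cfn].
Qed.

End monotone_limit.

(** * Deterministic resistances *)

Section degenerate.
Context {R : realType} d (Omega : measurableType d) (P : probability Omega R)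
  (J : choiceType) (r : J -> {RV P >-> R}).
Hypothesis ind : mutually_independent r.
Hypothesis r_gt0 : forall i w, (0 < r i w)%R.
Local Open Scope ereal_scope.
Variables (F : {fset J}) (f : (J -> R) -> R).
Hypothesis f0 : forall x, (0 <= f x)%R.
Hypothesis mf : coord_measurable (fun x => (f x)%:E).
Hypothesis fF : depends_on F (fun x => (f x)%:E).
Variable v : {fset J} -> R.
Hypothesis phiE : forall T, phi r (fun x => (f x)%:E) T = (v T)%:E.
Variable N : J -> R -> R -> \bar R.
Hypothesis mN : forall e, measurable_fun setT (fun z : Omega * Omega => N e (r e z.1) (r e z.2)).
Hypothesis N0 : forall e s t, 0 <= N e s t.
Hypothesis N_gt0 : forall e s t, (0 < s)%R -> (0 < t)%R -> s != t -> 0 < N e s t.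

(** The vanishing integral says that two independent values at [e] agree almost surely, so
    resampling [e] does not change [f]. *)
Lemma degenerate_influence e :
  \int[P \x P]_z N e (r e z.1) (r e z.2) = 0 -> v F = v (F `\ e)%fset.
Proof.
move=> NE; pose G x s := ((f (upd x e s) - f x) ^+ 2)%:E.
have mG : coord_measurable2 G.
  move=> d' S y s my ms y0 s0; apply/measurable_EFinP/measurable_funX/measurable_funB.
    by apply/measurable_EFinP; exact: (coord_measurable_upd2 e mf my ms y0 s0).
  by apply/measurable_EFinP; exact: (mf my y0).
have G0 x s : 0 <= G x s by rewrite lee_fin sqr_ge0.
have := mean_sqr_resample_diff ind r_gt0 f0 mf fF phiE e.
rewrite -/(mean r (fun x => \int[P]_w G x (r e w))).
rewrite -(mean_resample ind r_gt0 e (coord_measurable_int r_gt0 e mG G0)); last first.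
  by move=> x; apply: integral_ge0.
rewrite (_ : mean r _ = 0); first by move=> [] ?; lra.
rewrite /mean; apply: integral0_eq => w _; rewrite /resample.
set x := config r w.
have x0 : forall i, (0 < x i)%R by exact: config_gt0.
have mGz : measurable_fun setT
    (fun z : Omega * Omega => G (upd x e (r e z.1)) (r e z.2)).
  have [m1 m2] := measurable_RV_pair r e.
  apply: (mG _ _ (fun z : Omega * Omega => upd x e (r e z.1)) (fun z => r e z.2)) => //.
    by move=> i; apply: measurable_upd.
  by move=> z i; exact: upd_gt0.
transitivity (\int[P \x P]_z G (upd x e (r e z.1)) (r e z.2)).
  by rewrite fubini_tonelli1.
apply/eqP; rewrite eq_le; apply/andP; split; last exact: integral_ge0.
(* The squared jump is at most [+oo * N]: it vanishes wherever [N] does. *)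
apply: (@le_trans _ _ (\int[P \x P]_z (+oo * N e (r e z.1) (r e z.2)))).
  apply: ge0_le_integral => //.
  - exact: measurable_funeM.
  move=> z _; have [zz|zz] := eqVneq (r e z.1) (r e z.2).
    by rewrite /G upd_upd zz subrr expr0n mule_ge0.
  by rewrite gt0_mulye ?leey// N_gt0.
by rewrite ge0_integralZl// NE mule0.
Qed.

End degenerate.

(** * Walsh components of the effective resistance *)

Section walsh_eff_res.
Context {R : realType} {G : graph} {H : pred (edge G)}.
Hypothesis half : is_half H.
Context d (Omega : measurableType d) (P : probability Omega R)
  (r : half_edge H -> {RV P >-> R}).
Hypothesis ind : mutually_independent r.
Hypothesis r_gt0 : forall i w, (0 < r i w)%R.
Hypothesis sqr_moment : forall i, (\int[P]_w (r i w ^+ 2)%:E < +oo)%E.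
Variables u v : G.

Let W (S : {fset half_edge H}) :=
  sqnorm2 P (walsh r (fun w => eff_res u v (fun e => r e w)) S).

(** The finite inequality is a hypothesis on all minimal energies, so that the exhaustion and the
    limit serve both the general and the deterministic case. *)
Lemma eff_res_concentration (B : R) : 0 <= B ->
  (forall F Wc (a : half_edge H -> R) f, is_subspace Wc -> is_min_energy F Wc a f ->
    (forall x, 0 <= f x) -> coord_measurable (fun x => (f x)%:E) ->
    (forall T (x : half_edge H -> R), (forall i, 0 < x i) ->
      (cond r T (fun x => (f x)%:E) x < +oo)%E) ->
    forall vf : {fset half_edge H} -> R,
    (forall T, phi r (fun x => (f x)%:E) T = (vf T)%:E) ->
    (forall S, 0 <= moebius vf S) ->
    \sum_(S <- fpowerset F) #|` S|%:R ^+ 2 * moebius vf S <= B * (vf F - vf fset0)) ->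
  (\esum_(S in [set: {fset half_edge H}]) ((#|` S|%:R ^+ 2)%:E * W S) <=
   B%:E * \esum_(S in [set S : {fset half_edge H} | S <> fset0%fset]) W S)%E.
Proof.
move=> B0 level.
have [a [A [a_flow aA]]] := exists_unit_flow half u v (R := R).
have sub n := @is_subspace_circulations R G H n.
have /choice[f fP] : forall n, exists f : (half_edge H -> R) -> R,
    [/\ is_min_energy (incident n) (circulations n) a f, forall x, 0 <= f x &
        coord_measurable (fun x => (f x)%:E)].
  by move=> n; exact: exists_min_energy.
have f_min n : is_min_energy (incident n) (circulations n) a (f n) by have [] := fP n.
have f0 n x : 0 <= f n x by have [_ + _] := fP n; exact.
have mf n : coord_measurable (fun x => (f n x)%:E) by have [] := fP n.
have f_nd x := min_energy_nondecreasing a_flow f_min (x := x).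
have f_le n x := min_energy_le_reference a_flow aA f_min n (x := x).
have f_cvg x := cvg_eff_res half a_flow aA f_min (x := x).
(* [eff_res] is a nonnegative number only at positive resistances. *)
pose g (x : half_edge H -> R) : R := `|eff_res u v x|.
have g0 x : 0 <= g x by exact: normr_ge0.
have g_cvg x : (forall i, 0 < x i) -> f ^~ x @ \oo --> g x.
  move=> x0; have c := f_cvg x x0; rewrite /g ger0_norm//.
  rewrite -(cvg_lim _ c)//; apply: limr_ge; first by apply/cvg_ex; eexists; exact: c.
  by apply: nearW.
have gE : (fun w => eff_res u v (fun e => r e w)) = (fun w => g (config r w)).
  apply/funext => w; have w0 := config_gt0 r_gt0 w.
  by apply: (cvg_unique _ (f_cvg _ w0) (g_cvg _ w0)).
have mg : coord_measurable (fun x => (g x)%:E) by exact: coord_measurable_cvg mf g_cvg.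
pose c j := a j ^+ 2.
have c0 j : 0 <= c j by exact: sqr_ge0.
have fle n x : (forall i, 0 < x i) -> f n x <= \sum_(j <- A) c j * x j.
  by move=> x0; apply: (le_trans (f_le n x x0)); apply: ler_sum => j _; rewrite mulrC.
have g_le x : (forall i, 0 < x i) -> g x <= \sum_(j <- A) c j * x j.
  move=> x0; have cx := g_cvg x x0; rewrite -(cvg_lim _ cx)//.
  apply: limr_le; first by apply/cvg_ex; eexists; exact: cx.
  by apply: nearW => n; exact: fle.
have condf n T x := affine_cond_lty r_gt0 sqr_moment (f0 n) (mf n) c0 (fle n) T (x := x).
have condg T x := affine_cond_lty r_gt0 sqr_moment g0 mg c0 g_le T (x := x).
have phif n T := affine_phi_lty r_gt0 sqr_moment (f0 n) (mf n) c0 (fle n) T.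
have phig T := affine_phi_lty r_gt0 sqr_moment g0 mg c0 g_le T.
pose vn n T := fine (phi r (fun x => (f n x)%:E) T).
pose vg T := fine (phi r (fun x => (g x)%:E) T).
have vnE n T : phi r (fun x => (f n x)%:E) T = (vn n T)%:E.
  rewrite /vn fineK// ge0_fin_numE//; apply: integral_ge0 => w _.
  by rewrite mule_ge0//; apply: cond_ge0 => y; rewrite lee_fin.
have vgE T : phi r (fun x => (g x)%:E) T = (vg T)%:E.
  rewrite /vg fineK// ge0_fin_numE//; apply: integral_ge0 => w _.
  by rewrite mule_ge0//; apply: cond_ge0 => y; rewrite lee_fin.
have WE S : W S = (moebius vg S)%:E.
  by rewrite /W gE (sqnorm2_walsh ind r_gt0 g0 mg condg phig).
have sq0 h : (0 <= sqnorm2 P h)%E.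
  by rewrite sqnorm2E; apply: integral_ge0 => w _; rewrite lee_fin sqr_ge0.
have w0 S : 0 <= moebius vg S by rewrite -lee_fin -WE; exact: sq0.
have wn0 n S : 0 <= moebius (vn n) S.
  by rewrite -lee_fin -(sqnorm2_walsh ind r_gt0 (f0 n) (mf n) (condf n) (phif n)); exact: sq0.
under eq_esum do rewrite WE.
under [X in (_ <= _ * X)%E]eq_esum do rewrite WE.
apply: (esum_card2_le B0 w0 wn0 (Fn := @incident G H)).
- move=> n T; have := phi_le_limit r_gt0 g0 mg f0 mf f_nd g_cvg n T.
  by rewrite vnE vgE lee_fin.
- move=> T; apply: fine_cvg; rewrite -/(vg T) -vgE.
  exact: (phi_cvg r_gt0 sqr_moment g0 mg c0 g_le f0 mf f_nd g_cvg).
- exact: incident_near.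
move=> n; exact: (level _ _ _ _ (sub n) (f_min n) (f0 n) (mf n) (condf n) _ (vnE n) (wn0 n)).
Qed.

Lemma eff_res_card2_le (M rho lam : R) : 0 < M -> 0 < lam -> M * rho <= lam ^+ 2 ->
  0 <= rho ->
  (forall e, \int[P]_w (r e w ^+ 8)%:E + \int[P]_w (r e w ^- 8)%:E <= M%:E)%E ->
  (forall e,
    \int[P \x P]_z ((r e z.1 - r e z.2) ^+ 2 * (1 / r e z.1 ^+ 6 + r e z.1 ^+ 6))%:E <=
    rho%:E * \int[P \x P]_z
      (Num.max (r e z.1 - r e z.2)%R 0%R ^+ 2 * Num.min 1%R (1 / r e z.1 ^+ 4))%:E)%E ->
  (\esum_(S in [set: {fset half_edge H}]) ((#|` S|%:R ^+ 2)%:E * W S) <=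
   ((1 + 2048 * M ^+ 2 * lam) ^+ 2)%:E *
     \esum_(S in [set S : {fset half_edge H} | S <> fset0%fset]) W S)%E.
Proof.
move=> M0 lam0 lamE rho0 moments ratio_le; apply: eff_res_concentration.
  exact: sqr_ge0.
move=> F Wc a f sub fm f0 mf cf vf vfE w0.
have A0 : 0 <= 2048 * M ^+ 2 * lam.
  exact: mulr_ge0 (mulr_ge0 (ler0n _ _) (sqr_ge0 _)) (ltW lam0).
have fF := min_energy_depends sub fm.
have sq x e (x0 : forall i, 0 < x i) eF := min_energy_sqr_diff sub fm x0 eF (e := e).
have mx x (x0 : forall i, 0 < x i) := min_energy_mixed_diff sub fm x0.
have l2 := level_two_le ind r_gt0 f0 mf fF M0 lam0 lamE moments rho0 ratio_le sq mx cf vfE.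
exact: (sum_card2_moebius_le A0 w0 l2).
Qed.

(** The concentration lemma with [B = 0]: all influences vanish, hence so does every Walsh component
    on a nonempty set. *)
Lemma eff_res_degenerate (N : half_edge H -> R -> R -> \bar R) :
  (forall e, measurable_fun setT (fun z : Omega * Omega => N e (r e z.1) (r e z.2))) ->
  (forall e s t, 0 <= N e s t)%E ->
  (forall e (s t : R), 0 < s -> 0 < t -> s != t -> (0 < N e s t)%E) ->
  (forall e, \int[P \x P]_z N e (r e z.1) (r e z.2) = 0)%E ->
  (\esum_(S in [set: {fset half_edge H}]) ((#|` S|%:R ^+ 2)%:E * W S) <= 0)%E.
Proof.
move=> mN N0 N_gt0 NE.
rewrite -[leRHS](mul0e (\esum_(S in [set S : {fset half_edge H} | S <> fset0%fset]) W S)).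
apply: eff_res_concentration => //.
move=> F Wc a f sub fm f0 mf cf vf vfE w0; rewrite mul0r.
have fF := min_energy_depends sub fm.
have z : \sum_(S <- fpowerset F) #|` S|%:R * moebius vf S = 0.
  rewrite sum_card_moebius big1// => e _.
  by rewrite (degenerate_influence ind r_gt0 f0 mf fF vfE mN N0 N_gt0 (NE e)) subrr.
rewrite big_seq big1// => S SF.
have : #|` S|%:R * moebius vf S == 0.
  rewrite eq_le mulr_ge0// andbT -z (big_fsetD1 S)//= lerDl.
  by apply: sumr_ge0 => T _; rewrite mulr_ge0.
by rewrite expr2 -mulrA => /eqP->; rewrite mulr0.
Qed.

End walsh_eff_res.

(** * The constant *)

Section resistance_law.
Context {R : realType} d (Omega : measurableType d) (P : probability Omega R).
Variable X : {RV P >-> R}.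
Hypothesis X_gt0 : forall w, (0 < X w)%R.
Hypothesis sqr_moment : (\int[P]_w (X w ^+ 2)%:E < +oo)%E.
Local Open Scope ereal_scope.
Let mu := distribution P X.

Lemma ge0_integral_distribution2 (h : R -> R -> \bar R) :
  measurable_fun setT (fun z : R * R => h z.1 z.2) -> (forall x y, 0 <= h x y) ->
  \int[mu \x mu]_z h z.1 z.2 = \int[P \x P]_z h (X z.1) (X z.2).
Proof.
move=> mh h0; have mX : measurable_fun setT X by exact: measurable_funP.
have mXX : measurable_fun setT (fun z : Omega * Omega => h (X z.1) (X z.2)).
  apply: (measurableT_comp (f := fun z : R * R => h z.1 z.2)
    (g := fun z : Omega * Omega => (X z.1, X z.2))) => //.
  apply/measurable_fun_pairP; split.
    by apply: (measurableT_comp mX); exact: measurable_fst.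
  by apply: (measurableT_comp mX); exact: measurable_snd.
rewrite fubini_tonelli1// [RHS]fubini_tonelli1// /fubini_F/=.
rewrite ge0_integral_distribution; last 2 first.
- exact: (measurable_fun_fubini_tonelli_F (m2 := mu) (fun z : R * R => h z.1 z.2)).
- by move=> y; apply: integral_ge0.
apply: eq_integral => w _ /=; rewrite ge0_integral_distribution//.
exact: (measurableT_comp (f := fun z : R * R => h z.1 z.2) mh (pair1_measurable _)).
Qed.

Definition weighted_gap (s t : R) : \bar R := ((s - t) ^+ 2 * (1 / s ^+ 6 + s ^+ 6))%:E.

Definition positive_gap (s t : R) : \bar R :=
  (Num.max (s - t)%R 0%R ^+ 2 * Num.min 1%R (1 / s ^+ 4))%:E.

Lemma weighted_gap_ge0 s t : 0 <= weighted_gap s t.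
Proof.
rewrite lee_fin mulr_ge0 ?sqr_ge0// addr_ge0// ?exprn_even_ge0//.
by rewrite divr_ge0// exprn_even_ge0.
Qed.

Lemma weighted_gap_gt0 (s t : R) : (0 < s)%R -> s != t -> 0 < weighted_gap s t.
Proof.
move=> s0 st; rewrite lte_fin mulr_gt0//.
  by rewrite lt_neqAle sqr_ge0 andbT eq_sym sqrf_eq0 subr_eq0.
by rewrite addr_gt0// ?divr_gt0// exprn_gt0.
Qed.

Lemma positive_gap_ge0 s t : 0 <= positive_gap s t.
Proof.
by rewrite lee_fin mulr_ge0 ?sqr_ge0// le_min ler01/= divr_ge0// exprn_even_ge0.
Qed.

(** The minimum is at most 1, and a number plus its inverse is at least 1. Hence a ratio with
    nonzero numerator is at least 1. *)
Lemma positive_gap_le_weighted_gap (s t : R) : (0 < s)%R -> positive_gap s t <= weighted_gap s t.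
Proof.
move=> s0; rewrite lee_fin ler_pM ?sqr_ge0//.
- by rewrite le_min ler01/= divr_ge0// exprn_even_ge0.
- case: (leP (s - t)%R 0%R) => h; first by rewrite expr0n sqr_ge0.
  by [].
have p6 : (0 < s ^+ 6)%R by rewrite exprn_gt0.
have i6 : (0 < 1 / s ^+ 6)%R by rewrite divr_gt0.
have e1 : (1 / s ^+ 6 * s ^+ 6 = 1)%R by rewrite divfK// gt_eqF.
apply: (@le_trans _ _ 1%R); first by rewrite ge_min lexx.
by nra.
Qed.

Lemma measurable_weighted_gap : measurable_fun setT (fun z : R * R => weighted_gap z.1 z.2).
Proof.
have m1 : measurable_fun setT (fun z : R * R => z.1) by exact: measurable_fst.
have m2 : measurable_fun setT (fun z : R * R => z.2) by exact: measurable_snd.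
apply/measurable_EFinP/measurable_funM; first exact/measurable_funX/measurable_funB.
apply: measurable_funD; last exact: measurable_funX.
apply: measurable_funM => //; apply: (measurableT_comp measurable_invr).
exact: measurable_funX.
Qed.

Lemma measurable_positive_gap : measurable_fun setT (fun z : R * R => positive_gap z.1 z.2).
Proof.
have m1 : measurable_fun setT (fun z : R * R => z.1) by exact: measurable_fst.
have m2 : measurable_fun setT (fun z : R * R => z.2) by exact: measurable_snd.
apply/measurable_EFinP/measurable_funM.
  by apply/measurable_funX/measurable_maxr => //; exact: measurable_funB.
apply: measurable_minr => //; apply: measurable_funM => //.
apply: (measurableT_comp measurable_invr); exact: measurable_funX.
Qed.

Let mpair (h : R -> R -> \bar R) : measurable_fun setT (fun z : R * R => h z.1 z.2) ->
  measurable_fun setT (fun z : Omega * Omega => h (X z.1) (X z.2)).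
Proof.
move=> mh; have mX : measurable_fun setT X by exact: measurable_funP.
apply: (measurableT_comp (f := fun z : R * R => h z.1 z.2)
  (g := fun z : Omega * Omega => (X z.1, X z.2))) => //.
apply/measurable_fun_pairP; split.
  by apply: (measurableT_comp mX); exact: measurable_fst.
by apply: (measurableT_comp mX); exact: measurable_snd.
Qed.

Lemma measurable_weighted_gap_RV :
  measurable_fun setT (fun z : Omega * Omega => weighted_gap (X z.1) (X z.2)).
Proof. exact: mpair measurable_weighted_gap. Qed.

Let N := \int[P \x P]_z weighted_gap (X z.1) (X z.2).
Let D := \int[P \x P]_z positive_gap (X z.1) (X z.2).

Let N0 : 0 <= N.
Proof. by apply: integral_ge0 => z _; exact: weighted_gap_ge0. Qed.

Let D0 : 0 <= D.
Proof. by apply: integral_ge0 => z _; exact: positive_gap_ge0. Qed.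

Let D_le_N : D <= N.
Proof.
apply: ge0_le_integral => //.
- by move=> z _; exact: positive_gap_ge0.
- exact: mpair measurable_positive_gap.
- exact: mpair measurable_weighted_gap.
by move=> z _; exact: positive_gap_le_weighted_gap.
Qed.

(** The positive part of [s - t] is at most [s] for positive [t], so the second moment dominates. An
    infinite denominator would make the ratio 0. *)
Let D_lty : D < +oo.
Proof.
have mX2 : measurable_fun setT (fun z : Omega * Omega => (X z.1 ^+ 2)%:E).
  apply/measurable_EFinP/measurable_funX.
  by apply: (measurableT_comp (f := X)) => //; exact: measurable_fst.
apply: (@le_lt_trans _ _ (\int[P \x P]_z (X z.1 ^+ 2)%:E)).
  apply: ge0_le_integral => //.
  - by move=> z _; exact: positive_gap_ge0.
  - exact: mpair measurable_positive_gap.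
  move=> z _; rewrite lee_fin -[leRHS]mulr1.
  have X1 := X_gt0 z.1; have X2 := X_gt0 z.2.
  rewrite ler_pM ?sqr_ge0//.
  - by rewrite le_min ler01/= divr_ge0// exprn_even_ge0.
  - rewrite ler_pXn2r// ?nnegrE ?le_max ?lexx ?orbT//; last exact: ltW.
    by rewrite ge_max (ltW X1) andbT gerBl ltW.
  - by rewrite ge_min lexx.
rewrite fubini_tonelli1//; last by move=> z; rewrite lee_fin sqr_ge0.
rewrite /fubini_F/=; under eq_integral do rewrite integral_cst//= probability_setT mule1.
exact: sqr_moment.
Qed.

Lemma ratioE (I : Type) (nu : I -> probability R R) i : nu i = mu ->
  Defs.ratio nu i = N / D.
Proof.
move=> nui; rewrite /Defs.ratio nui (ge0_integral_distribution2 measurable_weighted_gap)//; last exact: weighted_gap_ge0.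
by rewrite (ge0_integral_distribution2 measurable_positive_gap)//; exact: positive_gap_ge0.
Qed.

Lemma ratio_ge0 : 0 <= N / D.
Proof. by rewrite mule_ge0// inve_ge0. Qed.

Lemma ratio_ge1 : 0 < N -> 1 <= N / D.
Proof.
move=> Np; have [->|Dn0] := eqVneq D 0; first by rewrite inve0 gt0_muley// leey.
have Dfin : D \is a fin_num by rewrite ge0_fin_numE.
have -> : 1 = D / D by rewrite divee.
by rewrite lee_wpmul2r// inve_ge0.
Qed.

(** If [D] vanishes, a finite quotient forces [N] to vanish too, since the inverse of 0 is [+oo]. *)
Lemma ratio_leP (rho : R) : N / D <= rho%:E -> N <= rho%:E * D.
Proof.
have [->|Dn0] := eqVneq D 0.
  rewrite inve0 mule0; have [->//|Nn0] := eqVneq N 0.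
  by rewrite gt0_muley ?lt_def ?Nn0// leye_eq.
have Dfin : D \is a fin_num by rewrite ge0_fin_numE.
move=> h; rewrite -[leLHS]mule1 -(divee Dfin Dn0) (muleC D) muleA.
by rewrite lee_wpmul2r.
Qed.

Lemma moment8E : 'E_mu[(fun x : R => x ^+ 8)%R] = \int[P]_w (X w ^+ 8)%:E.
Proof.
rewrite unlock ge0_integral_distribution// => [|y]; first exact/measurable_EFinP/measurable_funX.
by rewrite lee_fin exprn_even_ge0.
Qed.

Lemma momentN8E : 'E_mu[(fun x : R => x ^- 8)%R] = \int[P]_w (X w ^- 8)%:E.
Proof.
rewrite unlock ge0_integral_distribution// => [|y].
  apply/measurable_EFinP; apply: (measurableT_comp measurable_invr); exact: measurable_funX.
by rewrite lee_fin invr_ge0 exprn_even_ge0.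
Qed.

(** A positive number and its inverse sum to at least 2. This keeps the moments above 1, as
    absorbing constants requires. *)
Lemma moments_ge2 : 2%:E <= \int[P]_w (X w ^+ 8)%:E + \int[P]_w (X w ^- 8)%:E.
Proof.
have mX : measurable_fun setT X by exact: measurable_funP.
have m1 : measurable_fun setT (fun w => (X w ^+ 8)%:E) by exact/measurable_EFinP/measurable_funX.
have m2 : measurable_fun setT (fun w => (X w ^- 8)%:E).
  by apply/measurable_EFinP; apply: (measurableT_comp measurable_invr); exact: measurable_funX.
have p1 w : 0 <= (X w ^+ 8)%:E by rewrite lee_fin exprn_even_ge0.
have p2 w : 0 <= (X w ^- 8)%:E by rewrite lee_fin invr_ge0 exprn_even_ge0.
rewrite -(ge0_integralD P measurableT (fun w _ => p1 w) m1 (fun w _ => p2 w) m2).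
apply: (@le_trans _ _ (\int[P]_w 2%:E)).
  by rewrite integral_cst//= probability_setT mule1.
apply: ge0_le_integral => //.
- by apply: emeasurable_funD.
move=> w _; rewrite -EFinD lee_fin.
have q : (0 < X w ^+ 8)%R by rewrite exprn_gt0.
have e : (X w ^+ 8 * (X w ^- 8) = 1)%R by rewrite mulfV// gt_eqF.
have i : (0 < X w ^- 8)%R by rewrite invr_gt0.
move: (X w ^+ 8)%R (X w ^- 8)%R q e i => a b a0 ab b0.
have := mulr_ge0 (ltW b0) (sqr_ge0 (a - 1)%R).
have -> : (b * (a - 1) ^+ 2 = a * (a * b) - 2 * (a * b) + b)%R by ring.
by rewrite ab; lra.
Qed.

End resistance_law.

(** Markov's inequality for the square of the cardinal. *)
Lemma esum_tail_le (R : realType) (J : choiceType) (W : {fset J} -> \bar R) (k : nat)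
  (B : \bar R) : (0 < k)%N -> (forall S, 0 <= W S)%E ->
  (\esum_(S in [set: {fset J}]) ((#|` S|%:R ^+ 2)%:E * W S) <= B)%E ->
  (\esum_(S in [set S : {fset J} | (k <= #|` S|)%N]) W S <= B * ((k%:R ^+ 2)%:E)^-1)%E.
Proof.
move=> k0 W0 HB; have kp : 0 < k%:R ^+ 2 :> R by rewrite exprn_gt0// ltr0n.
rewrite inver gt_eqF//; set c := (_ ^-1).
have c0 : 0 < c by rewrite invr_gt0.
apply: ub_ereal_sup => _ [X [finX XS] <-].
apply: (@le_trans _ _ (\sum_(S \in X) (c%:E * ((#|` S|%:R ^+ 2)%:E * W S)))%E); last first.
  rewrite -ge0_mule_fsumr; last by move=> S; rewrite mule_ge0// lee_fin sqr_ge0.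
  rewrite muleC; apply: lee_wpmul2r; first by rewrite lee_fin ltW.
  apply: le_trans HB; apply: esum_ge.
  by exists X.
rewrite !fsbig_finite//= big_seq [leRHS]big_seq; apply: lee_sum => S.
rewrite in_fset_set// inE => /XS /= kS; rewrite muleA -EFinM -[leLHS]mul1e.
rewrite lee_wpmul2r// lee_fin mulrC ler_pdivlMr// mul1r.
by rewrite ler_pXn2r ?nnegrE ?ler0n// ler_nat.
Qed.

(** Since [m ^+ 2 * l] is at least 1, it absorbs the summand 1; its square is [m^5 q], and [m >= 1]
    raises the exponent to 6. *)
Lemma absorb_constant (R : realType) (c m q l : R) : 0 <= c -> 1 <= m -> 1 <= q ->
  0 <= l -> l ^+ 2 = m * q ->
  (1 + c * m ^+ 2 * l) ^+ 2 <= (1 + c) ^+ 2 * m ^+ 6 * q.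
Proof.
move=> c0 m1 q1 l0 lE; have m0 : 0 <= m by exact: le_trans m1.
have mq1 : 1 <= m * q by rewrite mulr_ege1.
have l1 : 1 <= l by rewrite -(ler_pXn2r (n := 2)) ?nnegrE// lE expr1n.
have x1 : 1 <= m ^+ 2 * l by rewrite mulr_ege1// exprn_ege1.
have -> : (1 + c) ^+ 2 * m ^+ 6 * q = (1 + c) ^+ 2 * m ^+ 4 * m * (m * q) by ring.
rewrite -lE; apply: (@le_trans _ _ (((1 + c) * (m ^+ 2 * l)) ^+ 2)).
  rewrite -mulrA; move: (m ^+ 2 * l) x1 => x x1.
  have x0 : 0 <= x by exact: le_trans x1.
  have b : 0 <= c * x by rewrite mulr_ge0.
  by rewrite ler_pXn2r ?nnegrE ?mulr_ge0 ?addr_ge0//; lra.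
have -> : ((1 + c) * (m ^+ 2 * l)) ^+ 2 = (1 + c) ^+ 2 * m ^+ 4 * l ^+ 2 by ring.
rewrite ler_wpM2r ?sqr_ge0// ler_peMr// mulr_ge0 ?sqr_ge0//.
exact: exprn_ge0.
Qed.

Theorem theorem3p5 (R : realType) :
  exists C : R, 0 < C /\
  forall (G : graph) (H : pred (edge G)), is_half H ->
  forall (d : measure_display) (Omega : measurableType d)
    (P : probability Omega R) (r : half_edge H -> {RV P >-> R}),
    (forall e w, 0 < r e w) ->
    (forall e, ('E_P[(fun w => r e w ^+ 2)%R] < +oo)%E) ->
    mutually_independent r ->
  let K := Kconst (fun e => distribution P (r e)) C in
  forall u v : G, u <> v ->
  let f := fun w => eff_res u v (fun e => r e w) in
  let W := fun S : {fset half_edge H} => sqnorm2 P (walsh r f S) in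
  (\esum_(S in [set: {fset half_edge H}]) ((#|` S|%:R ^+ 2)%:E * W S) <=
     K * \esum_(S in [set S : {fset half_edge H} | S <> fset0%fset]) W S)%E /\
  (forall k : nat, (1 <= k)%N ->
   \esum_(S in [set S : {fset half_edge H} | (k <= #|` S|)%N]) W S <=
     K / (k%:R ^+ 2)%:E *
     \esum_(S in [set S : {fset half_edge H} | S <> fset0%fset]) W S)%E.
Proof.
have c0 : 0 <= 2048 :> R by exact: ler0n.
have C0' : 0 < (1 + 2048) ^+ 2 :> R by exact: exprn_gt0 (ltr_wpDr c0 ltr01).
(* The value [(1 + c)^2] of [absorb_constant], for the constant 2048 of [level_two_le]. *)
pose C : R := (1 + 2048) ^+ 2; have CE : C = (1 + 2048) ^+ 2 by [].
rewrite -CE in C0'; clearbody C; exists C; split=> //.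
have C0 : (0 < C%:E)%E by rewrite lte_fin.
move=> G H half d Omega P r r_gt0 sqr_moment ind K u v uv f W.
have sqm e : (\int[P]_w (r e w ^+ 2)%:E < +oo)%E by have := sqr_moment e; rewrite unlock.
have W0 S : (0 <= W S)%E.
  by rewrite /W sqnorm2E; apply: integral_ge0 => w _; rewrite lee_fin sqr_ge0.
set Sg := (\esum_(S in [set S : {fset half_edge H} | S <> fset0%fset]) W S)%E.
have Sg0 : (0 <= Sg)%E by apply: esum_ge0 => S _.
suff main : (\esum_(S in [set: {fset half_edge H}]) ((#|` S|%:R ^+ 2)%:E * W S) <= K * Sg)%E.
  by split=> // k k1; rewrite muleAC; exact: esum_tail_le main.
have [p up pv] := adj_connected u v.
(* Distinct vertices in a connected graph give an edge, so the suprema are over a nonempty set. *)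
have [e0] : inhabited (half_edge H).
  case: p up pv => [_ uv'|y p /= /andP[uy _] _]; first by case: uv.
  have := half (exist _ (u, y) uy); set e := exist _ _ _.
  have [He _|_ /= Ho] := boolP (H e); first by constructor; exists e.
  by constructor; exists (opp_edge e).
pose M e := (\int[P]_w (r e w ^+ 8)%:E + \int[P]_w (r e w ^- 8)%:E)%E.
pose N e := (\int[P \x P]_z weighted_gap (r e z.1) (r e z.2))%E.
pose D e := (\int[P \x P]_z positive_gap (r e z.1) (r e z.2))%E.
pose MM := ereal_sup [set M e | e in [set: half_edge H]].
pose rho := ereal_sup [set (N e / D e)%E | e in [set: half_edge H]].
have MME : MM = ereal_sup [set ('E_(distribution P (r e))[(fun x : R => x ^+ 8)%R] +
    'E_(distribution P (r e))[(fun x : R => x ^- 8)%R])%E | e in [set: half_edge H]].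
  by congr ereal_sup; apply: eq_imagel => e _; rewrite moment8E momentN8E.
have rhoE : rho = ereal_sup [set Defs.ratio (fun e => distribution P (r e)) e |
    e in [set: half_edge H]].
  congr ereal_sup; apply: eq_imagel => e _; apply/esym; exact: ratioE.
have KE : K = (C%:E * MM ^+ 6 * rho)%E by rewrite MME rhoE.
have MM2 : (2%:E <= MM)%E.
  by apply: (le_trans (moments_ge2 (r_gt0 e0))); apply: ereal_sup_ubound; exists e0.
have rho0 : (0 <= rho)%E.
  by apply: (le_trans (ratio_ge0 (r e0))); apply: ereal_sup_ubound; exists e0.
have MM0 : (0 < MM)%E by apply: lt_le_trans MM2; rewrite lte_fin.
(* If all resistances are deterministic, each ratio is [0 / 0 = 0], so [K] is 0 whatever the moments
   are, and the left-hand side must vanish. *)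
have [Nz|] := pselect (forall e, N e = 0%E).
  apply: (@le_trans _ _ 0%E); last first.
    rewrite KE; apply: (mule_ge0 _ Sg0); apply: (mule_ge0 _ rho0).
    exact: mule_ge0 (ltW C0) (expe_ge0 _ (ltW MM0)).
  apply: (eff_res_degenerate half ind r_gt0 sqm u v (N := fun=> @weighted_gap R)) => //.
  - by move=> e; exact: measurable_weighted_gap_RV.
  - by move=> _ s t; exact: weighted_gap_ge0.
  - by move=> _ s t s0 _; exact: weighted_gap_gt0.
move=> /existsNP[e1 /eqP Ne1].
have rho1 : (1 <= rho)%E.
  apply: (@le_trans _ _ (N e1 / D e1)%E); last by apply: ereal_sup_ubound; exists e1.
  apply: (ratio_ge1 (r_gt0 e1) (sqm e1)); rewrite lt_def Ne1/=.
  by apply: integral_ge0 => z _; exact: weighted_gap_ge0.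
(* When the sum on the right is 0, an infinite [K] gives no bound; but then all components on
   nonempty sets vanish and the empty set has weight 0. *)
have [Sgz|Sgn] := eqVneq Sg 0%E.
  have Wz S : S <> fset0 -> W S = 0%E.
    move=> S0; apply/eqP; rewrite eq_le W0 andbT -Sgz; apply: esum_ge.
    by exists [set S]; [split=> // _ ->|rewrite fsbig_set1].
  rewrite Sgz mule0 esum1// => S _; have [->|/eqP S0] := eqVneq S fset0.
    by rewrite cardfs0 expr0n mul0e.
  by rewrite Wz// mule0.
have Sgp : (0 < Sg)%E by rewrite lt_def Sgn.
(* The other factors are now positive, so an infinite supremum makes the right-hand side
   infinite. *)
have [MMy|MMny] := eqVneq MM +oo%E.
  suff -> : K = +oo%E by rewrite gt0_mulye// leey.
  rewrite KE MMy (_ : +oo ^+ 6 = +oo)%E//.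
  by rewrite gt0_muley// gt0_mulye// (lt_le_trans _ rho1).
have MMfin : MM = (fine MM)%:E by rewrite fineK// ge0_fin_numE ?ltW// lt_neqAle MMny leey.
have [rhoy|rhony] := eqVneq rho +oo%E.
  suff -> : K = +oo%E by rewrite gt0_mulye// leey.
  by rewrite KE rhoy gt0_muley// mule_gt0// expe_gt0.
have rhofin : rho = (fine rho)%:E by rewrite fineK// ge0_fin_numE// lt_neqAle rhony leey.
move: MM2 rho1 KE; rewrite MMfin rhofin !lee_fin; set m := fine MM; set q := fine rho.
move=> m2 q1 KE.
have m0 : 0 < m by rewrite (lt_le_trans _ m2).
have q0 : 0 < q by rewrite (lt_le_trans _ q1).
have mq0 : 0 < m * q by exact: mulr_gt0.
have lam2 : Num.sqrt (m * q) ^+ 2 = m * q by rewrite sqr_sqrtr// ltW.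
have lam0 : 0 < Num.sqrt (m * q) by rewrite sqrtr_gt0.
have h1 e : (\int[P]_w (r e w ^+ 8)%:E + \int[P]_w (r e w ^- 8)%:E <= m%:E)%E.
  by rewrite -MMfin; apply: ereal_sup_ubound; exists e.
have h2 e : (N e <= q%:E * D e)%E.
  apply: (ratio_leP (r_gt0 e) (sqm e)); rewrite -rhofin.
  by apply: ereal_sup_ubound; exists e.
have le2 : m * q <= Num.sqrt (m * q) ^+ 2 by rewrite lam2.
have main := eff_res_card2_le half ind r_gt0 sqm u v m0 lam0 le2 (ltW q0) h1 h2.
apply: (le_trans main); rewrite lee_wpmul2r// KE -EFin_expe -!EFinM lee_fin.
rewrite CE; apply: absorb_constant => //.
by apply: le_trans m2; rewrite ler1n.
Qed.
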